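(* Let $\rho:B\twoheadrightarrow\Gamma$ be a Fell bundle over an étale groupoid $\Gamma$. Then $\mathcal{S}^\rho_{\mathsf b}$ (with norm $\|\cdot\|_{\mathsf b}$, involution $a^*(\gamma)=a(\gamma^{-1})^*$ and actions given by convolution) is a Banach *-bimodule over $\mathcal{B}^\rho$.
   Context: Groupoids. For a groupoid $\Gamma$, $\mathsf{s}(\gamma)=\gamma^{-1}\gamma$, $\mathsf{r}(\gamma)=\gamma\gamma^{-1}$, $\Gamma^0\subseteq\Gamma$ is the set of units, and $\Gamma^2$ is the set of composable pairs ($(\alpha,\beta)\in\Gamma^2$ iff $\mathsf{s}(\alpha)=\mathsf{r}(\beta)$). For $x\in\Gamma^0$, $\Gamma x=\{\gamma:\mathsf{s}(\gamma)=x\}$. An étale groupoid is a groupoid with a topology making product and inverse continuous and such that $\mathsf{s}$ is an open map. No Hausdorff, local compactness or countability assumption is made, even on $\Gamma^0$. Fell bundles. A semigroupoid is a set with a partial binary operation such that $(ab)c$ is defined iff $a(bc)$ is, in which case they are equal; a *-semigroupoid also has an involution with $a^{**}=a$ and $(ab)^*=b^*a^*$ whenever $ab$ is defined. A Banach bundle is an open continuous surjection $\rho:B\twoheadrightarrow X$ of topological spaces such that each fibre $B_x=\rho^{-1}\{x\}$ is a complex Banach space (zero $0_x$); for each $\lambda\in\mathbb{C}$, $b\mapsto\lambda b$ is continuous on $B$; addition is continuous on $\{(a,b):\rho(a)=\rho(b)\}$; the norm is upper semicontinuous on $B$; and $\rho(b_\lambda)\to x$, $\|b_\lambda\|\to0$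 imply $b_\lambda\to0_x$ for nets. A Fell bundle is a Banach bundle $\rho:B\twoheadrightarrow\Gamma$ such that: (1) $B$ is a *-semigroupoid with continuous product and involution, products are bilinear and $*$ is antilinear; (2) the norm is submultiplicative, $\Gamma$ is an étale groupoid, $ab$ is defined iff $(\rho(a),\rho(b))\in\Gamma^2$, in which case $\rho(ab)=\rho(a)\rho(b)$, and $\rho(a^* )=\rho(a)^{-1}$; (3) for all $b\in B$, $\|b^*b\|=\|b\|^2$ and there is $a\in B_{\rho(b^*b)}$ with $a^*a=b^*b$. Sections. $\mathcal{S}^\rho$ is the vector space (pointwise operations) of all, possibly discontinuous, sections $a:\Gamma\to B$, $\rho\circ a=\mathrm{id}_\Gamma$. Put $\mathrm{supp}(a)=\{\gamma:a(\gamma)\ne0_\gamma\}$ and $a^*(\gamma)=a(\gamma^{-1})^*$. The convolution $ab(\gamma)=\sum_{\gamma=\alpha\beta}a(\alpha)b(\beta)$ is ''defined'' if for every $\gamma\in\Gamma$ the net of finite partial sums converges in norm in $B_\gamma$. $\mathcal{F}^\rho$ denotes the finitely supported sections. Define $[0,\infty]$-valued norms by $$\|a\|_2=\sup_{x\in\Gamma^0}\ \sup_{F\subseteq\Gamma x\text{ finite}}\Big\|\sum_{\gamma\in F}a(\gamma)^*a(\gamma)\Big\|^{1/2},\qquad \|a\|_{\mathsf b}=\sup_{f\in\mathcal{F}^\rho}\frac{\|af\|_2}{\|f\|_2}\quad(0/0=0).$$ Let $\mathcal{S}^\rho_{\mathsf b}=\{a\in\mathcal{S}^\rho:\|a\|_{\mathsf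 b}<\infty\}$. The big C*-algebra is $\mathcal{B}^\rho=\{a\in\mathcal{S}^\rho_{\mathsf b}:a^*a\text{ and }aa^*\text{ are defined}\}$, with convolution, $*$ and norm $\|\cdot\|_{\mathsf b}$. Bimodules. A bimodule $M$ over an algebra $A$ is a Banach bimodule if $M$ and $A$ are Banach spaces with $\|ab\|\le\|a\|\|b\|$ whenever $a$ and/or $b$ are in $A$ (and the other, if not in $A$, is in $M$). It is a Banach *-bimodule if moreover $M$ and $A$ carry involutions with $\|a^*\|=\|a\|$ and $(ab)^*=b^*a^*$ whenever $a$ and/or $b$ are in $A$. Here $A\subseteq M$, with the Banach space structure and involution on $A$ induced from $M$. *)

(* Defs.v *)
From HB Require Import structures.
From mathcomp Require Import all_boot all_order all_algebra.
From mathcomp Require Import finmap complex.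
From mathcomp Require Import all_classical all_reals all_analysis.
From mathcomp.analysis.showcase Require summability.

Set Implicit Arguments.
Unset Strict Implicit.
Unset Printing Implicit Defensive.

Import Order.TTheory GRing.Theory Num.Theory.
Import numFieldNormedType.Exports.

Local Open Scope classical_set_scope.
Local Open Scope complex_scope.
Local Open Scope ring_scope.

(* Partial binary operations are given by a total function together with a
   domain of definition; the values of the function outside of the domain are
   arbitrary and no axiom refers to them. *)

Record is_semigroupoid (S : Type) (dom : S -> S -> Prop) (mul : S -> S -> S) :
    Prop := {
  semigroupoid_dom : forall a b c,
    dom a b /\ dom (mul a b) c <-> dom b c /\ dom a (mul b c) ;
  semigroupoid_mulA : forall a b c, dom a b -> dom (mul a b) c ->
    mul (mul a b) c = mul a (mul b c) }.

Record is_star_semigroupoid (S : Type) (dom : S -> S -> Prop)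
    (mul : S -> S -> S) (star : S -> S) : Prop := {
  star_semigroupoid_semigroupoid : is_semigroupoid dom mul ;
  star_semigroupoid_starK : forall a, star (star a) = a ;
  star_semigroupoid_starM : forall a b, dom a b ->
    dom (star b) (star a) /\ star (mul a b) = mul (star b) (star a) }.

Definition composable_for (G : Type) (mul : G -> G -> G) (inv : G -> G)
  (a b : G) : Prop := mul (inv a) a = mul b (inv b).

(* Small categories in which every arrow is invertible, in terms of arrows. *)
Record is_groupoid (G : Type) (mul : G -> G -> G) (inv : G -> G) : Prop := {
  groupoid_invK : forall a, inv (inv a) = a ;
  groupoid_source_mul : forall a b, composable_for mul inv a b ->
    mul (inv (mul a b)) (mul a b) = mul (inv b) b ;
  groupoid_range_mul : forall a b, composable_for mul inv a b ->
    mul (mul a b) (inv (mul a b)) = mul a (inv a) ;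
  groupoid_mulA : forall a b c,
    composable_for mul inv a b -> composable_for mul inv b c ->
    mul (mul a b) c = mul a (mul b c) ;
  groupoid_mul_source : forall a, mul a (mul (inv a) a) = a ;
  groupoid_mul_range : forall a, mul (mul a (inv a)) a = a }.

(* The source map is required to be open as a map from the groupoid to itself:
   openness onto the subspace of units would not give an etale groupoid. *)
Record etaleGroupoid := EtaleGroupoid {
  arrows :> topologicalType ;
  gmul : arrows -> arrows -> arrows ;
  ginv : arrows -> arrows ;
  gmul_groupoid : is_groupoid gmul ginv ;
  gmul_continuous : {within
    [set p : arrows * arrows | composable_for gmul ginv p.1 p.2],
    continuous (fun p => gmul p.1 p.2)} ;
  ginv_continuous : continuous ginv ;
  gsource_open : forall U : set arrows, open U ->
    open ((fun a => gmul (ginv a) a) @` U) }.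

Section Groupoid.
Variable G : etaleGroupoid.

Definition gsource (a : G) : G := gmul (ginv a) a.
Definition composable (a b : G) : Prop := composable_for (@gmul G) (@ginv G) a b.
Definition gunits : set G := [set x | gsource x = x].

(* The pairs over which the convolution sums range. *)
Definition factorizations (g : G) : set (G * G) :=
  [set p | composable p.1 p.2 /\ gmul p.1 p.2 = g].

End Groupoid.

(* The norm of a normed module over R[i] takes its values in R[i]; this is the
   same norm with values in R. *)
Definition cnorm (R : realType) (V : normedModType R[i]) (v : V) : R :=
  complex.Re `|v|.

(* A map whose fibres carry a Banach space structure: the Banach space
   [fibre x] is identified with the preimage of x by the bijection [fibre_incl]. *)
Record banachFibration (R : realType) (X : topologicalType) := BanachFibration {
  btotal :> topologicalType ;
  bproj : btotal -> X ;
  fibre : X -> completeNormedModType R[i] ;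
  fibre_incl : forall x, fibre x -> btotal ;
  fibre_incl_inj : forall x, injective (@fibre_incl x) ;
  range_fibre_incl : forall x, range (@fibre_incl x) = bproj @^-1` [set x] }.

Arguments fibre_incl {R X} _ {x} _.

Section Fibration.
Variables (R : realType) (X : topologicalType) (B : banachFibration R X).

(* The element of the fibre at x that b stands for, with value 0 when b does
   not lie over x. *)
Definition at_fibre (x : X) (b : B) : fibre B x :=
  xget 0 [set v | fibre_incl B v = b].

Definition bscale (l : R[i]) (b : B) : B :=
  fibre_incl B (l *: at_fibre (bproj b) b).

Definition badd (p : B * B) : B :=
  fibre_incl B (at_fibre (bproj p.1) p.1 + at_fibre (bproj p.1) p.2).

Definition bnorm (b : B) : R := cnorm (at_fibre (bproj b) b).

End Fibration.

Definition upper_semicontinuous (R : realType) (T : topologicalType)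
  (f : T -> R) : Prop :=
  forall x r, f x < r -> \forall y \near x, f y < r.

(* In [norm0_cvg], proper filters on the total space play the role of nets. *)
Record banachBundle (R : realType) (X : topologicalType) := BanachBundle {
  bfibration :> banachFibration R X ;
  bproj_open : forall U : set bfibration, open U ->
    open (@bproj _ _ bfibration @` U) ;
  bproj_continuous : continuous (@bproj _ _ bfibration) ;
  bproj_surjective : range (@bproj _ _ bfibration) = setT ;
  bscale_continuous : forall l : R[i], continuous (@bscale _ _ bfibration l) ;
  badd_continuous : {within
    [set p : bfibration * bfibration | bproj p.1 = bproj p.2],
    continuous (@badd _ _ bfibration)} ;
  bnorm_usc : upper_semicontinuous (@bnorm _ _ bfibration) ;
  norm0_cvg : forall (x : X) (F : set_system bfibration), ProperFilter F ->
    bproj b @[b --> F] --> x -> bnorm b @[b --> F] --> (0 : R) ->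
    F --> fibre_incl bfibration (0 : fibre bfibration x) }.

Record fellBundle (R : realType) (G : etaleGroupoid) := FellBundle {
  fbundle :> banachBundle R G ;
  bmul : fbundle -> fbundle -> fbundle ;
  bstar : fbundle -> fbundle ;
  bmul_star_semigroupoid : is_star_semigroupoid
    (fun a b => composable (bproj a) (bproj b)) bmul bstar ;
  bmul_continuous : {within
    [set p : fbundle * fbundle | composable (bproj p.1) (bproj p.2)],
    continuous (fun p => bmul p.1 p.2)} ;
  bstar_continuous : continuous bstar ;
  bmul_linearl : forall (g h : G) (l : R[i]) (u v : fibre fbundle g)
      (w : fibre fbundle h), composable g h ->
    at_fibre (gmul g h) (bmul (fibre_incl _ (l *: u + v)) (fibre_incl _ w)) =
    l *: at_fibre (gmul g h) (bmul (fibre_incl _ u) (fibre_incl _ w))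
    + at_fibre (gmul g h) (bmul (fibre_incl _ v) (fibre_incl _ w)) ;
  bmul_linearr : forall (g h : G) (l : R[i]) (w : fibre fbundle g)
      (u v : fibre fbundle h), composable g h ->
    at_fibre (gmul g h) (bmul (fibre_incl _ w) (fibre_incl _ (l *: u + v))) =
    l *: at_fibre (gmul g h) (bmul (fibre_incl _ w) (fibre_incl _ u))
    + at_fibre (gmul g h) (bmul (fibre_incl _ w) (fibre_incl _ v)) ;
  bstar_antilinear : forall (g : G) (l : R[i]) (u v : fibre fbundle g),
    at_fibre (ginv g) (bstar (fibre_incl _ (l *: u + v))) =
    l^* *: at_fibre (ginv g) (bstar (fibre_incl _ u))
    + at_fibre (ginv g) (bstar (fibre_incl _ v)) ;
  bnormM : forall a b : fbundle, composable (bproj a) (bproj b) ->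
    bnorm (bmul a b) <= bnorm a * bnorm b ;
  bprojM : forall a b : fbundle, composable (bproj a) (bproj b) ->
    bproj (bmul a b) = gmul (bproj a) (bproj b) ;
  bproj_star : forall a : fbundle, bproj (bstar a) = ginv (bproj a) ;
  bnorm_starM : forall b : fbundle, bnorm (bmul (bstar b) b) = bnorm b ^+ 2 ;
  bstarM_square : forall b : fbundle, exists a : fbundle,
    bproj a = bproj (bmul (bstar b) b) /\
    bmul (bstar a) a = bmul (bstar b) b }.

Section Sections.
Variables (R : realType) (X : topologicalType) (B : banachBundle R X).

(* All sections, whether or not continuous. *)
Definition sections : Type := forall x : X, fibre B x.

HB.instance Definition _ := gen_eqMixin sections.
HB.instance Definition _ := gen_choiceMixin sections.

Let sadd (a b : sections) : sections := fun x => a x + b x.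
Let sopp (a : sections) : sections := fun x => - a x.
Let szero : sections := fun x => 0.
Let sscale (l : R[i]) (a : sections) : sections := fun x => l *: a x.

Let saddA : associative sadd.
Proof. by move=> a b c; apply: functional_extensionality_dep => x; rewrite /sadd addrA. Qed.
Let saddC : commutative sadd.
Proof. by move=> a b; apply: functional_extensionality_dep => x; rewrite /sadd addrC. Qed.
Let sadd0 : left_id szero sadd.
Proof. by move=> a; apply: functional_extensionality_dep => x; rewrite /sadd add0r. Qed.
Let saddN : left_inverse szero sopp sadd.
Proof. by move=> a; apply: functional_extensionality_dep => x; rewrite /sadd addNr. Qed.

HB.instance Definition _ :=
  GRing.isZmodule.Build sections saddA saddC sadd0 saddN.

Let sscaleA l m a : sscale l (sscale m a) = sscale (l * m) a.
Proof. by apply: functional_extensionality_dep => x; rewrite /sscale scalerA. Qed.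
Let sscale1 : left_id 1 sscale.
Proof. by move=> a; apply: functional_extensionality_dep => x; rewrite /sscale scale1r. Qed.
Let sscaleDr : right_distributive sscale +%R.
Proof. by move=> l a b; apply: functional_extensionality_dep => x; apply: scalerDr. Qed.
Let sscaleDl a : {morph sscale^~ a : l m / l + m}.
Proof. by move=> l m; apply: functional_extensionality_dep => x; apply: scalerDl. Qed.

HB.instance Definition _ :=
  GRing.Zmodule_isLmodule.Build R[i] sections sscaleA sscale1 sscaleDr sscaleDl.

Definition ssupp (a : sections) : set X := [set x | a x != 0].

Definition fin_supported : set sections := [set a | finite_set (ssupp a)].

End Sections.

Section Convolution.
Variables (R : realType) (G : etaleGroupoid) (B : fellBundle R G).
Implicit Types a b f : sections B.

Definition sstar a : sections B :=
  fun g => at_fibre g (bstar (fibre_incl B (a (ginv g)))).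

Definition convolution_term a b (g : G) (p : factorizations g) : fibre B g :=
  at_fibre g (bmul (fibre_incl B (a (val p).1)) (fibre_incl B (b (val p).2))).

(* The net of partial sums over the finite subsets of [factorizations g]
   converges in norm, for each g. *)
Definition convolution_defined a b : Prop := forall g : G,
  cvg (summability.partial_sum (@convolution_term a b g) @ summability.totally).

(* Only meaningful at g if the net of partial sums converges there. *)
Definition convolution a b : sections B :=
  fun g => summability.sum (@convolution_term a b g).

(* The maximum with 0 only matters for the empty groupoid. *)
Definition norm2 a : \bar R :=
  Order.max 0%E (ereal_sup [set ereal_sup
    [set (Num.sqrt (cnorm
       (\sum_(g <- F) at_fibre x (bmul (bstar (fibre_incl B (a g))) (fibre_incl B (a g))))))%:E
     | F in [set F : {fset G} | forall g, g \in F -> gsource g = x]]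
   | x in @gunits G]).

(* In \bar R, the convention 0 / 0 = 0 holds since 0 / 0 = 0 * +oo = 0. *)
Definition normb a : \bar R :=
  ereal_sup [set (norm2 (convolution a f) / norm2 f)%E | f in @fin_supported _ _ B].

Definition bounded_sections : set (sections B) :=
  [set a | (normb a < +oo)%E].

Definition big_algebra : set (sections B) :=
  [set a | [/\ bounded_sections a, convolution_defined (sstar a) a
             & convolution_defined a (sstar a)]].

End Convolution.

(* Algebras A and bimodules M with A `<=` M, inside an ambient vector space V
   with a (possibly infinite) norm N, an involution and a product that are only
   relevant on the elements of M, resp. on the pairs of elements of M at least
   one of which is in A. The product gives the product of A and both actions. *)
Section Bimodules.
Variables (R : realType) (V : lmodType R[i]).
Variables (N : V -> \bar R) (star : V -> V) (mul : V -> V -> V).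

Definition is_subspace (S : set V) : Prop :=
  S 0 /\ forall (l : R[i]) u v, S u -> S v -> S (l *: u + v).

Definition is_banach_space (S : set V) : Prop :=
  exists (W : completeNormedModType R[i]) (i : {linear W -> V}),
    [/\ injective i, range i = S & forall w, N (i w) = (cnorm w)%:E].

Record is_algebra (A : set V) : Prop := {
  algebra_subspace : is_subspace A ;
  algebra_mul : forall a b, A a -> A b -> A (mul a b) ;
  algebra_linearl : forall (l : R[i]) a b c, A a -> A b -> A c ->
    mul (l *: a + b) c = l *: mul a c + mul b c ;
  algebra_linearr : forall (l : R[i]) a b c, A a -> A b -> A c ->
    mul c (l *: a + b) = l *: mul c a + mul c b ;
  algebra_mulA : forall a b c, A a -> A b -> A c ->
    mul (mul a b) c = mul a (mul b c) }.

Record is_bimodule (A M : set V) : Prop := {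
  bimodule_subspace : is_subspace M ;
  bimodule_mull : forall a m, A a -> M m -> M (mul a m) ;
  bimodule_mulr : forall m a, M m -> A a -> M (mul m a) ;
  bimodule_mull_linearl : forall (l : R[i]) a b m, A a -> A b -> M m ->
    mul (l *: a + b) m = l *: mul a m + mul b m ;
  bimodule_mull_linearr : forall (l : R[i]) a m n, A a -> M m -> M n ->
    mul a (l *: m + n) = l *: mul a m + mul a n ;
  bimodule_mulr_linearl : forall (l : R[i]) m n a, M m -> M n -> A a ->
    mul (l *: m + n) a = l *: mul m a + mul n a ;
  bimodule_mulr_linearr : forall (l : R[i]) m a b, M m -> A a -> A b ->
    mul m (l *: a + b) = l *: mul m a + mul m b ;
  bimodule_mullA : forall a b m, A a -> A b -> M m ->
    mul (mul a b) m = mul a (mul b m) ;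
  bimodule_mulrA : forall m a b, M m -> A a -> A b ->
    mul (mul m a) b = mul m (mul a b) ;
  bimodule_mulA : forall a m b, A a -> M m -> A b ->
    mul (mul a m) b = mul a (mul m b) }.

Record is_banach_bimodule (A M : set V) : Prop := {
  banach_bimodule_sub : A `<=` M ;
  banach_bimodule_algebra : is_algebra A ;
  banach_bimodule_bimodule : is_bimodule A M ;
  banach_bimodule_banach_algebra : is_banach_space A ;
  banach_bimodule_banach_module : is_banach_space M ;
  banach_bimodule_norm_mull : forall a m, A a -> M m ->
    (N (mul a m) <= N a * N m)%E ;
  banach_bimodule_norm_mulr : forall m a, M m -> A a ->
    (N (mul m a) <= N m * N a)%E }.

Record is_involution (S : set V) : Prop := {
  involution_star : forall u, S u -> S (star u) ;
  involution_starK : forall u, S u -> star (star u) = u ;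
  involution_antilinear : forall (l : R[i]) u v, S u -> S v ->
    star (l *: u + v) = l^* *: star u + star v }.

Record is_banach_star_bimodule (A M : set V) : Prop := {
  banach_star_bimodule_bimodule : is_banach_bimodule A M ;
  banach_star_bimodule_stara : is_involution A ;
  banach_star_bimodule_starm : is_involution M ;
  banach_star_bimodule_norm_star : forall m, M m -> N (star m) = N m ;
  banach_star_bimodule_star_mull : forall a m, A a -> M m ->
    star (mul a m) = mul (star m) (star a) ;
  banach_star_bimodule_star_mulr : forall m a, M m -> A a ->
    star (mul m a) = mul (star a) (star m) }.

End Bimodules.

(* Main.v *)
(* The norm of a section a is the best constant K such that
     || sum_{g,h in Gamma x} v(g)* a(g h^-1) w(h) || <= K ||v||_2 ||w||_2
   for all units x and all finitely supported v and w. In this form the norm is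
   visibly invariant under the involution, dominates both the fibrewise norms and
   ||a||_2, is submultiplicative whenever the convolution converges, and is lower
   semicontinuous for pointwise convergence, whence completeness. By the
   Cauchy-Schwarz inequality, a * m converges as soon as one of the two factors
   is square summable, with norm convergence, along the rows (resp. columns), and
   membership in the big algebra amounts to boundedness together with square
   summability of rows and columns. Associativity follows by approximating the
   square summable factor by finitely supported sections.

   The Cauchy-Schwarz inequality and the monotonicity of the norms of partial sums
   rest on the order of the C*-algebras which are the fibres over units. It is
   obtained here from operators on a C*-algebra (or on a fibre) seen as a right
   Hilbert module: square roots of 1 - H, for H self-adjoint of norm less than 1,
   come from the iteration S = (H + S^2) / 2, and the positivity of T*T from a
   bound on the powers of 1 - T*T. *)
Require Import Defs.
From HB Require Import structures.
From mathcomp Require Import all_boot all_order all_algebra.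
From mathcomp Require Import finmap complex.
From mathcomp Require Import all_classical all_reals all_analysis.
From mathcomp Require Import ring lra.
From mathcomp.analysis.showcase Require summability.
Set Implicit Arguments.
Unset Strict Implicit.
Unset Printing Implicit Defensive.
Import Order.TTheory GRing.Theory Num.Theory.
Import numFieldNormedType.Exports.
Local Open Scope classical_set_scope.
Local Open Scope complex_scope.
Local Open Scope ring_scope.

(** The fibre over a unit need not itself have a unit. Its elements are therefore replaced by left
    multiplications on the fibre, where scalars are available and positivity can be expressed by the
    norm; the norm of an element is recovered by evaluating its operator at the element itself. The
    Fell bundle axiom that b*b, for b over an arbitrary arrow, equals a*a with a over a unit enters
    at one place only: it makes b*b positive in this sense. The same lack of a unit removes the
    obvious test vector for comparing the column norms of a with its operator norm; the column's own
    square sum serves instead. No limit occurs in the description of the norm, which speaks of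
    finite sets of rows and columns only. Hence each passage to the limit needs convergence in
    finitely many fibres at a time. Fibres over arrows that are merely provably equal are different
    types. Products thus take the target arrow as an argument, and elements are compared through
    their images in the total space. *)

(** * Real-valued norms on complex normed modules *)

Section CNorm.
Variables (R : realType) (V : normedModType R[i]).
Implicit Types (u v : V) (l : R[i]) (t : R).

Lemma cnormE v : (cnorm v)%:C = `|v|.
Proof. by rewrite /cnorm RRe_real// normr_real. Qed.

Lemma cnorm_ge0 v : 0 <= cnorm v.
Proof. by rewrite -ler0c cnormE. Qed.

Lemma cnorm0 : cnorm (0 : V) = 0.
Proof. by rewrite /cnorm normr0. Qed.

Lemma cnorm_eq0 v : cnorm v = 0 -> v = 0.
Proof. by move=> v0; apply/normr0_eq0; rewrite -cnormE v0. Qed.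

Lemma cnorm_le0 v : cnorm v <= 0 -> v = 0.
Proof. by move=> v0; apply: cnorm_eq0; apply/le_anti; rewrite v0 cnorm_ge0. Qed.

Lemma cnormD u v : cnorm (u + v) <= cnorm u + cnorm v.
Proof. by rewrite -lecR rmorphD/= !cnormE ler_normD. Qed.

Lemma cnormN v : cnorm (- v) = cnorm v.
Proof. by rewrite /cnorm normrN. Qed.

Lemma cnormB u v : cnorm (u - v) <= cnorm u + cnorm v.
Proof. by rewrite -(cnormN v) cnormD. Qed.

Lemma cnormBC u v : cnorm (u - v) = cnorm (v - u).
Proof. by rewrite -cnormN opprB. Qed.

Definition cmod l : R := complex.Re `|l|.

Lemma cmodE l : (cmod l)%:C = `|l|.
Proof. by rewrite /cmod RRe_real// normr_real. Qed.

Lemma cmod_ge0 (l : R[i]) : 0 <= cmod l.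
Proof. by rewrite -ler0c cmodE. Qed.

Lemma cmodr t : cmod t%:C = `|t|.
Proof. by rewrite /cmod normc_def/= expr0n addr0 sqrtr_sqr. Qed.

Lemma cnormZ l v : cnorm (l *: v) = cmod l * cnorm v.
Proof.
have -> : cnorm (l *: v) = complex.Re ((cmod l)%:C * (cnorm v)%:C).
  by rewrite cmodE cnormE /cnorm normrZ.
by rewrite -rmorphM.
Qed.

Lemma cnormZr t v : cnorm (t%:C *: v) = `|t| * cnorm v.
Proof. by rewrite cnormZ cmodr. Qed.

Lemma cnorm_sum (I : Type) (r : seq I) (P : pred I) (F : I -> V) :
  cnorm (\sum_(i <- r | P i) F i) <= \sum_(i <- r | P i) cnorm (F i).
Proof.
elim/big_rec2: _ => [|i y x _ h]; first by rewrite cnorm0.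
by apply: (le_trans (cnormD _ _)); rewrite lerD2l.
Qed.

End CNorm.
(** The trailing 0 gives every summand a right neighbour, so that in the tactic [zmod] the rules
    [addNKr] and [addKr] also cancel the last pair. *)
Lemma subr0_eq0 (V : zmodType) (x y : V) : x - y + 0 = 0 -> x = y.
Proof. by rewrite addr0 => /subr0_eq. Qed.

(* [ring] does not apply to abelian groups. *)
Ltac zmod_cancel :=
  match goal with
  | |- - ?x + _ = 0 => repeat (progress rewrite (addrCA _ x)); rewrite (addNKr, addKr)
  | |- ?x + _ = 0 => repeat (progress rewrite (addrCA _ (- x))); rewrite (addNKr, addKr)
  end.
Ltac zmod :=
  apply: subr0_eq0; rewrite ?(opprD, opprB, opprK) -?addrA; repeat zmod_cancel; done.

(** * Adjointable operators on a module with an inner product *)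

Lemma conj_realc (R : realType) (t : R) : (t%:C)^* = t%:C.
Proof. by apply/CrealP/complex_realP; exists t. Qed.

Lemma conj_imag (R : realType) : ('i : R[i])^* = - 'i.
Proof. exact: conjCi. Qed.

Lemma conj_opp_imag (R : realType) : (- 'i : R[i])^* = - - 'i.
Proof. by rewrite rmorphN; congr (- _); exact: conj_imag. Qed.

Lemma imag_sq (R : realType) : ('i : R[i]) * 'i = -1.
Proof. by rewrite -expr2 sqrCi. Qed.

(** An abstraction of right Hilbert modules: the form takes values in a plain normed space, and the
    norm identity together with the norm inequality stands in for positivity. *)
Record innerForm (R : realType) := InnerForm {
  iform_space :> completeNormedModType R[i] ;
  iform_val : normedModType R[i] ;
  iform : iform_space -> iform_space -> iform_val ;
  iformDl : forall u v w, iform (u + v) w = iform u w + iform v w ;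
  iformDr : forall u v w, iform w (u + v) = iform w u + iform w v ;
  iformZl : forall l u v, iform (l *: u) v = l^* *: iform u v ;
  iformZr : forall l u v, iform u (l *: v) = l *: iform u v ;
  iform_norm : forall u, cnorm (iform u u) = cnorm u ^+ 2 ;
  iform_le : forall u v, cnorm (iform u v) <= cnorm u * cnorm v }.

Section Adjointable.
Variables (R : realType) (E : innerForm R).
Implicit Types (u v w : E) (f g : E -> E).
Local Notation "<< u , v >>" := (iform u v).

Lemma iformNl u v : << - u, v >> = - << u, v >>.
Proof. by rewrite -scaleN1r iformZl rmorphN rmorph1 scaleN1r. Qed.

Lemma iformNr u v : << u, - v >> = - << u, v >>.
Proof. by rewrite -scaleN1r iformZr scaleN1r. Qed.

Lemma iformBl u v w : << u - v, w >> = << u, w >> - << v, w >>.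
Proof. by rewrite iformDl iformNl. Qed.

Lemma iformBr u v w : << w, u - v >> = << w, u >> - << w, v >>.
Proof. by rewrite iformDr iformNr. Qed.

Lemma iform0l v : << 0, v >> = 0.
Proof. by rewrite -(subrr v) iformBl subrr. Qed.

Lemma iform0r v : << v, 0 >> = 0.
Proof. by rewrite -(subrr v) iformBr subrr. Qed.

Lemma iform_nondeg u v : (forall w, << w, u >> = << w, v >>) -> u = v.
Proof.
move=> uv; apply/eqP; rewrite -subr_eq0; apply/eqP/cnorm_eq0.
by apply/eqP; rewrite -sqrf_eq0 -iform_norm iformBr uv subrr cnorm0.
Qed.

Definition half_adjoint f g : Prop :=
  (exists K, forall v, cnorm (f v) <= K * cnorm v) /\
  forall u v, << f u, v >> = << u, g v >>.

(** The adjoint is part of the data, so that taking adjoints exchanges the two components. It is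
    determined by the operator ([adj_eq]), and linearity follows from nondegeneracy of the form
    ([adjD], [adjZ]). *)
Record adjointable := Adjointable {
  adj_fun :> E -> E ;
  adj_star : E -> E ;
  adj_funP : half_adjoint adj_fun adj_star ;
  adj_starP : half_adjoint adj_star adj_fun }.

HB.instance Definition _ := gen_eqMixin adjointable.
HB.instance Definition _ := gen_choiceMixin adjointable.

Implicit Types S T : adjointable.

Lemma adjE T u v : << T u, v >> = << u, adj_star T v >>.
Proof. by have [_ ->] := adj_funP T. Qed.

Lemma adj_starE T u v : << adj_star T u, v >> = << u, T v >>.
Proof. by have [_ ->] := adj_starP T. Qed.

Lemma adj_eq S T : S =1 T -> S = T.
Proof.
move=> ST; have ST' : adj_star S = adj_star T.
  apply: functional_extensionality_dep => v; apply: iform_nondeg => w.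
  by rewrite -!adjE ST.
have := functional_extensionality_dep ST.
case: S ST' {ST} => f g p q; case: T => f' g' p' q' /= gg' ff'.
by subst; congr Adjointable; exact: Prop_irrelevance.
Qed.

Lemma adjD T u v : T (u + v) = T u + T v.
Proof.
by apply: iform_nondeg => w; rewrite iformDr -!adj_starE iformDr.
Qed.

Lemma adjZ T l u : T (l *: u) = l *: T u.
Proof.
by apply: iform_nondeg => w; rewrite iformZr -!adj_starE iformZr.
Qed.

Lemma half_adjoint0 : half_adjoint (fun=> 0) (fun=> 0).
Proof.
split; first by exists 0 => v; rewrite cnorm0 mul0r.
by move=> u v; rewrite iform0l iform0r.
Qed.

Lemma half_adjointD f g f' g' : half_adjoint f g -> half_adjoint f' g' ->
  half_adjoint (fun v => f v + f' v) (fun v => g v + g' v).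
Proof.
move=> [[K fK] fg] [[K' fK'] fg']; split.
  exists (K + K') => v; apply: (le_trans (cnormD _ _)).
  by rewrite mulrDl lerD.
by move=> u v; rewrite iformDl iformDr fg fg'.
Qed.

Lemma half_adjointZ l f g : half_adjoint f g ->
  half_adjoint (fun v => l *: f v) (fun v => l^* *: g v).
Proof.
move=> [[K fK] fg]; split.
  exists (cmod l * K) => v; rewrite cnormZ -mulrA ler_wpM2l//.
  by rewrite -ler0c cmodE.
by move=> u v; rewrite iformZl iformZr fg.
Qed.

Lemma half_adjointZ_conj l f g : half_adjoint f g ->
  half_adjoint (fun v => l^* *: f v) (fun v => l *: g v).
Proof. by move=> /(half_adjointZ l^*); rewrite conjCK. Qed.

Lemma half_adjoint_id : half_adjoint id id.
Proof. by split=> //; exists 1 => v; rewrite mul1r. Qed.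

Lemma half_adjoint_comp f g f' g' : half_adjoint f g -> half_adjoint f' g' ->
  half_adjoint (f \o f') (g' \o g).
Proof.
move=> [[K fK] fg] [[K' fK'] fg']; split.
  exists (`|K| * `|K'|) => v /=; apply: (le_trans (fK _)).
  rewrite (le_trans (ler_wpM2r (cnorm_ge0 _) (ler_norm K)))// -mulrA.
  rewrite ler_wpM2l// (le_trans (fK' _))// ler_wpM2r ?cnorm_ge0//.
  exact: ler_norm.
by move=> u v /=; rewrite fg fg'.
Qed.

Definition adj0 := Adjointable half_adjoint0 half_adjoint0.
Definition adj_add S T := Adjointable
  (half_adjointD (adj_funP S) (adj_funP T))
  (half_adjointD (adj_starP S) (adj_starP T)).
Definition adj_scale l T := Adjointable
  (half_adjointZ l (adj_funP T))
  (half_adjointZ_conj l (adj_starP T)).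
Definition adj1 := Adjointable half_adjoint_id half_adjoint_id.
Definition adj_mul S T := Adjointable
  (half_adjoint_comp (adj_funP S) (adj_funP T))
  (half_adjoint_comp (adj_starP T) (adj_starP S)).

Let adj_addA : associative adj_add.
Proof. by move=> S T U; apply: adj_eq => v /=; rewrite addrA. Qed.
Let adj_addC : commutative adj_add.
Proof. by move=> S T; apply: adj_eq => v /=; rewrite addrC. Qed.
Let adj_add0 : left_id adj0 adj_add.
Proof. by move=> S; apply: adj_eq => v /=; rewrite add0r. Qed.
Let adj_addN : left_inverse adj0 (adj_scale (-1)) adj_add.
Proof. by move=> S; apply: adj_eq => v /=; rewrite scaleN1r addNr. Qed.

HB.instance Definition _ :=
  GRing.isZmodule.Build adjointable adj_addA adj_addC adj_add0 adj_addN.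

Let adj_mulA : associative adj_mul.
Proof. by move=> S T U; apply: adj_eq. Qed.
Let adj_mul1 : left_id adj1 adj_mul.
Proof. by move=> S; apply: adj_eq. Qed.
Let adj_mulr1 : right_id adj1 adj_mul.
Proof. by move=> S; apply: adj_eq. Qed.
Let adj_mulDl : left_distributive adj_mul +%R.
Proof. by move=> S T U; apply: adj_eq. Qed.
Let adj_mulDr : right_distributive adj_mul +%R.
Proof. by move=> S T U; apply: adj_eq => v /=; rewrite adjD. Qed.

HB.instance Definition _ := GRing.Zmodule_isPzRing.Build adjointable
  adj_mulA adj_mul1 adj_mulr1 adj_mulDl adj_mulDr.

Let adj_scaleA l m T : adj_scale l (adj_scale m T) = adj_scale (l * m) T.
Proof. by apply: adj_eq => v /=; rewrite scalerA. Qed.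
Let adj_scale1 : left_id 1 adj_scale.
Proof. by move=> T; apply: adj_eq => v /=; rewrite scale1r. Qed.
Let adj_scaleDr : right_distributive adj_scale +%R.
Proof. by move=> l S T; apply: adj_eq => v /=; rewrite scalerDr. Qed.
Let adj_scaleDl T : {morph adj_scale^~ T : l m / l + m}.
Proof. by move=> l m; apply: adj_eq => v /=; rewrite scalerDl. Qed.

HB.instance Definition _ := GRing.Zmodule_isLmodule.Build R[i] adjointable
  adj_scaleA adj_scale1 adj_scaleDr adj_scaleDl.

Definition adjoint T := Adjointable (adj_starP T) (adj_funP T).

Lemma adj_addE S T v : (S + T) v = S v + T v. Proof. by []. Qed.
Lemma adj_mulE S T v : (S * T) v = S (T v). Proof. by []. Qed.
Lemma adj_oneE v : (1 : adjointable) v = v. Proof. by []. Qed.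
Lemma adj_zeroE v : (0 : adjointable) v = 0. Proof. by []. Qed.
Lemma adj_scaleE l T v : (l *: T) v = l *: T v. Proof. by []. Qed.
Lemma adj_oppE T v : (- T) v = - T v.
Proof. by rewrite -scaleN1r adj_scaleE scaleN1r. Qed.
Definition adjEs :=
  (adj_oppE, adj_addE, adj_mulE, adj_oneE, adj_zeroE, adj_scaleE).

Lemma adj_scaleAl l S T : l *: (S * T) = (l *: S) * T.
Proof. by apply: adj_eq. Qed.

Lemma adj_scaleAr l S T : l *: (S * T) = S * (l *: T).
Proof. by apply: adj_eq => v; rewrite !adjEs adjZ. Qed.

Lemma adjointK T : adjoint (adjoint T) = T.
Proof. by apply: adj_eq. Qed.

Lemma adjointM S T : adjoint (S * T) = adjoint T * adjoint S.
Proof. by apply: adj_eq. Qed.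

Lemma adjointD S T : adjoint (S + T) = adjoint S + adjoint T.
Proof. by apply: adj_eq. Qed.

Lemma adjointZ l T : adjoint (l *: T) = l^* *: adjoint T.
Proof. by apply: adj_eq. Qed.

Lemma adjointN T : adjoint (- T) = - adjoint T.
Proof. by rewrite -scaleN1r adjointZ rmorphN rmorph1 scaleN1r. Qed.

Lemma adjoint1 : adjoint 1 = 1.
Proof. by apply: adj_eq. Qed.

Lemma adjoint0 : adjoint 0 = 0.
Proof. by apply: adj_eq. Qed.

Definition selfadj T := adjoint T = T.

Lemma selfadjD S T : selfadj S -> selfadj T -> selfadj (S + T).
Proof. by rewrite /selfadj adjointD => -> ->. Qed.

Lemma selfadjN T : selfadj T -> selfadj (- T).
Proof. by rewrite /selfadj adjointN => ->. Qed.

Lemma selfadj1 : selfadj 1. Proof. exact: adjoint1. Qed.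

Lemma selfadjZ (t : R) T : selfadj T -> selfadj (t%:C *: T).
Proof. by rewrite /selfadj adjointZ conj_realc => ->. Qed.

Lemma selfadjM S T : selfadj S -> selfadj T -> S * T = T * S ->
  selfadj (S * T).
Proof. by rewrite /selfadj adjointM => -> -> ->. Qed.

Lemma selfadjX T n : selfadj T -> selfadj (T ^+ n).
Proof.
move=> T'; elim: n => [|n IH]; first exact: selfadj1.
by rewrite exprS; apply: selfadjM => //; rewrite -exprS -exprSr.
Qed.

Lemma selfadj_adjM T : selfadj (adjoint T * T).
Proof. by rewrite /selfadj adjointM adjointK. Qed.

Definition opnorm_le T (K : R) := forall v, cnorm (T v) <= K * cnorm v.

Lemma opnorm_ex T : exists2 K, 0 <= K & opnorm_le T K.
Proof.
have [[K TK] _] := adj_funP T; exists `|K| => // v.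
by rewrite (le_trans (TK v))// ler_wpM2r ?cnorm_ge0// ler_norm.
Qed.

Lemma opnorm_leW T K K' : K <= K' -> opnorm_le T K -> opnorm_le T K'.
Proof. by move=> KK' TK v; rewrite (le_trans (TK v))// ler_wpM2r ?cnorm_ge0. Qed.

Lemma opnorm_leD S T K K' : opnorm_le S K -> opnorm_le T K' ->
  opnorm_le (S + T) (K + K').
Proof.
by move=> SK TK v; rewrite mulrDl (le_trans (cnormD _ _))// lerD.
Qed.

Lemma opnorm_leZ l T K : opnorm_le T K -> opnorm_le (l *: T) (cmod l * K).
Proof.
move=> TK v; rewrite cnormZ -mulrA ler_wpM2l// -ler0c.
by rewrite cmodE.
Qed.

Lemma opnorm_leZr (t : R) T K : 0 <= t -> opnorm_le T K ->
  opnorm_le (t%:C *: T) (t * K).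
Proof. by move=> t0 /(opnorm_leZ t%:C); rewrite cmodr ger0_norm. Qed.

Lemma opnorm_leN T K : opnorm_le T K -> opnorm_le (- T) K.
Proof. by move=> TK v; rewrite adjEs cnormN. Qed.

Lemma opnorm_leM S T K K' : 0 <= K -> opnorm_le S K -> opnorm_le T K' ->
  opnorm_le (S * T) (K * K').
Proof.
by move=> K0 SK TK v; rewrite (le_trans (SK _))// -mulrA ler_wpM2l.
Qed.

Lemma opnorm_le1 : opnorm_le 1 1.
Proof. by move=> v; rewrite mul1r. Qed.

(** One half of the C*-identity: the square of ||Tv|| is the norm of << v, T*Tv >>, at most ||v||
    ||T*Tv||. *)
Lemma opnorm_le_adjM T K : 0 <= K -> opnorm_le (adjoint T * T) (K ^+ 2) ->
  opnorm_le T K.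
Proof.
move=> K0 TK v; rewrite -(@ler_pXn2r _ 2%N) ?nnegrE ?mulr_ge0 ?cnorm_ge0//.
rewrite -iform_norm adjE exprMn (le_trans (iform_le _ _))//.
by rewrite [X in _ <= X]mulrC expr2 -mulrA ler_wpM2l ?cnorm_ge0// mulrC TK.
Qed.

Lemma opnorm_le_sq T K : selfadj T -> 0 <= K -> opnorm_le (T * T) (K ^+ 2) ->
  opnorm_le T K.
Proof. by move=> T' K0 TK; apply: opnorm_le_adjM => //; rewrite T'. Qed.

Lemma opnorm_le_lim T (K : R) :
  (forall e, 0 < e -> opnorm_le T (K + e)) -> opnorm_le T K.
Proof.
move=> TK v; apply/ler_addgt0Pr => e e0.
have c0 : 0 < cnorm v + 1 by rewrite ltr_wpDl ?cnorm_ge0.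
have := TK _ (divr_gt0 e0 c0) v; rewrite mulrDl => /le_trans; apply.
rewrite lerD2l mulrAC ler_pdivrMr// ler_wpM2l ?lerDl//.
exact: ltW.
Qed.

End Adjointable.
Arguments selfadj {R E}.
Arguments opnorm_le {R E}.

(** * Square roots of self-adjoint operators *)

Section GeometricLimit.
Variable R : realType.

(** Limits of operators are handled through explicit geometric rates; this lemma turns an estimate
    at every stage into an exact one. *)
Lemma geometric_le0 (C r x : R) : 0 <= r < 1 ->
  (forall n, x <= C * r ^+ n) -> x <= 0.
Proof.
move=> /andP[r0 r1] xr.
have c : (fun n => C * r ^+ n) @ \oo --> (C * 0 : R).
  by apply: cvgMr; apply: cvg_expr; rewrite ger0_norm.
rewrite -(mulr0 C) -(cvg_lim _ c)//; apply: limr_ge.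
  by apply/cvg_ex; exists (C * 0).
by apply: nearW => n; exact: xr.
Qed.

Variable V : completeNormedModType R[i].

Lemma cnorm_cauchy_cvg (F : set_system V) : ProperFilter F ->
  (forall e : R, 0 < e -> exists v, \forall u \near F, cnorm (u - v) < e) ->
  exists l, forall e : R, 0 < e -> \forall u \near F, cnorm (u - l) < e.
Proof.
move=> FF Fc.
have /cauchy_cvg : cauchy F.
  apply: cauchy_exP => e e0.
  have eE : e = (complex.Re e)%:C by rewrite RRe_real// gtr0_real.
  have /Fc[v Fv] : 0 < complex.Re e by rewrite -ltcR -eE.
  exists v; apply: filterS Fv => u uv.
  by rewrite -ball_normE /= eE -cnormE ltcR cnormBC.
move=> /cvg_ex[l Fl]; exists l => e e0.
have e0' : 0 < e%:C by rewrite ltcR.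
move/cvgrPdist_lt : Fl => /(_ _ e0'); apply: filterS => u.
by rewrite -cnormE ltcR cnormBC.
Qed.

Lemma geometric_cvg (u : nat -> V) (C r : R) : 0 <= r < 1 -> 0 <= C ->
  (forall n, cnorm (u n.+1 - u n) <= C * r ^+ n) ->
  exists l, forall n, cnorm (u n - l) <= C / (1 - r) * r ^+ n.
Proof.
move=> /andP[r0 r1] C0 uC; have r1' : 0 < 1 - r by rewrite subr_gt0.
set D := C / (1 - r); have D0 : 0 <= D by rewrite divr_ge0// ltW.
(* The factor 1 - r^k is that of a partial geometric sum; with it the induction on k closes with
   equality. *)
have uD n k : cnorm (u (n + k)%N - u n) <= D * r ^+ n * (1 - r ^+ k).
  elim: k => [|k IH]; first by rewrite addn0 !subrr cnorm0 mulr0.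
  rewrite addnS -(subrKA (u (n + k)%N)) (le_trans (cnormD _ _))//.
  rewrite (le_trans (lerD (uC _) IH))// le_eqVlt; apply/orP; left; apply/eqP.
  rewrite /D exprD exprS.
  by field; rewrite gt_eqF.
have uD' n k : (n <= k)%N -> cnorm (u k - u n) <= D * r ^+ n.
  move=> /subnKC <-; rewrite (le_trans (uD _ _))// ler_piMr//.
    by rewrite mulr_ge0// exprn_ge0.
  by rewrite lerBlDr lerDl exprn_ge0.
have small (e : R) : 0 < e -> exists n, D * r ^+ n < e.
  move=> e0; apply: contrapT => /forallNP H.
  suff : e <= 0 by rewrite leNgt e0.
  apply: (@geometric_le0 D r) => [|n]; first by rewrite r0.
  by rewrite leNgt; apply/negP; exact: H.
have [|l ul] := @cnorm_cauchy_cvg (u @ \oo) _.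
  move=> e /small[n Hn]; exists (u n); exists n => // k /= nk.
  exact: le_lt_trans (uD' _ _ nk) Hn.
exists l => n; apply/ler_addgt0Pr => e /ul[N _ HN].
rewrite -(subrKA (u (maxn n N))) addrC (le_trans (cnormD _ _))// addrC.
by rewrite lerD// ?[cnorm (u n - _)]cnormBC ?uD' ?leq_maxl// ltW// HN/= ?leq_maxr.
Qed.

End GeometricLimit.

Section SquareRoot.
Variables (R : realType) (E : innerForm R).
Implicit Types (u v w : E) (S T H : adjointable E).

Lemma opnorm_geometric_eq0 T (C r : R) : 0 <= r < 1 ->
  (forall n, opnorm_le T (C * r ^+ n)) -> T = 0.
Proof.
move=> r01 TC; apply: adj_eq => v; apply: cnorm_le0.
apply: (geometric_le0 (C := C * cnorm v) r01) => n.
by rewrite mulrAC TC.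
Qed.

(** The limit is taken vector by vector. The error bounds are proportional to [cnorm v], so the
    limit is bounded, and self-adjointness passes to the limit in the form. *)
Lemma adjointable_cvg (s : nat -> adjointable E) (C r : R) :
  0 <= r < 1 -> 0 <= C -> (forall n, selfadj (s n)) ->
  (forall n, opnorm_le (s n.+1 - s n) (C * r ^+ n)) ->
  exists2 S, selfadj S & forall n, opnorm_le (s n - S) (C / (1 - r) * r ^+ n).
Proof.
move=> r01 C0 s' sC.
have [f fP] : {f : E -> E & forall v n,
    cnorm (s n v - f v) <= C * cnorm v / (1 - r) * r ^+ n}.
  apply: (@choice _ _ (fun v l => forall n,
    cnorm (s n v - l) <= C * cnorm v / (1 - r) * r ^+ n)) => v.
  apply: geometric_cvg => //; first by rewrite mulr_ge0 ?cnorm_ge0.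
  by move=> n; have := sC n v; rewrite !adjEs mulrAC.
pose D := C / (1 - r).
have fD v n : cnorm (s n v - f v) <= D * r ^+ n * cnorm v.
  by rewrite (le_trans (fP v n))// /D le_eqVlt; apply/orP; left; apply/eqP; ring.
have fK : half_adjoint f f.
  split.
    have [K K0 sK] := opnorm_ex (s 0%N); exists (D + K) => v.
    rewrite -[f v](subrK (s 0%N v)) (le_trans (cnormD _ _))// cnormBC mulrDl.
    by rewrite lerD//; have := fD v 0%N; rewrite expr0 mulr1.
  move=> u v; apply/eqP; rewrite -subr_eq0; apply/eqP/cnorm_le0.
  apply: (geometric_le0 (C := D * cnorm u * cnorm v + D * cnorm u * cnorm v) r01).
  move=> n.
  have -> : iform (f u) v - iform u (f v) =
      iform u (s n v - f v) - iform (s n u - f u) v.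
    rewrite iformBr iformBl adjE [adj_star _ _](_ : _ = s n v); last first.
      by rewrite -[in RHS](s' n).
    by rewrite opprB [RHS]addrC addrA subrK.
  rewrite (le_trans (cnormB _ _))// mulrDl; apply: lerD.
    rewrite (le_trans (iform_le _ _))//.
    have := ler_wpM2l (cnorm_ge0 u) (fD v n); move=> /le_trans; apply.
    by rewrite le_eqVlt; apply/orP; left; apply/eqP; ring.
  rewrite (le_trans (iform_le _ _))//.
  have := ler_wpM2r (cnorm_ge0 v) (fD u n); move=> /le_trans; apply.
  by rewrite le_eqVlt; apply/orP; left; apply/eqP; ring.
exists (Adjointable fK fK); first exact: adj_eq.
by move=> n v; rewrite !adjEs fD.
Qed.

(** The equation for S is equivalent to S = (H + S^2) / 2. The iterates are polynomials in H, so
    they are self-adjoint and commute with whatever commutes with H; both properties survive the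
    limit. *)
Lemma selfadj_sqrt H (rho : R) : selfadj H -> 0 <= rho < 1 ->
  opnorm_le H rho -> exists S, [/\ selfadj S, (1 - S) * (1 - S) = 1 - H &
    forall T, T * H = H * T -> T * S = S * T].
Proof.
move=> H' /andP[rho0 rho1] Hrho.
pose s n := iter n (fun S : adjointable E => (2^-1)%:C *: (H + S * S)) 0.
have sS n : s n.+1 = (2^-1)%:C *: (H + s n * s n) by [].
have s' n : selfadj (s n).
  elim: n => [|n IH]; first exact: adjoint0.
  by rewrite sS; apply: selfadjZ; apply: selfadjD => //; exact: selfadjM.
have scomm T n : T * H = H * T -> T * s n = s n * T.
  move=> TH; elim: n => [|n IH]; first by rewrite mulr0 mul0r.
  rewrite sS -adj_scaleAr -adj_scaleAl mulrDr mulrDl TH.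
  by rewrite mulrA IH -mulrA IH mulrA.
(* The smaller fixed point of the scalar iteration t -> (rho + t^2) / 2. It bounds all iterates and
   is also the contraction ratio. *)
pose r := 1 - Num.sqrt (1 - rho).
have q1 : Num.sqrt (1 - rho) <= 1.
  by rewrite -[leRHS]sqrtr1 ler_wsqrtr// lerBlDr lerDl.
have q0 : 0 < Num.sqrt (1 - rho) by rewrite sqrtr_gt0 subr_gt0.
have r01 : 0 <= r < 1 by rewrite subr_ge0 q1/= ltrBlDr ltrDl.
have /andP[r0 r1] := r01.
have rE : 2^-1 * (rho + r * r) = r.
  have : Num.sqrt (1 - rho) ^+ 2 = 1 - rho by rewrite sqr_sqrtr// subr_ge0 ltW.
  by rewrite /r; move: (Num.sqrt _) => q qE; rewrite (_ : rho = 1 - q ^+ 2);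
     [field | rewrite qE; ring].
have sr n : opnorm_le (s n) r.
  elim: n => [|n IH]; first by move=> v; rewrite adjEs cnorm0 mulr_ge0 ?cnorm_ge0.
  rewrite sS -rE; apply: opnorm_leZr => //; apply: opnorm_leD => //.
  exact: opnorm_leM.
have sd n : opnorm_le (s n.+1 - s n) (1 * r ^+ n).
  elim: n => [|n IH].
    rewrite sS [s 0%N](_ : _ = 0)// mulr0 addr0 subr0 expr0 mulr1.
    apply: (@opnorm_leW _ _ _ (2^-1 * rho)); first by lra.
    exact: opnorm_leZr.
  (* A difference of squares, X^2 - Y^2 = X (X - Y) + (X - Y) Y, valid without commutativity. *)
  have -> : s n.+2 - s n.+1 =
      (2^-1)%:C *: (s n.+1 * (s n.+1 - s n) + (s n.+1 - s n) * s n).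
    rewrite [in LHS](sS n.+1) [s n.+1 in X in _ - X]sS -scalerBr; congr (_ *: _).
    by rewrite mulrBr mulrBl addrA subrK opprD addrACA subrr add0r.
  have -> : 1 * r ^+ n.+1 = 2^-1 * (r * (1 * r ^+ n) + (1 * r ^+ n) * r).
    by rewrite exprS; field.
  apply: opnorm_leZr => //; apply: opnorm_leD; apply: opnorm_leM => //.
  by rewrite mul1r exprn_ge0.
have [S S' sC] := adjointable_cvg r01 ler01 s' sd.
set C := 1 / (1 - r) in sC.
have C0 : 0 <= C by rewrite divr_ge0// subr_ge0 ltW.
have [K K0 SK] := opnorm_ex S.
exists S; split => //.
  suff -> : H = S + S - S * S.
    by rewrite mulrBr mulr1 mulrBl mul1r -addrA -opprD addrA.
  apply/eqP; rewrite -subr_eq0; apply/eqP.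
  pose D := 2 * C + (r * C + C * K).
  apply: (@opnorm_geometric_eq0 _ D r r01) => n.
  (* The recursion in the form H = 2 s(n+1) - s(n)^2 eliminates H, leaving only differences with the
     limit S. *)
  have -> : H - (S + S - S * S) = 2%:C *: (s n.+1 - S) -
      (s n * (s n - S) + (s n - S) * S).
    rewrite sS scalerBr scalerA -rmorphM/= mulfV ?pnatr_eq0// scale1r.
    rewrite mulrBr mulrBl [s n * s n - _ + _]addrA subrK.
    rewrite [_%:C *: S](_ : _ = S + S); last first.
      by rewrite rmorphD/= rmorph1 scalerDl scale1r.
    by rewrite !opprB [S * S - s n * s n]addrC addrACA addrK [- _ + _]addrC.
  apply: (@opnorm_leW _ _ _ (2 * (C * r ^+ n.+1) +
      (r * (C * r ^+ n) + (C * r ^+ n) * K))).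
    rewrite /D [leRHS]mulrDl; apply: lerD.
      rewrite mulrA; apply: ler_wpM2l; first by rewrite mulr_ge0.
      by rewrite exprS ler_piMl ?exprn_ge0// ltW.
    by rewrite le_eqVlt; apply/orP; left; apply/eqP; ring.
  apply: opnorm_leD; first exact: opnorm_leZr.
  apply: opnorm_leN; apply: opnorm_leD; first exact: opnorm_leM.
  by apply: opnorm_leM => //; rewrite mulr_ge0// exprn_ge0.
move=> T TH; apply/eqP; rewrite -subr_eq0; apply/eqP.
have [M M0 TM] := opnorm_ex T.
apply: (@opnorm_geometric_eq0 _ (C * M + M * C) r r01) => n.
have -> : T * S - S * T = (s n - S) * T - T * (s n - S).
  by rewrite mulrBl mulrBr (scomm _ _ TH) opprB [RHS]addrC subrKA.
rewrite [X in opnorm_le _ X]mulrDl; apply: opnorm_leD.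
  rewrite mulrAC; apply: opnorm_leM => //.
  by rewrite mulr_ge0// exprn_ge0.
by apply: opnorm_leN; rewrite -mulrA; exact: opnorm_leM.
Qed.

End SquareRoot.

(** * Positive operators *)

Section Positive.
Variables (R : realType) (E : innerForm R).
Implicit Types (u v w : E) (K L S T p q : adjointable E).
Local Notation "t %:I" := (t%:C *: (1 : adjointable E)) (format "t %:I").

(** The norm criterion for positivity in a C*-algebra: it places the spectrum of [p] in the interval
    [0, 2t]. In this form sums of positive operators are positive by the triangle inequality. *)
Definition oppos p := selfadj p /\ exists2 t, 0 <= t & opnorm_le (t%:I - p) t.

Lemma scalar_selfadj (t : R) : selfadj (t%:I).
Proof. exact/selfadjZ/selfadj1. Qed.

Lemma scalar_comm (t : R) T : t%:I * T = T * t%:I.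
Proof. by rewrite -adj_scaleAl -adj_scaleAr mul1r mulr1. Qed.

Lemma scalar_opnorm (t : R) : 0 <= t -> opnorm_le (t%:I) t.
Proof. by move=> t0; have := opnorm_leZr t0 (@opnorm_le1 _ E); rewrite mulr1. Qed.

Lemma scalarD (s t : R) : (s + t)%:I = s%:I + t%:I.
Proof. by rewrite rmorphD scalerDl. Qed.

Lemma oppos_add p q : oppos p -> oppos q -> oppos (p + q).
Proof.
move=> [p' [s s0 ps]] [q' [t t0 qt]]; split; first exact: selfadjD.
exists (s + t); first exact: addr_ge0.
by rewrite scalarD opprD addrACA; exact: opnorm_leD.
Qed.

Lemma opposZ (s : R) p : 0 <= s -> oppos p -> oppos (s%:C *: p).
Proof.
move=> s0 [p' [t t0 pt]]; split; first exact: selfadjZ.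
exists (s * t); first exact: mulr_ge0.
by rewrite rmorphM/= -scalerA -scalerBr; exact: opnorm_leZr.
Qed.

Lemma oppos0 : oppos 0.
Proof.
split; first exact: adjoint0.
by exists 0 => //; rewrite scale0r subr0 => v; rewrite adjEs cnorm0 mul0r.
Qed.

(* K + iL is a multiple of a unitary. *)
Lemma opnorm_le_sum_sq K L (c : R) : selfadj K -> selfadj L -> 0 <= c ->
  K * L = L * K -> K * K + L * L = (c ^+ 2)%:I -> opnorm_le K c.
Proof.
move=> K' L' c0 KL KLc.
have bound (l : R[i]) : l^* = - l -> l * l = -1 -> opnorm_le (K + l *: L) c.
  move=> lc ll; apply: opnorm_le_adjM => //.
  rewrite adjointD adjointZ K' L' lc mulrDr !mulrDl -!adj_scaleAl -!adj_scaleAr.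
  rewrite scalerA mulNr ll opprK scale1r KL scaleNr.
  rewrite [X in opnorm_le X _](_ : _ = K * K + L * L); last by zmod.
  by rewrite KLc; apply: scalar_opnorm; rewrite exprn_ge0.
have b1 : opnorm_le (K + 'i *: L) c.
  by apply: bound; [exact: conj_imag | exact: imag_sq].
have b2 : opnorm_le (K + (- 'i) *: L) c.
  by apply: bound; [exact: conj_opp_imag | rewrite mulrNN; exact: imag_sq].
have -> : K = (2^-1)%:C *: ((K + 'i *: L) + (K + (- 'i) *: L)).
  rewrite addrACA -scalerDl subrr scale0r addr0 scalerDr -scalerDl -rmorphD/=.
  by rewrite (_ : 2^-1 + 2^-1 = 1) ?scale1r//; field.
have -> : c = 2^-1 * (c + c) by field.
by apply: opnorm_leZr => //; exact: opnorm_leD.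
Qed.

(** For t > ||K||^2 the operator H = K^2 / t has norm less than 1, and 1 - H = (1 - S)^2. The
    squares of K / sqrt t and 1 - S sum to 1, so 1 - S has norm at most 1 by [opnorm_le_sum_sq], and
    t - K^2 = t (1 - S)^2 has norm at most t. *)
Lemma oppos_sq K : selfadj K -> oppos (K * K).
Proof.
move=> K'; have [M M0 KM] := opnorm_ex K.
split; first exact: selfadjM.
pose t := M ^+ 2 + 1; have t0 : 0 < t by rewrite ltr_wpDl ?sqr_ge0.
exists t; first exact: ltW.
pose a := (Num.sqrt t)^-1; have a0 : 0 <= a by rewrite invr_ge0 sqrtr_ge0.
have aa : a * a = t^-1 by rewrite /a -invfM -expr2 sqr_sqrtr// ltW.
pose H := (a%:C *: K) * (a%:C *: K).
have HE : H = (t^-1)%:C *: (K * K).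
  by rewrite /H -adj_scaleAl -adj_scaleAr scalerA -rmorphM/= aa.
have aK' : selfadj (a%:C *: K) by exact: selfadjZ.
have H' : selfadj H by exact: selfadjM.
have rho01 : 0 <= t^-1 * (M * M) < 1.
  rewrite mulr_ge0 ?invr_ge0 ?mulr_ge0 ?(ltW t0)//=.
  by rewrite mulrC ltr_pdivrMr// mul1r -expr2 ltrDl.
have Hrho : opnorm_le H (t^-1 * (M * M)).
  rewrite HE; apply: opnorm_leZr; first by rewrite invr_ge0 ltW.
  exact: opnorm_leM.
have [S [S' SH SC]] := selfadj_sqrt H' rho01 Hrho.
have L' : selfadj (1 - S) by apply: selfadjD; [exact: selfadj1|exact: selfadjN].
have L1 : opnorm_le (1 - S) 1.
  apply: (@opnorm_le_sum_sq _ (a%:C *: K)) => //.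
    rewrite mulrBl mulrBr mul1r mulr1 SC//.
    by rewrite /H mulrA.
  by rewrite SH -/H subrK expr1n scale1r.
have -> : t%:I - K * K = t%:C *: ((1 - S) * (1 - S)).
  rewrite SH HE scalerBr scalerA -rmorphM/= divff ?gt_eqF// scale1r.
  by [].
rewrite -[X in opnorm_le _ X]mulr1; apply: opnorm_leZr; first exact: ltW.
by rewrite -[X in opnorm_le _ X]mulr1; exact: opnorm_leM.
Qed.

(** One has p + e = (t + e)(1 - H) with H = (t - p) / (t + e), of norm at most t / (t + e); the
    summand e makes this strictly less than 1. *)
Lemma oppos_sqrt p (e : R) : oppos p -> 0 < e ->
  exists K, [/\ selfadj K, K * K = p + e%:I &
    forall T, T * p = p * T -> T * K = K * T].
Proof.
move=> [p' [t t0 pt]] e0.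
have te : 0 < t + e by rewrite ltr_wpDl.
pose H := ((t + e)^-1)%:C *: (t%:I - p).
have H' : selfadj H.
  by apply: selfadjZ; apply: selfadjD; [exact: scalar_selfadj|exact: selfadjN].
have rho01 : 0 <= (t + e)^-1 * t < 1.
  rewrite mulr_ge0 ?invr_ge0 ?(ltW te)//=.
  by rewrite mulrC ltr_pdivrMr// mul1r ltrDl.
have Hrho : opnorm_le H ((t + e)^-1 * t).
  by apply: opnorm_leZr => //; rewrite invr_ge0 ltW.
have [S [S' SH SC]] := selfadj_sqrt H' rho01 Hrho.
pose a := Num.sqrt (t + e).
have aa : a * a = t + e by rewrite -expr2 sqr_sqrtr// ltW.
exists (a%:C *: (1 - S)); split.
- by apply: selfadjZ; apply: selfadjD; [exact: selfadj1|exact: selfadjN].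
- rewrite -adj_scaleAl -adj_scaleAr scalerA -rmorphM/= aa SH /H scalerBr scalerA.
  rewrite -rmorphM/= divff ?gt_eqF// scale1r scalarD opprB.
  by zmod.
- move=> T Tp; rewrite -adj_scaleAl -adj_scaleAr mulrBl mulrBr mul1r mulr1.
  rewrite SC// /H -adj_scaleAl -adj_scaleAr mulrBr mulrBl Tp.
  by rewrite scalar_comm.
Qed.

(** The square roots K of p + e/3 and L of c - p + e/3 commute, and their squares sum to the scalar
    c + 2e/3. By [opnorm_le_sum_sq] this bounds K^2, and p = K^2 - e/3 is then bounded by c + e. *)
Lemma oppos_opnorm_le p (c : R) : 0 <= c -> oppos p -> oppos (c%:I - p) ->
  opnorm_le p c.
Proof.
move=> c0 p0 cp0; apply: opnorm_le_lim => e e0.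
have e3 : 0 < e / 3 by rewrite divr_gt0.
have [K [K' KK KC]] := oppos_sqrt p0 e3.
have [L [L' LL LC]] := oppos_sqrt cp0 e3.
have KL : K * L = L * K.
  have pK : p * K = K * p by exact: KC.
  by apply: LC; rewrite mulrBr mulrBl scalar_comm pK.
pose d := Num.sqrt (c + 2 * (e / 3)).
have d0 : 0 <= c + 2 * (e / 3) by rewrite addr_ge0// mulr_ge0// ltW.
have Kd : opnorm_le K d.
  apply: (opnorm_le_sum_sq K' L') => //; first exact: sqrtr_ge0.
  rewrite KK LL sqr_sqrtr// addrACA [p + _]addrC subrK -!scalarD.
  by congr (_%:C *: _); field.
have -> : p = K * K - (e / 3)%:I by rewrite KK addrK.
apply: (@opnorm_leW _ _ _ (d * d + e / 3)).
  by rewrite -expr2 sqr_sqrtr//; lra.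
apply: opnorm_leD; last by apply/opnorm_leN/scalar_opnorm/ltW.
by apply: opnorm_leM => //; exact: sqrtr_ge0.
Qed.

(** The norm bound makes c - (p + q) positive by the very definition of [oppos]; adding q shows that
    c - p is positive. *)
Lemma oppos_opnorm_le_add p q (c : R) : 0 <= c -> oppos p -> oppos q ->
  opnorm_le (p + q) c -> opnorm_le p c.
Proof.
move=> c0 p0 q0 pqc; apply: oppos_opnorm_le => //.
have -> : c%:I - p = (c%:I - (p + q)) + q by rewrite opprD addrA subrK.
apply: oppos_add => //; split.
  apply: selfadjD; first exact: scalar_selfadj.
  by apply/selfadjN/selfadjD; [case: p0|case: q0].
by exists c => //; rewrite opprB addrC subrK.
Qed.

(** Cartesian decomposition: up to a factor, the operator is the sum of the squares of the
    self-adjoint operators T + T* and i times T - T*. *)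
Lemma oppos_adjM_add T : oppos (adjoint T * T + T * adjoint T).
Proof.
set T' := adjoint T.
have s1 : selfadj (T + T') by rewrite /selfadj adjointD adjointK addrC.
have s2 : selfadj ('i *: (T - T')).
  by rewrite /selfadj adjointZ conj_imag adjointD adjointN adjointK scaleNr -scalerN opprB.
have -> : T' * T + T * T' = (2^-1)%:C *:
    ((T + T') * (T + T') + ('i *: (T - T')) * ('i *: (T - T'))).
  rewrite -adj_scaleAl -adj_scaleAr scalerA imag_sq scaleN1r.
  rewrite mulrBl !mulrBr mulrDl !mulrDr.
  rewrite [X in _ *: X](_ : _ = (T' * T + T * T') + (T' * T + T * T')); last by zmod.
  rewrite scalerDr -scalerDl -rmorphD/= (_ : 2^-1 + 2^-1 = 1) ?scale1r//.
  by field.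
apply: opposZ => //; apply: oppos_add; exact: oppos_sq.
Qed.

(** Since 1 + a is at most (1 + a/2)^2, a bound 1 + a on the power 2^(n+1) gives 1 + a/2 on the
    power 2^n. Descending from 2 = 1 + 1 leaves 1 + 2^(-n) for T itself. *)
Lemma opnorm_le_powers T : selfadj T -> (forall n, opnorm_le (T ^+ n) 2) ->
  opnorm_le T 1.
Proof.
move=> T' T2.
have descent n (a : R) : 0 <= a -> opnorm_le (T ^+ (2 ^ n)) (1 + a) ->
    opnorm_le T (1 + a / 2 ^+ n).
  elim: n a => [|n IH] a a0; first by rewrite expr0 divr1 expr1.
  rewrite expnS mul2n -addnn exprD => Ta.
  have : opnorm_le (T ^+ (2 ^ n)) (1 + a / 2).
    apply: opnorm_le_sq; first exact: selfadjX.
      by rewrite addr_ge0// divr_ge0.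
    apply: opnorm_leW Ta; rewrite -subr_ge0.
    by rewrite (_ : _ - _ = (a / 2) ^+ 2) ?sqr_ge0//; field.
  move=> /IH; rewrite divr_ge0// exprS invfM mulrA; exact.
apply: opnorm_le_lim => e e0.
have [n ne] : exists n, 1 / 2 ^+ n < e.
  apply: contrapT => /forallNP H; suff : e <= 0 by rewrite leNgt e0.
  apply: (@geometric_le0 _ 1 (2^-1)) => [|n]; first by lra.
  by rewrite exprVn leNgt; apply/negP; exact: H.
apply: (@opnorm_leW _ _ _ (1 + 1 / 2 ^+ n)); first by rewrite lerD2l ltW.
by apply: descent => //; exact: T2.
Qed.

(* With H = T*T, W = TT*, X = 1 - H and Y = 1 - W, the operators c = T X^(j/2)
   satisfy c*c + cc* = H X^j + W Y^j = (X^j - X^(j+1)) + (Y^j - Y^(j+1)).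
   These telescope to 2 - X^n - Y^n >= 0, and for n even Y^n is the square of a
   self-adjoint operator, so that X^n <= 2. *)
Lemma oppos_adjM T : oppos (adjoint T * T).
Proof.
wlog [rho rho1 Trho] : T / exists2 rho, 0 <= rho < 1 & opnorm_le (adjoint T * T) rho.
  move=> small; have [K K0 TK] := opnorm_ex (adjoint T * T).
  pose t := K + 1; have t0 : 0 < t by rewrite ltr_wpDl.
  pose a := (Num.sqrt t)^-1.
  have aa : a * a = t^-1 by rewrite /a -invfM -expr2 sqr_sqrtr// ltW.
  have E1 : adjoint (a%:C *: T) * (a%:C *: T) = (t^-1)%:C *: (adjoint T * T).
    by rewrite adjointZ conj_realc -adj_scaleAl -adj_scaleAr scalerA -rmorphM aa.
  have -> : adjoint T * T = t%:C *: (adjoint (a%:C *: T) * (a%:C *: T)).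
    by rewrite E1 scalerA -rmorphM/= divff ?gt_eqF// scale1r.
  apply: opposZ; first exact: ltW.
  apply: small; exists (t^-1 * K).
    rewrite mulr_ge0 ?invr_ge0 ?(ltW t0)//=.
    by rewrite mulrC ltr_pdivrMr// mul1r ltrDl.
  by rewrite E1; apply: opnorm_leZr => //; rewrite invr_ge0 ltW.
set T' := adjoint T in Trho *; set H := T' * T in Trho *.
have H' : selfadj H by exact: selfadj_adjM.
have W' : selfadj (T * T') by rewrite -{1}(adjointK T); exact: selfadj_adjM.
have [S [S' SH SC]] := selfadj_sqrt H' rho1 Trho.
pose r := 1 - S; have r' : selfadj r.
  by apply: selfadjD; [exact: selfadj1|exact: selfadjN].
pose X := 1 - H; pose Y := 1 - T * T'.
have X' : selfadj X by apply: selfadjD; [exact: selfadj1|exact: selfadjN].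
have Y' : selfadj Y by apply: selfadjD; [exact: selfadj1|exact: selfadjN].
have rr : r * r = X by [].
have TX n : T * X ^+ n = Y ^+ n * T.
  elim: n => [|n IH]; first by rewrite !expr0 mulr1 mul1r.
  rewrite exprSr mulrA IH -mulrA [Y ^+ n.+1]exprSr -[RHS]mulrA; congr (_ * _).
  by rewrite mulrBr mulrBl mulr1 mul1r mulrA.
have rH : r * H = H * r by rewrite mulrBl mulrBr mul1r mulr1 SC.
have rX n : r ^+ n * r ^+ n = X ^+ n.
  by rewrite -rr -exprMn_comm.
have step n : oppos (H * X ^+ n + T * T' * Y ^+ n).
  have := oppos_adjM_add (T * r ^+ n); congr oppos.
  rewrite adjointM (selfadjX n r') -/T'; congr (_ + _).
    rewrite mulrA -[r ^+ n * T' * T]mulrA -/H.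
    have rnH : r ^+ n * H = H * r ^+ n.
      have := @commrX _ H r n; rewrite /GRing.comm => <- //.
    by rewrite -rX [RHS]mulrA -rnH.
  rewrite mulrA -[T * _ * _]mulrA rX TX -mulrA.
  have YW : GRing.comm (T * T') Y.
    by rewrite /GRing.comm mulrBr mulrBl mulr1 mul1r.
  by rewrite -mulrA [RHS]mulrA; have := commrX n YW; rewrite /GRing.comm.
have tele n : oppos (2%:I - X ^+ n - Y ^+ n).
  elim: n => [|n IH].
    rewrite !expr0 -addrA -opprD.
    rewrite (_ : 2%:I = 1 + 1) ?subrr; first exact: oppos0.
    by rewrite rmorphD/= rmorph1 scalerDl scale1r.
  have -> : 2%:I - X ^+ n.+1 - Y ^+ n.+1 =
      (2%:I - X ^+ n - Y ^+ n) + (H * X ^+ n + T * T' * Y ^+ n).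
    rewrite [X ^+ n.+1]exprS [Y ^+ n.+1]exprS !mulrBl !mul1r.
    by zmod.
  exact: oppos_add.
have X1 : opnorm_le X 1.
  apply: opnorm_le_powers => // n; rewrite -[2](@mulr1 R).
  (* The telescoping bound is used at even exponents only; it controls the square of X^n, hence X^n
     for every n. *)
  have XX : opnorm_le (X ^+ n * X ^+ n) 2.
    apply: oppos_opnorm_le => //; first by apply/oppos_sq/selfadjX.
    have -> : 2%:I - X ^+ n * X ^+ n =
        (2%:I - X ^+ (n + n) - Y ^+ (n + n)) + Y ^+ n * Y ^+ n.
      by rewrite !exprD subrK.
    by apply: oppos_add => //; apply/oppos_sq/selfadjX.
  rewrite mulr1; apply: opnorm_le_sq => //; first exact: selfadjX.
  by apply: opnorm_leW XX; lra.
split=> //; exists 1 => //.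
by rewrite scale1r.
Qed.

End Positive.

(** * Groupoids and fibrewise products in a Fell bundle *)

Section GroupoidTheory.
Variable G : etaleGroupoid.
Implicit Types a b c g h k x : G.

Definition grange g : G := gmul g (ginv g).
Definition gdiv g h : G := gmul g (ginv h).

Lemma ginvK g : ginv (ginv g) = g.
Proof. exact: (groupoid_invK (gmul_groupoid G)). Qed.

Lemma composableE g h : composable g h <-> gsource g = grange h.
Proof. by []. Qed.

Lemma gsource_inv g : gsource (ginv g) = grange g.
Proof. by rewrite /gsource ginvK. Qed.

Lemma grange_inv g : grange (ginv g) = gsource g.
Proof. by rewrite /grange ginvK. Qed.

Lemma gsource_mul g h : gsource g = grange h -> gsource (gmul g h) = gsource h.
Proof. exact: (groupoid_source_mul (gmul_groupoid G)). Qed.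

Lemma grange_mul g h : gsource g = grange h -> grange (gmul g h) = grange g.
Proof. exact: (groupoid_range_mul (gmul_groupoid G)). Qed.

Lemma gmulA g h k : gsource g = grange h -> gsource h = grange k ->
  gmul (gmul g h) k = gmul g (gmul h k).
Proof. exact: (groupoid_mulA (gmul_groupoid G)). Qed.

Lemma gmul_source g : gmul g (gsource g) = g.
Proof. exact: (groupoid_mul_source (gmul_groupoid G)). Qed.

Lemma gmul_range g : gmul (grange g) g = g.
Proof. exact: (groupoid_mul_range (gmul_groupoid G)). Qed.

Lemma gsource_source g : gsource (gsource g) = gsource g.
Proof. exact: (gsource_mul (gsource_inv g)). Qed.

Lemma grange_source g : grange (gsource g) = gsource g.
Proof. by rewrite -[RHS]grange_inv; exact: (grange_mul (gsource_inv g)). Qed.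

Lemma gsource_range g : gsource (grange g) = grange g.
Proof. by rewrite -(gsource_inv g) gsource_source. Qed.

Lemma gunit_range x : gsource x = x -> grange x = x.
Proof. by move=> xu; have := grange_source x; rewrite xu. Qed.

Lemma gunit_inv x : gsource x = x -> ginv x = x.
Proof.
by move=> xu; rewrite -(gmul_source (ginv x)) gsource_inv gunit_range.
Qed.

Lemma ginv_mul g h : gsource g = grange h ->
  ginv (gmul g h) = gmul (ginv h) (ginv g).
Proof.
move=> gh.
have hg : gsource (ginv h) = grange (ginv g) by rewrite gsource_inv grange_inv.
have E : gmul (gmul g h) (gmul (ginv h) (ginv g)) = grange g.
  rewrite gmulA//; last by rewrite grange_mul// grange_inv.
  rewrite -(gmulA (g := h))// ?grange_inv// -/(grange h) -gh.
  by rewrite -grange_inv gmul_range.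
rewrite -(gmul_source (ginv (gmul g h))) gsource_inv grange_mul// -E.
rewrite -gmulA; first last.
- by rewrite gsource_mul// grange_mul// grange_inv.
- by rewrite gsource_inv.
rewrite -/(gsource (gmul g h)) gsource_mul// -(grange_inv h).
rewrite -[X in gmul X _](grange_mul hg); exact: gmul_range.
Qed.

Lemma gsource_div g h : gsource g = gsource h -> gsource (gdiv g h) = grange h.
Proof. by move=> gh; rewrite gsource_mul ?grange_inv// gsource_inv. Qed.

Lemma grange_div g h : gsource g = gsource h -> grange (gdiv g h) = grange g.
Proof. by move=> gh; rewrite grange_mul ?grange_inv. Qed.

Lemma ginv_div g h : gsource g = gsource h -> ginv (gdiv g h) = gdiv h g.
Proof. by move=> gh; rewrite ginv_mul ?grange_inv// ginvK. Qed.

Lemma gdivK g h : gsource g = gsource h -> gmul (gdiv g h) h = g.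
Proof.
by move=> gh; rewrite gmulA ?grange_inv ?gsource_inv// -/(gsource h) -gh gmul_source.
Qed.

Lemma gmulK g h : gsource g = grange h -> gdiv (gmul g h) h = g.
Proof.
move=> gh; rewrite /gdiv gmulA ?grange_inv// -/(grange h) -gh.
exact: gmul_source.
Qed.

Lemma gmul_div g h k : gsource g = gsource h -> gsource h = gsource k ->
  gmul (gdiv g h) (gdiv h k) = gdiv g k.
Proof.
move=> gh hk; rewrite /gdiv -gmulA; first last.
- by rewrite grange_inv.
- by rewrite -/(gdiv g h) gsource_div.
by rewrite -/(gdiv g h) gdivK.
Qed.

(** A relation instead of a function, so that the fibre over [k] can be the target of a product
    although [k] is only provably equal to g h. *)
Definition gprod g h k := gsource g = grange h /\ gmul g h = k.

Lemma gprod_source g h k : gprod g h k -> gsource k = gsource h.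
Proof. by move=> [gh <-]; rewrite gsource_mul. Qed.

Lemma gprod_range g h k : gprod g h k -> grange k = grange g.
Proof. by move=> [gh <-]; rewrite grange_mul. Qed.

Lemma gprod_inv g h k : gprod g h k -> gprod (ginv h) (ginv g) (ginv k).
Proof.
by move=> [gh <-]; split; rewrite ?ginv_mul// gsource_inv grange_inv.
Qed.

Lemma gprod_invl g : gprod (ginv g) g (gsource g).
Proof. by split => //; rewrite gsource_inv. Qed.

Lemma gprod_source_r g : gprod g (gsource g) g.
Proof. by split; rewrite ?gmul_source ?grange_source. Qed.

Lemma gprod_range_l g : gprod (grange g) g g.
Proof. by split; rewrite ?gmul_range ?gsource_range. Qed.

Lemma gprodA a b c g h k : gprod a b g -> gprod g c k -> gprod b c h ->
  gprod a h k.
Proof.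
move=> [ab <-] [gc <-] [bc <-]; split; first by rewrite grange_mul.
by rewrite gmulA.
Qed.

Lemma gprod_invlr g h k : gprod g h k -> gprod (ginv g) k h.
Proof.
move=> [gh <-]; split; first by rewrite gsource_inv grange_mul.
by rewrite -gmulA ?gsource_inv// -/(gsource g) gh gmul_range.
Qed.

Lemma gprod_div g h : gsource g = gsource h -> gprod (gdiv g h) h g.
Proof. by move=> gh; split; [rewrite gsource_div|rewrite gdivK]. Qed.

End GroupoidTheory.

Section FellAlgebra.
Variables (R : realType) (G : etaleGroupoid) (B : fellBundle R G).
Implicit Types (g h k l x : G) (b : B).
Local Notation incl := (fibre_incl B).

Lemma bproj_incl g (u : fibre B g) : bproj (incl u) = g.
Proof.
have : range (@fibre_incl R G B g) (incl u) by exists u.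
by rewrite range_fibre_incl.
Qed.

Lemma inclK g (u : fibre B g) : at_fibre g (incl u) = u.
Proof.
rewrite /at_fibre; case: xgetP => [v _ /= /fibre_incl_inj //|].
by move=> /(_ u) /= [].
Qed.

Lemma at_fibreK g b : bproj b = g -> incl (at_fibre g b) = b.
Proof.
move=> bg; have : (@bproj _ _ B @^-1` [set g]) b by [].
by rewrite -range_fibre_incl => -[v _ <-]; rewrite inclK.
Qed.

Lemma bnorm_incl g (u : fibre B g) : bnorm (incl u) = cnorm u.
Proof.
have bE b : bproj b = g -> bnorm b = cnorm (at_fibre g b) by move=> <-.
by rewrite bE ?bproj_incl// inclK.
Qed.

(** The target [k] is a free argument, tied to [g] and [h] by [gprod] in the lemmas; this avoids
    transport along equalities of arrows. *)
Definition fmul g h k (u : fibre B g) (v : fibre B h) : fibre B k :=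
  at_fibre k (bmul (incl u) (incl v)).

Definition fstar g k (u : fibre B g) : fibre B k := at_fibre k (bstar (incl u)).

Lemma incl_fmul g h k (u : fibre B g) (v : fibre B h) : gprod g h k ->
  incl (fmul k u v) = bmul (incl u) (incl v).
Proof.
move=> [gh <-]; apply: at_fibreK; by rewrite bprojM ?bproj_incl.
Qed.

Lemma incl_fstar g k (u : fibre B g) : k = ginv g ->
  incl (fstar k u) = bstar (incl u).
Proof. by move=> ->; apply: at_fibreK; rewrite bproj_star bproj_incl. Qed.

Lemma incl_eq g (u v : fibre B g) : incl u = incl v -> u = v.
Proof. exact: fibre_incl_inj. Qed.

Lemma fmulA (a b c g h k : G) (u : fibre B a) (v : fibre B b) (w : fibre B c) :
  gprod a b g -> gprod b c h -> gprod g c k ->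
  fmul k (fmul g u v) w = fmul k u (fmul h v w).
Proof.
move=> abg bch gck; have ahk := gprodA abg gck bch.
apply: incl_eq; rewrite !incl_fmul//.
have [sg _ _] := bmul_star_semigroupoid B.
apply: (semigroupoid_mulA sg); first by rewrite !bproj_incl; case: abg.
by rewrite -(incl_fmul u v abg) !bproj_incl; case: gck.
Qed.

Lemma fmulDl g h k (u v : fibre B g) (w : fibre B h) : gprod g h k ->
  fmul k (u + v) w = fmul k u w + fmul k v w.
Proof.
move=> [gh <-]; rewrite -[u in LHS]scale1r /fmul bmul_linearl//.
by rewrite scale1r.
Qed.

Lemma fmulDr g h k (u v : fibre B h) (w : fibre B g) : gprod g h k ->
  fmul k w (u + v) = fmul k w u + fmul k w v.
Proof.
move=> [gh <-]; rewrite -[u in LHS]scale1r /fmul bmul_linearr//.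
by rewrite scale1r.
Qed.

Lemma fmul0l g h k (w : fibre B h) : gprod g h k -> fmul k (0 : fibre B g) w = 0.
Proof.
move=> ghk; have := fmulDl 0 0 w ghk; rewrite addr0 => /eqP.
by rewrite -subr_eq0 opprD addrA subrr sub0r oppr_eq0 => /eqP.
Qed.

Lemma fmul0r g h k (w : fibre B g) : gprod g h k -> fmul k w (0 : fibre B h) = 0.
Proof.
move=> ghk; have := fmulDr 0 0 w ghk; rewrite addr0 => /eqP.
by rewrite -subr_eq0 opprD addrA subrr sub0r oppr_eq0 => /eqP.
Qed.

Lemma fmulZl g h k (l : R[i]) (u : fibre B g) (w : fibre B h) : gprod g h k ->
  fmul k (l *: u) w = l *: fmul k u w.
Proof.
move=> ghk; have [gh kE] := ghk; rewrite -[l *: u in LHS]addr0.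
rewrite -kE in ghk *; rewrite /fmul bmul_linearl//.
by rewrite -/(fmul _ (0 : fibre B g) w) fmul0l// addr0.
Qed.

Lemma fmulZr g h k (l : R[i]) (u : fibre B h) (w : fibre B g) : gprod g h k ->
  fmul k w (l *: u) = l *: fmul k w u.
Proof.
move=> ghk; have [gh kE] := ghk; rewrite -[l *: u in LHS]addr0.
rewrite -kE in ghk *; rewrite /fmul bmul_linearr//.
by rewrite -/(fmul _ w (0 : fibre B h)) fmul0r// addr0.
Qed.

Lemma fmulNl g h k (u : fibre B g) (w : fibre B h) : gprod g h k ->
  fmul k (- u) w = - fmul k u w.
Proof. by move=> ghk; rewrite -scaleN1r fmulZl// scaleN1r. Qed.

Lemma fmulNr g h k (u : fibre B h) (w : fibre B g) : gprod g h k ->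
  fmul k w (- u) = - fmul k w u.
Proof. by move=> ghk; rewrite -scaleN1r fmulZr// scaleN1r. Qed.

Lemma fmul_suml g h k (I : Type) (r : seq I) (P : pred I) (F : I -> fibre B g)
    (w : fibre B h) : gprod g h k ->
  fmul k (\sum_(i <- r | P i) F i) w = \sum_(i <- r | P i) fmul k (F i) w.
Proof.
move=> ghk; apply: (big_morph (fun u => fmul k u w)); last exact: fmul0l.
by move=> u v; exact: fmulDl.
Qed.

Lemma fmul_sumr g h k (I : Type) (r : seq I) (P : pred I) (F : I -> fibre B h)
    (w : fibre B g) : gprod g h k ->
  fmul k w (\sum_(i <- r | P i) F i) = \sum_(i <- r | P i) fmul k w (F i).
Proof.
move=> ghk; apply: (big_morph (fun u => fmul k w u)); last exact: fmul0r.
by move=> u v; exact: fmulDr.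
Qed.

Lemma cnorm_fmul g h k (u : fibre B g) (v : fibre B h) : gprod g h k ->
  cnorm (fmul k u v) <= cnorm u * cnorm v.
Proof.
move=> ghk; rewrite -!bnorm_incl incl_fmul// bnormM// !bproj_incl.
by case: ghk.
Qed.

Lemma fstarD g (u v : fibre B g) k : k = ginv g ->
  fstar k (u + v) = fstar k u + fstar k v.
Proof.
move=> ->; rewrite -[u in LHS]scale1r /fstar bstar_antilinear rmorph1.
by rewrite scale1r.
Qed.

Lemma fstar0 g k : k = ginv g -> fstar k (0 : fibre B g) = 0.
Proof.
move=> kg; have := fstarD (0 : fibre B g) 0 kg; rewrite addr0 => /eqP.
by rewrite -subr_eq0 opprD addrA subrr sub0r oppr_eq0 => /eqP.
Qed.

Lemma fstarZ g (u : fibre B g) (l : R[i]) k : k = ginv g ->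
  fstar k (l *: u) = l^* *: fstar k u.
Proof.
move=> kg; rewrite -[l *: u in LHS]addr0 kg /fstar bstar_antilinear.
by rewrite -/(fstar _ (0 : fibre B g)) fstar0// addr0.
Qed.

Lemma fstarN g (u : fibre B g) k : k = ginv g -> fstar k (- u) = - fstar k u.
Proof. by move=> kg; rewrite -scaleN1r fstarZ// rmorphN rmorph1 scaleN1r. Qed.

Lemma fstar_sum g k (I : Type) (r : seq I) (P : pred I) (F : I -> fibre B g) :
  k = ginv g ->
  fstar k (\sum_(i <- r | P i) F i) = \sum_(i <- r | P i) fstar k (F i).
Proof.
move=> kg; apply: (big_morph (@fstar g k)); last exact: fstar0.
by move=> u v; exact: fstarD.
Qed.

Lemma bstarK (b : B) : bstar (bstar b) = b.
Proof. exact: (star_semigroupoid_starK (bmul_star_semigroupoid B)). Qed.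

Lemma fstarK g k (u : fibre B g) : k = ginv g -> fstar g (fstar k u) = u.
Proof.
move=> kg; apply: incl_eq; rewrite incl_fstar ?kg ?ginvK// incl_fstar//.
exact: bstarK.
Qed.

Lemma fstarM g h k (u : fibre B g) (v : fibre B h) : gprod g h k ->
  fstar (ginv k) (fmul k u v) = fmul (ginv k) (fstar (ginv h) v) (fstar (ginv g) u).
Proof.
move=> ghk; apply: incl_eq; rewrite incl_fstar// incl_fmul//.
rewrite incl_fmul; last exact: gprod_inv.
rewrite !incl_fstar//.
have [_ _ starM] := bmul_star_semigroupoid B.
by have [|_ ->] := starM (incl u) (incl v); rewrite ?bproj_incl//; case: ghk.
Qed.

(* The fibre at k is meant to be the one at ginv g * h. *)
Definition fdot g h k (u : fibre B g) (v : fibre B h) : fibre B k :=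
  fmul k (fstar (ginv g) u) v.

Lemma cnorm_fdot_self g (u : fibre B g) :
  cnorm (fdot (gsource g) u u) = cnorm u ^+ 2.
Proof.
rewrite -!bnorm_incl -bnorm_starM; congr bnorm.
by rewrite incl_fmul ?incl_fstar//; exact: gprod_invl.
Qed.

(** From ||v||^2 = ||v*v|| one gets that v has norm at most that of its adjoint; the converse is the
    same statement for the adjoint. *)
Lemma cnorm_fstar g k (u : fibre B g) : k = ginv g -> cnorm (fstar k u) = cnorm u.
Proof.
move=> kg; have le g' k' (v : fibre B g') : k' = ginv g' -> cnorm v <= cnorm (fstar k' v).
  move=> ->; have [v0|v0] := eqVneq (cnorm v) 0; first by rewrite v0 cnorm_ge0.
  have vp : 0 < cnorm v by rewrite lt_neqAle eq_sym v0 cnorm_ge0.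
  rewrite -(ler_pM2r vp) -expr2 -cnorm_fdot_self.
  exact/cnorm_fmul/gprod_invl.
apply/le_anti; rewrite [X in _ && X]le//.
by rewrite -[in X in _ <= X](fstarK u kg) le// kg ginvK.
Qed.

Lemma cnorm_fdot g h k (u : fibre B g) (v : fibre B h) :
  gprod (ginv g) h k -> cnorm (fdot k u v) <= cnorm u * cnorm v.
Proof. by move=> /cnorm_fmul/le_trans; apply; rewrite cnorm_fstar. Qed.

Lemma fdotDl g h k (u v : fibre B g) (w : fibre B h) : gprod (ginv g) h k ->
  fdot k (u + v) w = fdot k u w + fdot k v w.
Proof. by move=> ghk; rewrite /fdot fstarD// fmulDl. Qed.

Lemma fdotDr g h k (u v : fibre B h) (w : fibre B g) : gprod (ginv g) h k ->
  fdot k w (u + v) = fdot k w u + fdot k w v.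
Proof. by move=> ghk; rewrite /fdot fmulDr. Qed.

Lemma fdotZl g h k (l : R[i]) (u : fibre B g) (w : fibre B h) :
  gprod (ginv g) h k -> fdot k (l *: u) w = l^* *: fdot k u w.
Proof. by move=> ghk; rewrite /fdot fstarZ// fmulZl. Qed.

Lemma fdotZr g h k (l : R[i]) (u : fibre B h) (w : fibre B g) :
  gprod (ginv g) h k -> fdot k w (l *: u) = l *: fdot k w u.
Proof. by move=> ghk; rewrite /fdot fmulZr. Qed.

Lemma fdotNl g h k (u : fibre B g) (w : fibre B h) : gprod (ginv g) h k ->
  fdot k (- u) w = - fdot k u w.
Proof. by move=> ghk; rewrite /fdot fstarN// fmulNl. Qed.

Lemma fdotNr g h k (u : fibre B h) (w : fibre B g) : gprod (ginv g) h k ->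
  fdot k w (- u) = - fdot k w u.
Proof. by move=> ghk; rewrite /fdot fmulNr. Qed.

Lemma fdot_suml g h k (I : Type) (r : seq I) (P : pred I) (F : I -> fibre B g)
    (w : fibre B h) : gprod (ginv g) h k ->
  fdot k (\sum_(i <- r | P i) F i) w = \sum_(i <- r | P i) fdot k (F i) w.
Proof. by move=> ghk; rewrite /fdot fstar_sum// fmul_suml. Qed.

Lemma fdot_sumr g h k (I : Type) (r : seq I) (P : pred I) (F : I -> fibre B h)
    (w : fibre B g) : gprod (ginv g) h k ->
  fdot k w (\sum_(i <- r | P i) F i) = \sum_(i <- r | P i) fdot k w (F i).
Proof. by move=> ghk; rewrite /fdot fmul_sumr. Qed.

Lemma gprod_inv_invl g h k : gprod (ginv g) h k -> gprod (ginv h) g (ginv k).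
Proof. by move/gprod_inv; rewrite ginvK. Qed.

(** The hypotheses live in the total space, so the factors may lie over arrows that are equal
    without being convertible. *)
Lemma fmul_congr g g' h h' k (u : fibre B g) (u' : fibre B g') (v : fibre B h)
    (v' : fibre B h') : incl u = incl u' -> incl v = incl v' ->
  fmul k u v = fmul k u' v'.
Proof. by rewrite /fmul => -> ->. Qed.

Lemma incl_fstarK g k l (u : fibre B g) : k = ginv g -> l = g ->
  incl (fstar l (fstar k u)) = incl u.
Proof. by move=> kg ->; rewrite fstarK. Qed.

Lemma fstar_fdot g h k k' (u : fibre B g) (v : fibre B h) :
  gprod (ginv g) h k -> k' = ginv k -> fstar k' (fdot k u v) = fdot k' v u.
Proof.
move=> ghk ->; rewrite fstarM//; apply: fmul_congr => //.
by rewrite incl_fstarK ?ginvK.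
Qed.

Lemma fdotA (a b c d g h : G) (u : fibre B a) (p : fibre B b) (v : fibre B c) :
  gprod b c g -> gprod (ginv a) g h -> gprod (ginv b) a d ->
  fdot h (fdot d p u) v = fdot h u (fmul g p v).
Proof.
move=> bcg agh bad; have abd := gprod_inv_invl bad.
rewrite /fdot -(@fmulA (ginv a) b c (ginv d) g h)//; last first.
  have [cg e] := abd; split; first by rewrite -e gsource_mul//; case: bcg.
  case: agh => ag <-; case: bcg => bc <-; rewrite -e gmulA//.
apply: fmul_congr => //.
by rewrite -[fmul d _ _]/(fdot d p u) (fstar_fdot p u bad).
Qed.

(* The fibre at g as a right Hilbert module over the fibre at its source. *)
Definition fibre_form g : innerForm R := @InnerForm R (fibre B g)
  (fibre B (gsource g)) (fun u v => fdot (gsource g) u v)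
  (fun u v w => fdotDl u v w (gprod_invl g))
  (fun u v w => fdotDr u v w (gprod_invl g))
  (fun (l : R[i]) u v => fdotZl l u v (gprod_invl g))
  (fun (l : R[i]) u v => fdotZr l v u (gprod_invl g))
  (@cnorm_fdot_self g) (fun u v => cnorm_fdot u v (gprod_invl g)).

Lemma gprod_unit x : gsource x = x -> gprod x x x.
Proof. by move=> xu; split; rewrite ?gunit_range// -{2}xu gmul_source. Qed.

Lemma fmul_half_adjoint x g (p q : fibre B x) : x = grange g ->
  fstar x p = q ->
  @half_adjoint R (@fibre_form g) (fmul g p : fibre B g -> fibre B g) (fmul g q).
Proof.
move=> xg <-; have xgg : gprod x g g by rewrite xg; exact: gprod_range_l.
have xi : x = ginv x by rewrite gunit_inv// xg gsource_range.
split; first by exists (cnorm p) => v; exact: cnorm_fmul.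
move=> u v; rewrite -[RHS](@fdotA g x g g g (gsource g))//.
- congr fdot; rewrite /fdot; apply: fmul_congr => //.
  by rewrite incl_fstarK// -xi.
- exact: gprod_invl.
- by rewrite -xi.
Qed.

Lemma gunit_inv_range x g : x = grange g -> x = ginv x.
Proof. by move=> ->; rewrite gunit_inv// gsource_range. Qed.

Definition lmul x g (xg : x = grange g) (p : fibre B x) :
    adjointable (fibre_form g) :=
  Adjointable (fmul_half_adjoint xg erefl)
    (fmul_half_adjoint xg (fstarK p (gunit_inv_range xg))).

Section Unit.
Variables (x g : G) (xg : x = grange g).
Implicit Types p q : fibre B x.
Local Notation L := (@lmul x g xg).

Let xgg : gprod x g g. Proof. by rewrite xg; exact: gprod_range_l. Qed.
Let xxx : gprod x x x.
Proof. by apply: gprod_unit; rewrite xg gsource_range. Qed.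

Lemma lmulE p (u : fibre B g) : L p u = fmul g p u. Proof. by []. Qed.

Lemma lmulD p q : L (p + q) = L p + L q.
Proof. by apply: adj_eq => u; exact: fmulDl. Qed.

Lemma lmulM p q : L (fmul x p q) = L p * L q.
Proof. by apply: adj_eq => u; exact: (fmulA _ _ _ xxx xgg xgg). Qed.

Lemma lmul_star p : L (fstar x p) = adjoint (L p).
Proof. exact: adj_eq. Qed.

Lemma opnorm_lmul p : opnorm_le (L p) (cnorm p).
Proof. by move=> u; exact: cnorm_fmul. Qed.

End Unit.

(** Left multiplication on the fibre itself is used because adjointable operators have a unit even
    where the fibre has none. The existential supplies the proof, required by [lmul], that [x] is a
    unit. *)
Definition fpos x (p : fibre B x) :=
  exists xx : x = grange x, oppos (lmul xx p).

(** The element [u] lies over an arbitrary arrow, so u*u is not visibly of the form T*T for an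
    operator on the fibre over the unit. By [bstarM_square] it equals v*v with v over the unit, and
    then [oppos_adjM] applies. *)
Lemma fpos_fdot g (u : fibre B g) : fpos (fdot (gsource g) u u).
Proof.
set x := gsource g; have xu : gsource x = x by exact: gsource_source.
have xx : x = grange x by rewrite gunit_range.
have [b [bx bb]] := bstarM_square (incl u).
exists xx; have gx := gprod_invl g.
have xi : x = ginv x by rewrite gunit_inv.
pose v : fibre B x := at_fibre x b.
have bE : incl v = b.
  by apply: at_fibreK; rewrite bx -(incl_fstar u erefl) -(incl_fmul _ _ gx) bproj_incl.
have -> : fdot x u u = fmul x (fstar x v) v.
  have xxx := gprod_unit xu.
  apply: incl_eq; rewrite incl_fmul// incl_fstar//.
  by rewrite incl_fmul// incl_fstar// bE bb.
by rewrite lmulM lmul_star; exact: oppos_adjM.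
Qed.

Lemma fposD x (p q : fibre B x) : fpos p -> fpos q -> fpos (p + q).
Proof.
move=> [xx p0] [xx' q0]; exists xx; rewrite lmulD; apply: oppos_add => //.
by rewrite (Prop_irrelevance xx xx').
Qed.

Lemma fpos0 x : gsource x = x -> fpos (0 : fibre B x).
Proof.
move=> xu; exists (esym (gunit_range xu)).
rewrite (_ : lmul _ _ = 0); first exact: oppos0.
by apply: adj_eq => u; apply: fmul0l; exact: gprod_unit.
Qed.

Lemma fpos_sum x (I : Type) (r : seq I) (P : pred I) (F : I -> fibre B x) :
  gsource x = x -> (forall i, P i -> fpos (F i)) -> fpos (\sum_(i <- r | P i) F i).
Proof. by move=> xu FP; apply: big_ind => //; [exact: fpos0|exact: fposD]. Qed.

(** The comparison of left multiplications is evaluated at [p]: ||p||^2 = ||p p|| is at most ||p +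
    q|| ||p||. *)
Lemma cnorm_fposD x (p q : fibre B x) : fpos p -> fpos q ->
  cnorm p <= cnorm (p + q).
Proof.
move=> [xx p0] [xx' q0]; rewrite (Prop_irrelevance xx' xx) in q0.
have xu : gsource x = x by rewrite xx gsource_range.
have xxx := gprod_unit xu.
have [->|pn0] := eqVneq p 0; first by rewrite cnorm0 cnorm_ge0.
have pp : 0 < cnorm p.
  by rewrite lt_neqAle cnorm_ge0 andbT; apply: contra_neq pn0 => /esym/cnorm_eq0.
have := oppos_opnorm_le_add (cnorm_ge0 (p + q)) p0 q0.
rewrite -lmulD => /(_ (@opnorm_lmul _ _ _ _)) /(_ p).
have -> : cnorm (lmul xx p p) = cnorm p ^+ 2.
  rewrite -cnorm_fdot_self; have -> : lmul xx p p = lmul xx (fstar x p) p.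
    by case: p0 => ps _; rewrite lmul_star ps.
  rewrite lmulE -!bnorm_incl !incl_fmul//; last exact: gprod_invl.
  by rewrite !incl_fstar// gunit_inv.
by rewrite expr2 ler_pM2r.
Qed.

Lemma cnorm_fpos_le x (p q : fibre B x) : fpos p -> fpos (q - p) ->
  cnorm p <= cnorm q.
Proof. by move=> p0 qp0; have := cnorm_fposD p0 qp0; rewrite addrC subrK. Qed.

End FellAlgebra.

(** * The Cauchy-Schwarz inequality *)

Section CauchySchwarz.
Variables (R : realType) (G : etaleGroupoid) (B : fellBundle R G).
Implicit Types (g h k x : G).

Lemma fposZ x (p : fibre B x) (t : R) : 0 <= t -> fpos p -> fpos (t%:C *: p).
Proof.
move=> t0 [xx p0]; exists xx.
have xxx : gprod x x x by apply: gprod_unit; rewrite xx gsource_range.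
have -> : lmul xx (t%:C *: p) = t%:C *: lmul xx p.
  by apply: adj_eq => u; rewrite adjEs !lmulE fmulZl.
exact: opposZ.
Qed.

Lemma fdot_mull (a b c d e h : G) (v : fibre B a) (u : fibre B c)
    (w : fibre B d) : gprod a c b -> gprod (ginv b) d h -> gprod (ginv a) d e ->
  fdot h (fmul b v u) w = fdot h u (fdot e v w).
Proof.
move=> acb bdh ade; rewrite /fdot fstarM//.
by rewrite (fmulA _ _ _ (gprod_inv acb) ade bdh).
Qed.

Lemma fdot_mulr (a b c d e h : G) (v : fibre B a) (u : fibre B c)
    (w : fibre B d) : gprod a c b -> gprod (ginv d) b h -> gprod (ginv d) a e ->
  fdot h w (fmul b v u) = fmul h (fdot e w v) u.
Proof.
move=> acb dbh dae; rewrite /fdot -(fmulA _ _ _ dae acb)//.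
have [da <-] := dae; have [ac bE] := acb; have [db <-] := dbh.
by split; rewrite ?gsource_mul// -bE gmulA.
Qed.

(** Completing the square. Write a, p, q for the three sums. For t > ||p||, put Z_i = w_i - v_i a /
    t and y = (1 - p / t)^(1/2) a. Then q - a*a / t is the sum of the Z_i* Z_i plus y*y / t, hence
    positive, so ||a||^2 is at most t ||q||. *)
Lemma cauchy_schwarz (I : Type) (r : seq I) (P : pred I) (al be : I -> G) k
    (v : forall i, fibre B (al i)) (w : forall i, fibre B (be i)) :
  (forall i, P i -> gprod (ginv (al i)) (be i) k) ->
  cnorm (\sum_(i <- r | P i) fdot k (v i) (w i)) ^+ 2 <=
  cnorm (\sum_(i <- r | P i) fdot (grange k) (v i) (v i)) *
  cnorm (\sum_(i <- r | P i) fdot (gsource k) (w i) (w i)).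
Proof.
move=> Pk; set a := \sum_(i <- r | P i) fdot k _ _.
set p := \sum_(i <- r | P i) fdot (grange k) _ _.
set q := \sum_(i <- r | P i) _.
have kk := gprod_range_l k; have k1 := gprod_source_r k; have ki := gprod_invl k.
have su := gsource_source k; have si := esym (gunit_inv su).
have ri := gunit_inv (gsource_range k).
have Pb i : P i -> gprod (al i) k (be i).
  by move=> /Pk/gprod_invlr; rewrite ginvK.
have Ps i : P i -> gsource (be i) = gsource k by move=> /Pk/gprod_source.
have Pr i : P i -> gsource (al i) = grange k.
  by move=> /Pk/gprod_range; rewrite grange_inv.
have Pa i : P i -> gprod (ginv (al i)) (al i) (grange k).
  by move=> Pi; rewrite -(Pr i Pi); exact: gprod_invl.
have Pbb i : P i -> gprod (ginv (be i)) (be i) (gsource k).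
  by move=> Pi; rewrite -(Ps i Pi); exact: gprod_invl.
have p' : fstar (grange k) p = p.
  rewrite fstar_sum//; apply: eq_bigr => i Pi.
  by apply: fstar_fdot => //; exact: Pa.
(* The strict inequality makes the square root of 1 - p / t available; at the end t tends to the
   norm of p. *)
have main t : cnorm p < t -> cnorm a ^+ 2 <= t * cnorm q.
  move=> pt; have t0 : 0 < t by exact: le_lt_trans (cnorm_ge0 _) pt.
  have ti0 : 0 <= t^-1 by rewrite invr_ge0 ltW.
  pose D := fdot (gsource k) a a; pose E := fdot (gsource k) a (fmul k p a).
  pose c := (t^-1)%:C *: a.
  pose Z i := w i - fmul (be i) (v i) c.
  pose H := (t^-1)%:C *: lmul (erefl (grange k)) p.
  have H' : selfadj H by apply: selfadjZ; rewrite /selfadj -lmul_star p'.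
  have [||S [S' SH _]] := @selfadj_sqrt _ _ H (t^-1 * cnorm p) H'.
  - by rewrite mulr_ge0 ?cnorm_ge0//= mulrC ltr_pdivrMr// mul1r.
  - by apply: opnorm_leZr => //; exact: opnorm_lmul.
  pose y : fibre B k := (1 - S) a.
  have yE : fdot (gsource k) y y = D - (t^-1)%:C *: E.
    have r' : selfadj (1 - S) by apply: selfadjD; [exact: selfadj1|exact: selfadjN].
    have -> : fdot (gsource k) y y = iform (a : fibre_form B k) (((1 - S) * (1 - S)) a).
      rewrite adj_mulE; have := adjE (1 - S) a ((1 - S) a).
      by rewrite -[adj_star _ _]/(adjoint (1 - S) _) r'.
    rewrite SH !adjEs iformBr; congr (_ - _).
    by rewrite iformZr.
  have DE : fdot (gsource k) a c = (t^-1)%:C *: D by rewrite fdotZr.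
  have DE' : fdot (gsource k) c a = (t^-1)%:C *: D.
    by rewrite fdotZl// conj_realc.
  have EE : fdot (gsource k) c (fmul k p c) = (t^-1 * t^-1)%:C *: E.
    by rewrite fdotZl// conj_realc fmulZr// fdotZr// scalerA -rmorphM.
  have ZE : \sum_(i <- r | P i) fdot (gsource k) (Z i) (Z i) =
      q - fdot (gsource k) a c - fdot (gsource k) c a +
      fdot (gsource k) c (fmul k p c).
    have e1 : fdot (gsource k) c a =
        \sum_(i <- r | P i) fdot (gsource k) (fmul (be i) (v i) c) (w i).
      rewrite fdot_sumr//; apply: eq_bigr => i Pi; apply/esym.
      by apply: fdot_mull; [exact: Pb|exact: Pbb|exact: Pk].
    have e2 : fdot (gsource k) a c =
        \sum_(i <- r | P i) fdot (gsource k) (w i) (fmul (be i) (v i) c).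
      rewrite -(fstar_fdot c a ki si) e1 fstar_sum//; apply: eq_bigr => i Pi.
      by apply: fstar_fdot => //; exact: Pbb.
    have e3 : fdot (gsource k) c (fmul k p c) = \sum_(i <- r | P i)
        fdot (gsource k) (fmul (be i) (v i) c) (fmul (be i) (v i) c).
      rewrite fmul_suml// fdot_sumr//; apply: eq_bigr => i Pi.
      rewrite (fdot_mull (e := k) _ _ _ (Pb i Pi) (Pbb i Pi) (Pk i Pi)).
      by rewrite (fdot_mulr _ _ _ (Pb i Pi) (Pk i Pi) (Pa i Pi)).
    rewrite e1 e2 e3 -!sumrB -big_split/=; apply: eq_bigr => i Pi.
    have bb := Pbb i Pi.
    rewrite /Z fdotDl// !fdotDr// fdotNl// fdotNr// fdotNl// fdotNr// opprK.
    by zmod.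
  have DZ : q - (t^-1)%:C *: D = \sum_(i <- r | P i) fdot (gsource k) (Z i) (Z i) +
      (t^-1)%:C *: fdot (gsource k) y y.
    rewrite ZE DE DE' EE yE scalerBr scalerA -rmorphM/=.
    by zmod.
  have D0 : fpos ((t^-1)%:C *: D) by apply: fposZ => //; exact: fpos_fdot.
  have : cnorm ((t^-1)%:C *: D) <= cnorm q.
    apply: cnorm_fpos_le => //; rewrite DZ; apply: fposD.
      by apply: fpos_sum => // i Pi; rewrite -(Ps i Pi); exact: fpos_fdot.
    by apply: fposZ => //; exact: fpos_fdot.
  rewrite cnormZr ger0_norm// cnorm_fdot_self => le.
  by rewrite mulrC -ler_pdivrMr// mulrC.
have q0 : 0 < cnorm q + 1 by rewrite ltr_wpDl ?cnorm_ge0.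
apply/ler_addgt0Pr => e e0.
have := main (cnorm p + e / (cnorm q + 1)); rewrite ltrDl divr_gt0// => /(_ isT).
move=> /le_trans; apply; rewrite mulrDl lerD2l mulrAC ler_pdivrMr//.
by rewrite ler_pM2l// lerDl.
Qed.

End CauchySchwarz.

(** * Finite square sums and bounded sections *)

Section SquareSums.
Variables (R : realType) (G : etaleGroupoid) (B : fellBundle R G).
Implicit Types (g h k x : G) (F D : {fset G}) (a b f u v w : sections B) (l : R[i]).

Lemma sectionsD v w g : (v + w) g = v g + w g. Proof. by []. Qed.
Lemma sectionsZ l v g : (l *: v) g = l *: v g. Proof. by []. Qed.
Lemma sections0 g : (0 : sections B) g = 0. Proof. by []. Qed.
Lemma sectionsN v g : (- v) g = - v g. Proof. by []. Qed.

(** The restriction to source [x] is a predicate in the sum, so [F] can be any finite set of arrows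
    and unions need no side conditions. *)
Definition sform x F v w : fibre B x :=
  \sum_(g <- F | gsource g == x) fdot x (v g) (w g).

Definition l2norm x F v : R := Num.sqrt (cnorm (sform x F v v)).

Lemma gprod_invl_eq g x : gsource g == x -> gprod (ginv g) g x.
Proof. by move=> /eqP <-; exact: gprod_invl. Qed.

Lemma sformDl x F u v w : sform x F (u + v) w = sform x F u w + sform x F v w.
Proof.
by rewrite -big_split/=; apply: eq_bigr => g /gprod_invl_eq gx; rewrite -fdotDl.
Qed.

Lemma sformDr x F u v w : sform x F w (u + v) = sform x F w u + sform x F w v.
Proof.
by rewrite -big_split/=; apply: eq_bigr => g /gprod_invl_eq gx; rewrite -fdotDr.
Qed.

Lemma sformZl x F l u v : sform x F (l *: u) v = l^* *: sform x F u v.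
Proof.
by rewrite scaler_sumr; apply: eq_bigr => g /gprod_invl_eq gx; rewrite -fdotZl.
Qed.

Lemma sformZr x F l u v : sform x F v (l *: u) = l *: sform x F v u.
Proof.
by rewrite scaler_sumr; apply: eq_bigr => g /gprod_invl_eq gx; rewrite -fdotZr.
Qed.

Lemma l2norm_ge0 x F v : 0 <= l2norm x F v.
Proof. exact: sqrtr_ge0. Qed.

Lemma sqr_l2norm x F v : l2norm x F v ^+ 2 = cnorm (sform x F v v).
Proof. by rewrite sqr_sqrtr// cnorm_ge0. Qed.

Lemma fpos_sform x F v : gsource x = x -> fpos (sform x F v v).
Proof. by move=> xu; apply: fpos_sum => // g /eqP <-; exact: fpos_fdot. Qed.

Lemma cnorm_sform x F v w : gsource x = x ->
  cnorm (sform x F v w) <= l2norm x F v * l2norm x F w.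
Proof.
move=> xu; rewrite -(@ler_pXn2r _ 2%N) ?nnegrE ?mulr_ge0 ?l2norm_ge0 ?cnorm_ge0//.
rewrite exprMn !sqr_l2norm.
have := @cauchy_schwarz R G B G F (fun g => gsource g == x) id id x v w.
by rewrite gunit_range// xu; apply => g; exact: gprod_invl_eq.
Qed.

Lemma l2normD x F v w : gsource x = x ->
  l2norm x F (v + w) <= l2norm x F v + l2norm x F w.
Proof.
move=> xu; rewrite -(@ler_pXn2r _ 2%N) ?nnegrE ?addr_ge0 ?l2norm_ge0//.
rewrite sqr_l2norm sformDl !sformDr (le_trans (cnormD _ _))//.
rewrite (_ : _ ^+ 2 = (l2norm x F v ^+ 2 + l2norm x F v * l2norm x F w) +
  (l2norm x F w * l2norm x F v + l2norm x F w ^+ 2)); last by ring.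
rewrite !sqr_l2norm; apply: lerD; rewrite (le_trans (cnormD _ _))//.
  by rewrite lerD2l cnorm_sform.
by rewrite lerD2r cnorm_sform.
Qed.

Lemma l2normZ x F l v : l2norm x F (l *: v) = cmod l * l2norm x F v.
Proof.
have l0 : 0 <= cmod l by rewrite -ler0c cmodE.
rewrite /l2norm sformZl sformZr !cnormZ mulrA [cmod l^*](_ : _ = cmod l); last first.
  by apply: complexI; rewrite !cmodE norm_conjC.
by rewrite sqrtrM ?mulr_ge0// -expr2 sqrtr_sqr ger0_norm.
Qed.

Lemma l2normN x F v : l2norm x F (- v) = l2norm x F v.
Proof.
rewrite -scaleN1r l2normZ (_ : -1 = (-1)%:C :> R[i]); last by rewrite rmorphN rmorph1.
by rewrite cmodr normrN normr1 mul1r.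
Qed.

Lemma l2normB x F v w : gsource x = x ->
  l2norm x F (v - w) <= l2norm x F v + l2norm x F w.
Proof. by move=> xu; rewrite -(l2normN _ _ w) l2normD. Qed.

Lemma l2norm0 x F : l2norm x F 0 = 0.
Proof. by rewrite -(scale0r (0 : sections B)) l2normZ (cmodr 0) normr0 mul0r. Qed.

Lemma eq_l2norm x F v w : (forall g, g \in F -> gsource g = x -> v g = w g) ->
  l2norm x F v = l2norm x F w.
Proof.
move=> vw; congr (Num.sqrt (cnorm _)); rewrite /sform big_seq_cond.
rewrite [RHS]big_seq_cond; apply: eq_bigr => g /andP[gF /eqP gx].
by rewrite vw.
Qed.

Definition srestr D v : sections B := fun g => if g \in D then v g else 0.

Lemma sform_restr x F D v : (F `<=` D)%fset ->
  sform x D (srestr F v) (srestr F v) = sform x F v v.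
Proof.
move=> FD; have Fm := fsubsetP FD; rewrite /sform.
rewrite (bigID (mem F))/= [X in _ + X]big1 ?addr0; last first.
  move=> g /andP[/gprod_invl_eq gx gF].
  by rewrite /srestr (negbTE gF) /fdot fmul0r.
rewrite (eq_bigl (fun g => (g \in F) && (gsource g == x))); last first.
  by move=> g; rewrite andbC.
rewrite -big_filter_cond.
have -> : \sum_(i <- [seq i <- D | i \in F] | gsource i == x)
     fdot x (srestr F v i) (srestr F v i) =
   \sum_(i <- F | gsource i == x) fdot x (srestr F v i) (srestr F v i).
  apply: perm_big; apply: uniq_perm; rewrite ?filter_uniq ?fset_uniq// => g.
  by rewrite mem_filter; case: (boolP (g \in F)) => //= /Fm ->.
rewrite big_seq_cond [RHS]big_seq_cond; apply: eq_bigr => g /andP[gF _].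
by rewrite /srestr gF.
Qed.

Lemma l2norm_restr x F D v : (F `<=` D)%fset ->
  l2norm x D (srestr F v) = l2norm x F v.
Proof. by move=> FD; rewrite /l2norm sform_restr. Qed.

Lemma l2norm_mono x F D v : gsource x = x -> (F `<=` D)%fset ->
  l2norm x F v <= l2norm x D v.
Proof.
move=> xu FD; rewrite -(l2norm_restr _ _ FD) ler_wsqrtr//.
apply: cnorm_fpos_le; first exact: fpos_sform.
rewrite -sumrB; apply: fpos_sum => // g gx.
rewrite /srestr; case: ifP => _; last first.
  rewrite {2}/fdot fmul0r ?subr0; last exact: gprod_invl_eq.
  by move/eqP : gx => <-; exact: fpos_fdot.
by rewrite subrr; exact: fpos0.
Qed.

Lemma l2norm1 g v : l2norm (gsource g) [fset g]%fset v = cnorm (v g).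
Proof.
rewrite /l2norm /sform big_mkcond big_seq_fset1 eqxx cnorm_fdot_self sqrtr_sqr.
by rewrite ger0_norm ?cnorm_ge0.
Qed.

End SquareSums.

(** * Convergence along source fibres *)

Existing Instance summability.totally_filter.

Lemma near_all_seq (T : Type) (X : set_system T) (I : eqType) (s : seq I)
    (Q : I -> T -> Prop) : Filter X ->
  (forall i, i \in s -> \forall t \near X, Q i t) ->
  \forall t \near X, forall i, i \in s -> Q i t.
Proof.
move=> FX; elim: s => [|i s IH] H; first by apply: nearW.
have H1 : \forall t \near X, Q i t by apply: H; rewrite mem_head.
have H2 : \forall t \near X, forall j, j \in s -> Q j t.
  by apply: IH => j js; apply: H; rewrite inE js orbT.
apply: filterS2 H1 H2 => t Qi Qs j; rewrite inE => /orP[/eqP ->//|].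
exact: Qs.
Qed.

Section SumsOverSourceFibres.
Variables (R : realType) (G : etaleGroupoid).
Implicit Types (g h k x y : G) (D E F : {fset G}).

Section Hassum.
Variable V : completeNormedModType R[i].
Implicit Types (Phi Psi : G -> V) (u v l : V).

Definition sfsum y Phi D : V := \sum_(h <- D | gsource h == y) Phi h.

(** Unconditional summation over the arrows with source [y]. The net runs over all finite sets of
    arrows, the predicate in [sfsum] discarding the others, so one index set serves for all [y]. *)
Definition hassum y Phi l : Prop := forall e : R, 0 < e ->
  \forall D \near summability.totally, cnorm (sfsum y Phi D - l) < e.

Lemma hassumP y Phi l : hassum y Phi l <-> forall e : R, 0 < e ->
  exists D0, forall D, (D0 `<=` D)%fset -> cnorm (sfsum y Phi D - l) < e.
Proof.
split=> H e /H; first by move=> [D0 _ HD]; exists D0.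
by move=> [D0 HD]; exists D0.
Qed.

Lemma hassumD y Phi Psi u v : hassum y Phi u -> hassum y Psi v ->
  hassum y (fun h => Phi h + Psi h) (u + v).
Proof.
move=> Hu Hv e e0; have e2 : 0 < e / 2 by rewrite divr_gt0.
apply: filterS2 (Hu _ e2) (Hv _ e2) => D Du Dv.
rewrite /sfsum big_split/= -/(sfsum _ _ _) -/(sfsum _ _ _) opprD addrACA.
by rewrite (le_lt_trans (cnormD _ _))// [ltRHS]splitr ltrD.
Qed.

Lemma eq_sfsum y Phi Psi D : (forall h, gsource h = y -> Phi h = Psi h) ->
  sfsum y Phi D = sfsum y Psi D.
Proof. by move=> PP; apply: eq_bigr => h /eqP/PP. Qed.

Lemma eq_hassum y Phi Psi l : (forall h, gsource h = y -> Phi h = Psi h) ->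
  hassum y Phi l -> hassum y Psi l.
Proof.
move=> PP H e /H; apply: filterS => D.
by rewrite (eq_sfsum _ PP).
Qed.

Lemma sfsumU y Phi D E : (forall h, h \in E -> gsource h = y -> h \in D) ->
  sfsum y Phi (D `|` E)%fset = sfsum y Phi D.
Proof.
move=> ED; rewrite /sfsum -big_filter -[RHS]big_filter; apply: perm_big.
apply: uniq_perm; rewrite ?filter_uniq ?fset_uniq// => h.
rewrite !mem_filter; case: eqP => //= hy; rewrite inE orbC.
by case: (boolP (h \in E)) => //= /ED ->.
Qed.

Lemma sfsum_disjU y Phi D E : [disjoint D & E]%fset ->
  sfsum y Phi (D `|` E)%fset = sfsum y Phi D + sfsum y Phi E.
Proof.
move=> DE; rewrite /sfsum -big_filter -[X in _ = X + _]big_filter.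
rewrite -[X in _ = _ + X]big_filter -big_cat; apply: perm_big.
apply: uniq_perm; first by rewrite filter_uniq ?fset_uniq.
  rewrite -filter_cat filter_uniq// cat_uniq !fset_uniq andbT/=.
  apply/hasPn => h hE; apply/negP => hD.
  by move/fdisjointP : DE => /(_ h hD); rewrite hE.
by move=> h; rewrite mem_cat !mem_filter inE; case: (gsource h == y).
Qed.

Lemma hassum_cauchy y Phi : (forall e : R, 0 < e -> exists D0, forall D,
  [disjoint D & D0]%fset -> cnorm (sfsum y Phi D) < e) -> exists l, hassum y Phi l.
Proof.
move=> H; have [|l Hl] := @cnorm_cauchy_cvg _ V
    (sfsum y Phi @ summability.totally) _.
  move=> e /H[D0 HD]; exists (sfsum y Phi D0); exists D0 => // D /= D0D.
  have DE : (D `\` D0 `|` D0)%fset = D.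
    rewrite fsetUC -[RHS](fsetID D0 D); congr (_ `|` _)%fset.
    by apply/esym/fsetIidPr.
  have dj : [disjoint D `\` D0 & D0]%fset.
    by apply/fdisjointP => z; rewrite inE => /andP[].
  by rewrite -DE sfsum_disjU// addrK; exact: HD.
by exists l.
Qed.

(** Right translation by [g] is a bijection from the arrows with source [grange g] onto those with
    source [gsource g], with inverse the translation by [ginv g]. All changes of summation index
    below are of this kind. *)
Definition rtransl g E : {fset G} :=
  [fset h in [seq gmul k g | k <- E & gsource k == grange g]]%fset.

Lemma mem_rtransl g E k : k \in E -> gsource k = grange g ->
  gmul k g \in rtransl g E.
Proof.
by move=> kE kg; rewrite !inE; apply/map_f; rewrite mem_filter kg eqxx.
Qed.

Lemma rtranslP g E h : h \in rtransl g E ->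
  exists k, [/\ k \in E, gsource k = grange g & h = gmul k g].
Proof.
rewrite !inE => /mapP[k]; rewrite mem_filter => /andP[/eqP kg kE] ->.
by exists k.
Qed.

Lemma gmul_inj g k k' : gsource k = grange g -> gsource k' = grange g ->
  gmul k g = gmul k' g -> k = k'.
Proof. by move=> kg kg' e; rewrite -(gmulK kg) e gmulK. Qed.

Lemma sfsum_rtransl g Phi E :
  sfsum (gsource g) Phi (rtransl g E) = sfsum (grange g) (fun k => Phi (gmul k g)) E.
Proof.
rewrite /sfsum -big_filter -[RHS]big_filter -[RHS](big_map (fun k => gmul k g) xpredT).
apply: perm_big; apply: uniq_perm.
- by rewrite filter_uniq ?fset_uniq.
- rewrite map_inj_in_uniq ?filter_uniq ?fset_uniq// => k k'.
  rewrite !mem_filter => /andP[/eqP kg _] /andP[/eqP kg' _]; exact: gmul_inj.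
- move=> h; rewrite mem_filter; apply/andP/mapP.
    move=> [/eqP hg /rtranslP[k [kE kg ->]]]; exists k => //.
    by rewrite mem_filter kg eqxx.
  move=> [k]; rewrite mem_filter => /andP[/eqP kg kE] ->.
  by rewrite gsource_mul// eqxx mem_rtransl.
Qed.

Lemma hassum_rtransl g Phi l : hassum (gsource g) Phi l ->
  hassum (grange g) (fun k => Phi (gmul k g)) l.
Proof.
move=> /hassumP H; apply/hassumP => e /H[D0 HD].
exists (rtransl (ginv g) D0) => E D0E; rewrite -sfsum_rtransl.
have -> : sfsum (gsource g) Phi (rtransl g E) =
    sfsum (gsource g) Phi (rtransl g E `|` D0)%fset.
  rewrite sfsumU// => h hD0 hg.
  have -> : h = gmul (gdiv h g) g by rewrite gdivK.
  apply: mem_rtransl; last by rewrite gsource_div.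
  by move/fsubsetP : D0E; apply; apply: mem_rtransl => //; rewrite grange_inv.
by apply: HD; exact: fsubsetUr.
Qed.

End Hassum.

(** Stated for additive maps in order to cover the antilinear [fstar] as well as right
    multiplications. *)
Lemma hassum_map (V W : completeNormedModType R[i]) (T : V -> W) (K : R) y
    (Phi : G -> V) l : (forall u v, T (u + v) = T u + T v) ->
  (forall u, cnorm (T u) <= K * cnorm u) ->
  hassum y Phi l -> hassum y (fun h => T (Phi h)) (T l).
Proof.
move=> TD TK H e e0; have T0 : T 0 = 0.
  by apply: (addrI (T 0)); rewrite -TD !addr0.
have TN u : T (- u) = - T u by apply/eqP; rewrite -addr_eq0 -TD addNr T0.
have K1 : 0 < `|K| + 1 by rewrite ltr_wpDl.
apply: filterS (H _ (divr_gt0 e0 K1)) => D HD.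
have -> : sfsum y (fun h => T (Phi h)) D - T l = T (sfsum y Phi D - l).
  by rewrite TD TN; congr (_ - _); rewrite /sfsum (big_morph T TD T0).
rewrite (le_lt_trans (TK _))//.
move: HD; rewrite ltr_pdivlMr// => /(le_lt_trans _); apply.
rewrite mulrC ler_wpM2l ?cnorm_ge0// (le_trans (ler_norm K))// lerDl.
exact: ler01.
Qed.

Lemma hassum0 (V : completeNormedModType R[i]) x : hassum x (fun=> 0 : V) 0.
Proof.
move=> e e0; apply: nearW => D.
by rewrite /sfsum big1// subr0 cnorm0.
Qed.

Lemma hassum_sum (V : completeNormedModType R[i]) x (I : Type) (r : seq I)
    (P : pred I) (Phi : I -> G -> V) (l : I -> V) :
  (forall i, P i -> hassum x (Phi i) (l i)) ->
  hassum x (fun h => \sum_(i <- r | P i) Phi i h) (\sum_(i <- r | P i) l i).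
Proof.
move=> H; elim: r => [|i r IH].
  rewrite big_nil; apply: eq_hassum (hassum0 V x) => h _.
  by rewrite big_nil.
rewrite big_cons; case: ifP => Pi.
  apply: eq_hassum (hassumD (H i Pi) IH) => h _.
  by rewrite big_cons Pi.
by apply: eq_hassum IH => h _; rewrite big_cons Pi.
Qed.

Lemma hassumZ (V : completeNormedModType R[i]) x (Phi : G -> V) (t : R[i]) l :
  hassum x Phi l -> hassum x (fun h => t *: Phi h) (t *: l).
Proof.
apply: (hassum_map (K := cmod t)) => [u v|u]; first exact: scalerDr.
by rewrite cnormZ.
Qed.

End SumsOverSourceFibres.

(** * Sections as bounded matrices on square-summable columns *)

Section BoundedSections.
Variables (R : realType) (G : etaleGroupoid) (B : fellBundle R G).
Implicit Types (g h k x : G) (F D E : {fset G}) (a b c d f u v w : sections B).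
Implicit Types (K L M : R).
Local Notation incl := (fibre_incl B).

Lemma incl_section a g h : g = h -> incl (a g) = incl (a h).
Proof. by move=> ->. Qed.

Lemma incl_sstar a g : incl (sstar a g) = bstar (incl (a (ginv g))).
Proof. by rewrite (incl_fstar (a (ginv g))) ?ginvK. Qed.

Lemma sstarK : involutive (@sstar R G B).
Proof.
move=> a; apply: functional_extensionality_dep => g; apply: incl_eq.
by rewrite !incl_sstar bstarK; apply: incl_section; rewrite ginvK.
Qed.

Lemma sstarD a b : sstar (a + b) = sstar a + sstar b.
Proof.
apply: functional_extensionality_dep => g; rewrite sectionsD.
by apply: fstarD; rewrite ginvK.
Qed.

Lemma sstarZ (l : R[i]) a : sstar (l *: a) = l^* *: sstar a.
Proof.
apply: functional_extensionality_dep => g; rewrite sectionsZ.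
by apply: fstarZ; rewrite ginvK.
Qed.

Lemma sstarN a : sstar (- a) = - sstar a.
Proof. by rewrite -scaleN1r sstarZ rmorphN rmorph1 scaleN1r. Qed.

(** Factorizations of [g] are indexed by their second factor [h], which runs over the arrows with
    the source of [g]. *)
Definition smul_term a b g h : fibre B g := fmul g (a (gdiv g h)) (b h).

Definition sapp a D b : sections B :=
  fun g => sfsum (gsource g) (smul_term a b g) D.

Lemma smul_termDl a b c g h : gsource h = gsource g ->
  smul_term (a + b) c g h = smul_term a c g h + smul_term b c g h.
Proof. by move=> hg; rewrite /smul_term -fmulDl//; exact: gprod_div. Qed.

Lemma smul_termDr a b c g h : gsource h = gsource g ->
  smul_term a (b + c) g h = smul_term a b g h + smul_term a c g h.
Proof. by move=> hg; rewrite /smul_term -fmulDr//; exact: gprod_div. Qed.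

Lemma smul_termZl (l : R[i]) a c g h : gsource h = gsource g ->
  smul_term (l *: a) c g h = l *: smul_term a c g h.
Proof. by move=> hg; rewrite /smul_term -fmulZl//; exact: gprod_div. Qed.

Lemma smul_termZr (l : R[i]) a c g h : gsource h = gsource g ->
  smul_term a (l *: c) g h = l *: smul_term a c g h.
Proof. by move=> hg; rewrite /smul_term -fmulZr//; exact: gprod_div. Qed.

Lemma sappDl a b D f : sapp (a + b) D f = sapp a D f + sapp b D f.
Proof.
apply: functional_extensionality_dep => g; rewrite sectionsD /sapp /sfsum.
by rewrite -big_split/=; apply: eq_bigr => h /eqP hg; exact: smul_termDl.
Qed.

Lemma sappDr a D f w : sapp a D (f + w) = sapp a D f + sapp a D w.
Proof.
apply: functional_extensionality_dep => g; rewrite sectionsD /sapp /sfsum.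
by rewrite -big_split/=; apply: eq_bigr => h /eqP hg; exact: smul_termDr.
Qed.

Lemma sappZl (l : R[i]) a D f : sapp (l *: a) D f = l *: sapp a D f.
Proof.
apply: functional_extensionality_dep => g; rewrite sectionsZ /sapp /sfsum.
by rewrite scaler_sumr; apply: eq_bigr => h /eqP hg; exact: smul_termZl.
Qed.

(** The matrix with entries a(g h^-1) has as its adjoint the matrix of [sstar a], with entries at h
    g^-1. *)
Lemma sform_sapp x F D a u f :
  sform x F u (sapp a D f) = sform x D (sapp (sstar a) F u) f.
Proof.
have E1 : sform x F u (sapp a D f) = \sum_(g <- F | gsource g == x)
    \sum_(h <- D | gsource h == x) fdot x (u g) (smul_term a f g h).
  apply: eq_bigr => g gx; rewrite fdot_sumr; last exact: gprod_invl_eq.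
  by apply: eq_bigl => h; rewrite (eqP gx).
have E2 : sform x D (sapp (sstar a) F u) f = \sum_(h <- D | gsource h == x)
    \sum_(g <- F | gsource g == x) fdot x (smul_term (sstar a) u h g) (f h).
  apply: eq_bigr => h hx; rewrite fdot_suml; last exact: gprod_invl_eq.
  by apply: eq_bigl => g; rewrite (eqP hx).
rewrite E1 E2 exchange_big/=; apply: eq_bigr => h hx; apply: eq_bigr => g gx.
have gh : gsource g = gsource h by rewrite (eqP gx) (eqP hx).
rewrite (@fdot_mull _ _ _ (gdiv h g) h g h g); last first.
- by rewrite ginv_div; [exact: gprod_div|exact: esym].
- exact: gprod_invl_eq.
- by apply: gprod_div.
congr fdot; apply: fmul_congr => //.
rewrite incl_fstar// incl_sstar bstarK; apply: incl_section.
by rewrite ginv_div.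
Qed.

(** An operator bound for the truncations of the matrix of [a] to rows in [F] and columns in [D].
    The clause [0 <= K] excludes negative constants, which the inequality admits when all [l2norm]
    vanish. *)
Definition bounded_by a K := 0 <= K /\ forall x F D f, gsource x = x ->
  l2norm x F (sapp a D f) <= K * l2norm x D f.

Lemma bounded_byW a K L : K <= L -> bounded_by a K -> bounded_by a L.
Proof.
move=> KL [K0 aK]; split; first exact: le_trans KL.
move=> x F D f xu; rewrite (le_trans (aK _ _ _ _ xu))//.
by rewrite ler_wpM2r ?l2norm_ge0.
Qed.

Lemma bounded_byD a b K L : bounded_by a K -> bounded_by b L ->
  bounded_by (a + b) (K + L).
Proof.
move=> [K0 aK] [L0 bL]; split; first exact: addr_ge0.
move=> x F D f xu; rewrite sappDl (le_trans (l2normD _ _ _ xu))// mulrDl.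
by apply: lerD; [exact: aK|exact: bL].
Qed.

Lemma bounded_byZ (l : R[i]) a K : bounded_by a K ->
  bounded_by (l *: a) (cmod l * K).
Proof.
move=> [K0 aK]; split; first by rewrite mulr_ge0// cmod_ge0.
move=> x F D f xu; rewrite sappZl l2normZ -mulrA ler_wpM2l ?cmod_ge0//.
exact: aK.
Qed.

Lemma bounded_byN a K : bounded_by a K -> bounded_by (- a) K.
Proof.
move=> /(bounded_byZ (-1)%:C); rewrite cmodr normrN normr1 mul1r.
by rewrite rmorphN rmorph1 scaleN1r.
Qed.

Lemma bounded_byB a b K L : bounded_by a K -> bounded_by b L ->
  bounded_by (a - b) (K + L).
Proof. by move=> aK bL; apply: bounded_byD => //; exact: bounded_byN. Qed.

(** With N the norm of a*u, one has N^2 = ||< u, a a*u >||, at most ||u|| K N; then N cancels unless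
    it is 0. *)
Lemma bounded_by_star a K : bounded_by a K -> bounded_by (sstar a) K.
Proof.
move=> [K0 aK]; split=> // x D F u xu.
set N := l2norm x D _; have N0 : 0 <= N by exact: l2norm_ge0.
have [->|Nn0] := eqVneq N 0; first by rewrite mulr_ge0// l2norm_ge0.
have Np : 0 < N by rewrite lt_neqAle eq_sym Nn0.
rewrite -(ler_pM2r Np) -expr2 sqr_l2norm -sform_sapp.
rewrite (le_trans (cnorm_sform _ _ _ xu))//.
by rewrite -mulrA mulrCA ler_wpM2l ?l2norm_ge0// aK.
Qed.

Lemma sapp1 a g f h : gsource h = gsource g -> sapp a [fset h]%fset f g = smul_term a f g h.
Proof. by move=> hg; rewrite /sapp /sfsum big_mkcond big_seq_fset1 hg eqxx. Qed.

Lemma cnorm_sq_unit x (p : fibre B x) : gsource x = x -> fstar x p = p ->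
  cnorm (fmul x p p) = cnorm p ^+ 2.
Proof.
move=> xu ps; have xi : x = ginv x by rewrite gunit_inv.
rewrite -cnorm_fdot_self -{1}ps -!bnorm_incl incl_fmul; last exact: gprod_unit.
rewrite incl_fmul; last exact: gprod_invl.
by rewrite !incl_fstar.
Qed.

Lemma fstar_sform x F v w : gsource x = x -> fstar x (sform x F v w) = sform x F w v.
Proof.
move=> xu; have xi : x = ginv x by rewrite gunit_inv.
rewrite fstar_sum//; apply: eq_bigr => g gx.
by apply: fstar_fdot => //; exact: gprod_invl_eq.
Qed.

(** Without a unit in the fibre over [x], the column of [a] is not of the form a f. The test vector
    is p = sum of a(g)* a(g), placed at [x]: p^2 is the form of a with a f, so N^4 = ||p^2|| is at
    most N K ||p|| = K N^3. *)
Lemma bounded_by_l2norm a K x F : gsource x = x -> bounded_by a K ->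
  l2norm x F a <= K.
Proof.
move=> xu [K0 aK]; pose p := sform x F a a; set N := l2norm x F a.
have xxx := gprod_unit xu.
have N0 : 0 <= N by exact: l2norm_ge0.
have pN : cnorm p = N ^+ 2 by rewrite sqr_l2norm.
have ps : fstar x p = p by exact: fstar_sform.
(* The section with value p at x: over every other arrow [at_fibre] takes its default value 0. *)
pose f : sections B := fun g => at_fibre g (incl p).
have fx : f x = p by exact: inclK.
have pp : fmul x p p = sform x F a (sapp a [fset x]%fset f).
  rewrite fmul_suml//; apply: eq_bigr => g gx.
  have gxg : gprod g x g by rewrite -(eqP gx); exact: gprod_source_r.
  have ggx := gprod_invl_eq gx.
  rewrite -(fdot_mulr _ _ _ gxg ggx ggx); congr fdot.
  rewrite sapp1 ?xu ?(eqP gx)// /smul_term fx; apply: fmul_congr => //.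
  apply: incl_section; rewrite /gdiv gunit_inv//.
  by case: gxg.
have [->//|Nn0] := eqVneq N 0.
have Np : 0 < N by rewrite lt_neqAle eq_sym Nn0.
have N3 : 0 < N ^+ 3 by rewrite exprn_gt0.
rewrite -(ler_pM2r N3) -exprS.
have -> : N ^+ 4 = cnorm (fmul x p p).
  by rewrite cnorm_sq_unit// pN -exprM.
rewrite pp (le_trans (cnorm_sform _ _ _ xu))// -/N.
have -> : K * N ^+ 3 = N * (K * N ^+ 2) by ring.
rewrite ler_wpM2l// (le_trans (aK _ _ _ _ xu))// ler_wpM2l//.
by rewrite -{1}xu l2norm1 -pN fx.
Qed.

Lemma bounded_by_pointwise a K g : bounded_by a K -> cnorm (a g) <= K.
Proof.
by move=> aK; rewrite -l2norm1 bounded_by_l2norm// gsource_source.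
Qed.

End BoundedSections.

(** * Existence and bounds of convolutions *)

Section HasConvolution.
Variables (R : realType) (G : etaleGroupoid) (B : fellBundle R G).
Implicit Types (g h k x : G) (F D E : {fset G}) (a b c d f u v w ab bc : sections B).
Implicit Types (K L M e : R).
Local Notation incl := (fibre_incl B).

Definition has_conv a b g (l : fibre B g) := hassum (gsource g) (smul_term a b g) l.

(** Square summability along source fibres as a Cauchy criterion on tails. Applied to [sstar a] it
    is the condition on rows. *)
Definition column_summable a := forall x e, gsource x = x -> 0 < e ->
  exists D0, forall D, [disjoint D & D0]%fset -> l2norm x D a < e.

Lemma has_convDl a b c g (l m : fibre B g) :
  has_conv a c l -> has_conv b c m -> has_conv (a + b) c (l + m).
Proof.
by move=> H1 H2; apply: eq_hassum (hassumD H1 H2) => h hg; rewrite smul_termDl.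
Qed.

Lemma has_convDr a b c g (l m : fibre B g) :
  has_conv c a l -> has_conv c b m -> has_conv c (a + b) (l + m).
Proof.
by move=> H1 H2; apply: eq_hassum (hassumD H1 H2) => h hg; rewrite smul_termDr.
Qed.

Lemma has_convZl a c g (t : R[i]) (l : fibre B g) :
  has_conv a c l -> has_conv (t *: a) c (t *: l).
Proof. by move=> /(hassumZ t); apply: eq_hassum => h hg; rewrite smul_termZl. Qed.

Lemma has_convZr a c g (t : R[i]) (l : fibre B g) :
  has_conv c a l -> has_conv c (t *: a) (t *: l).
Proof. by move=> /(hassumZ t); apply: eq_hassum => h hg; rewrite smul_termZr. Qed.

Lemma smul_termE a b g h : gsource h = gsource g ->
  smul_term a b g h = fdot g (sstar a (gdiv h g)) (b h).
Proof.
move=> hg; apply: fmul_congr => //; rewrite incl_fstar// incl_sstar bstarK.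
by apply: incl_section; rewrite ginv_div.
Qed.

Lemma gprod_inv_div g h : gsource h = gsource g -> gprod (ginv (gdiv h g)) h g.
Proof. by move=> hg; rewrite ginv_div//; exact: gprod_div. Qed.

(** Cauchy-Schwarz, the row of [a] met at [g] being read as a column of [sstar a] over the arrows h
    g^-1 with h in [D]. *)
Lemma cnorm_sapp a b g D : cnorm (sapp a D b g) <=
  l2norm (grange g) (rtransl (ginv g) D) (sstar a) * l2norm (gsource g) D b.
Proof.
rewrite -(@ler_pXn2r _ 2%N) ?nnegrE ?mulr_ge0 ?l2norm_ge0 ?cnorm_ge0//.
rewrite exprMn !sqr_l2norm.
have -> : sapp a D b g =
    \sum_(h <- D | gsource h == gsource g) fdot g (sstar a (gdiv h g)) (b h).
  by apply: eq_bigr => h /eqP hg; exact: smul_termE.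
have -> : sform (grange g) (rtransl (ginv g) D) (sstar a) (sstar a) =
  \sum_(h <- D | gsource h == gsource g)
     fdot (grange g) (sstar a (gdiv h g)) (sstar a (gdiv h g)).
  have := sfsum_rtransl (ginv g) (fun k => fdot (grange g) (sstar a k) (sstar a k)) D.
  by rewrite gsource_inv grange_inv.
by apply: cauchy_schwarz => h /eqP hg; exact: gprod_inv_div.
Qed.

Lemma rtransl_disjoint g D D0 : [disjoint D & rtransl g D0]%fset ->
  [disjoint rtransl (ginv g) D & D0]%fset.
Proof.
move=> /fdisjointP H; apply/fdisjointP => k /rtranslP[h [hD hg ->]].
rewrite grange_inv in hg; apply/negP => kD0.
have := H h hD; rewrite -{1}(gdivK hg) mem_rtransl//.
by rewrite gsource_div.
Qed.

Lemma column_summable_conv a b K g : bounded_by a K -> column_summable b ->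
  exists l : fibre B g, has_conv a b l.
Proof.
move=> aK bc; have [K0 _] := aK; apply: hassum_cauchy => e e0.
have K1 : 0 < K + 1 by rewrite ltr_wpDl.
have [D0 HD] := bc _ _ (gsource_source g) (divr_gt0 e0 K1).
exists D0 => D /HD bD; rewrite (le_lt_trans (cnorm_sapp a b g D))//.
have aD := bounded_by_l2norm (rtransl (ginv g) D) (gsource_range g) (bounded_by_star aK).
apply: (@le_lt_trans _ _ (K * l2norm (gsource g) D b)).
  by rewrite ler_wpM2r ?l2norm_ge0.
move: bD; rewrite ltr_pdivlMr// => /(le_lt_trans _); apply.
by rewrite mulrC ler_wpM2l ?l2norm_ge0// lerDl ler01.
Qed.

Lemma row_summable_conv a b L g : column_summable (sstar a) -> bounded_by b L ->
  exists l : fibre B g, has_conv a b l.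
Proof.
move=> ac bL; have [L0 _] := bL; apply: hassum_cauchy => e e0.
have L1 : 0 < L + 1 by rewrite ltr_wpDl.
have [D0 HD] := ac _ _ (gsource_range g) (divr_gt0 e0 L1).
exists (rtransl g D0) => D /rtransl_disjoint/HD aD.
rewrite (le_lt_trans (cnorm_sapp a b g D))//.
have bD := bounded_by_l2norm D (gsource_source g) bL.
apply: (le_lt_trans (ler_wpM2l (l2norm_ge0 _ _ _) bD)).
move: aD; rewrite ltr_pdivlMr// => /(le_lt_trans _); apply.
by rewrite ler_wpM2l ?l2norm_ge0// lerDl ler01.
Qed.

Lemma l2norm_small x F v e : 0 <= e ->
  (forall g, g \in F -> gsource g = x -> cnorm (v g) <= e) ->
  l2norm x F v <= (size F)%:R * e.
Proof.
move=> e0 ve; rewrite -(@ler_pXn2r _ 2%N) ?nnegrE ?mulr_ge0 ?l2norm_ge0 ?ler0n//.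
rewrite sqr_l2norm (le_trans (cnorm_sum _ _ _))//.
apply: (@le_trans _ _ (\sum_(g <- F | gsource g == x) e ^+ 2)).
  rewrite big_seq_cond [leRHS]big_seq_cond; apply: ler_sum => g /andP[gF /eqP gx].
  rewrite -[X in cnorm (fdot X _ _)]gx.
  by rewrite cnorm_fdot_self ler_pXn2r ?nnegrE ?cnorm_ge0// ve.
apply: (@le_trans _ _ (\sum_(g <- F) e ^+ 2)).
  rewrite [leRHS](bigID (fun g => gsource g == x))/= lerDl.
  by apply: sumr_ge0 => *; rewrite sqr_ge0.
have -> : \sum_(g <- F) e ^+ 2 = (size F)%:R * e ^+ 2.
  by rewrite big_const_seq count_predT iter_addr_0 mulr_natl.
rewrite exprMn; apply: ler_wpM2r; first exact: sqr_ge0.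
rewrite -natrX ler_nat; case: (size F) => // n.
by rewrite expnS expn1 leq_pmulr.
Qed.

(** Truncating [c] to a large finite set gives the bound K M, and on the finite set [F] the
    truncated products approximate [d] pointwise, hence in [l2norm] by [l2norm_small]. *)
Lemma l2norm_conv a c d x K M F : gsource x = x -> bounded_by a K ->
  (forall g, gsource g = x -> has_conv a c (d g)) ->
  (forall E, l2norm x E c <= M) -> l2norm x F d <= K * M.
Proof.
move=> xu [K0 aK] acd cM; apply/ler_addgt0Pr => e e0.
have n1 : 0 < (size F)%:R + 1 :> R by rewrite ltr_wpDl.
have e1 : 0 < e / ((size F)%:R + 1) by rewrite divr_gt0.
have : \forall D \near summability.totally, forall g, g \in enum_fset F ->
    gsource g = x -> cnorm (sapp a D c g - d g) < e / ((size F)%:R + 1).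
  apply: near_all_seq => g _; have [gx|gx] := pselect (gsource g = x); last first.
    by apply: nearW.
  by apply: filterS (acd g gx _ e1).
move=> /filter_ex[D HD].
have -> : d = sapp a D c - (sapp a D c - d) by zmod.
rewrite (le_trans (l2normB _ _ _ xu))//; apply: lerD.
  by rewrite (le_trans (aK _ _ _ _ xu))// ler_wpM2l.
rewrite (le_trans (l2norm_small (ltW e1) _))//.
  by move=> g gF gx; apply/ltW/HD.
rewrite mulrCA; apply: ler_piMr; first exact: ltW.
by rewrite ler_pdivrMr// mul1r lerDl.
Qed.

(** Associativity with third factor cut down to [D]: a finite sum is exchanged with the limits
    defining [ab]. For each h in [D], translation by [ginv h] moves the sum at g h^-1 to the source
    fibre of [g]. *)
Lemma has_conv_sapp a b ab D f g : (forall k, has_conv a b (ab k)) ->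
  has_conv a (sapp b D f) (sapp ab D f g).
Proof.
move=> abE.
have H h : gsource h == gsource g ->
    hassum (gsource g) (fun k => smul_term a (fun j => smul_term b f j h) g k)
      (smul_term ab f g h).
  move=> /eqP hg; have gh := esym hg; have ghg := gprod_div gh.
  have := abE (gdiv g h); rewrite /has_conv gsource_div// -gsource_inv.
  move=> /hassum_rtransl; rewrite grange_inv hg.
  move=> /(hassum_map (T := fun p : fibre B (gdiv g h) => fmul g p (f h)) (K := cnorm (f h))).
  have TK (p : fibre B (gdiv g h)) : cnorm (fmul g p (f h)) <= cnorm (f h) * cnorm p.
    by rewrite mulrC; exact: cnorm_fmul.
  move=> /(_ (fun p q => fmulDl p q (f h) ghg)).
  move=> /(_ TK).
  apply: eq_hassum => k kg; have gk := esym kg; have kh : gsource k = gsource h by rewrite kg.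
  rewrite /smul_term -/(gdiv k h) -(@fmulA _ _ _ (gdiv g k) (gdiv k h) h (gdiv g h)) //.
  - congr fmul; apply: fmul_congr => //; apply: incl_section.
    by rewrite /gdiv -/(gdiv g h) -/(gdiv k h) ginv_div// gmul_div.
  - by split; rewrite ?gmul_div// gsource_div// grange_div.
  - exact: gprod_div.
have := hassum_sum (enum_fset D) H; rewrite -/(sfsum _ _ D) -/(sapp ab D f g).
apply: eq_hassum => k kg; rewrite [RHS]/smul_term /sapp /sfsum.
rewrite fmul_sumr; last exact: gprod_div.
by apply: eq_bigl => h; rewrite kg.
Qed.

Lemma bounded_by_conv a b ab K L : bounded_by a K -> bounded_by b L ->
  (forall k, has_conv a b (ab k)) -> bounded_by ab (K * L).
Proof.
move=> aK bL abE; have [K0 _] := aK; have [L0 bL'] := bL.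
split; first exact: mulr_ge0.
move=> x F D f xu; rewrite -mulrA.
apply: (@l2norm_conv a (sapp b D f)) => // [g _|E]; last exact: bL'.
exact: has_conv_sapp.
Qed.

(** Cutting [c] down to [D0] changes the product by [b] times the tail of [c], to which
    [l2norm_conv] applies. *)
Lemma l2norm_tail b c d D0 x L e E : gsource x = x -> bounded_by b L ->
  (forall g, gsource g = x -> has_conv b c (d g)) ->
  (forall D, [disjoint D & D0]%fset -> l2norm x D c <= e) ->
  l2norm x E (d - sapp b D0 c) <= L * e.
Proof.
move=> xu bL bcd cD.
have cE D : c - srestr D0 c = (fun g => if g \in D0 then 0 else c g) :> sections B.
  apply: functional_extensionality_dep => g; rewrite sectionsD sectionsN /srestr.
  by case: ifP => _; rewrite ?subrr ?subr0.
apply: (@l2norm_conv b (c - srestr D0 c)) => // [g gx|D]; last first.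
  rewrite (@eq_l2norm _ _ _ _ _ _ (srestr (D `\` D0)%fset c)).
    rewrite l2norm_restr ?fsubsetDl//; apply: cD.
    by apply/fdisjointP => h; rewrite inE => /andP[].
  move=> g gD _; rewrite (cE D) /srestr inE gD andbT.
  by case: (g \in D0).
move=> e' e0; have : \forall D \near summability.totally, (D0 `<=` D)%fset by exists D0.
apply: filterS2 (bcd g gx e' e0) => D bD D0D.
have -> : sfsum (gsource g) (smul_term b (c - srestr D0 c) g) D =
    sapp b D c g - sapp b D0 c g.
  rewrite -[LHS]/(sapp b D (c - srestr D0 c) g) sappDr sectionsD.
  congr (_ + _); rewrite -scaleN1r.
  have -> : sapp b D (-1 *: srestr D0 c) g = - sapp b D (srestr D0 c) g.
    rewrite /sapp /sfsum -sumrN; apply: eq_bigr => h /eqP hg.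
    by rewrite smul_termZr// scaleN1r.
  congr (- _).
  have DE : (D0 `|` (D `\` D0))%fset = D.
    rewrite -[RHS](fsetID D0 D); congr (_ `|` _)%fset.
    by apply/esym/fsetIidPr.
  rewrite /sapp -DE sfsum_disjU; last first.
    by apply/fdisjointP => z zD; rewrite inE zD.
  rewrite [X in _ + X]big_seq_cond [X in _ + X]big1 ?addr0.
    rewrite /sfsum big_seq_cond [RHS]big_seq_cond; apply: eq_bigr => h /andP[hD _].
    by rewrite /smul_term /srestr hD.
  move=> h /andP[]; rewrite inE => /andP[hD _] /eqP hg.
  rewrite /smul_term /srestr (negbTE hD) fmul0r//; exact: gprod_div.
by rewrite sectionsD sectionsN opprB addrA subrK; move: bD.
Qed.

End HasConvolution.

(** * Stability of square summability, associativity and involution *)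

Section ConvolutionAlgebra.
Variables (R : realType) (G : etaleGroupoid) (B : fellBundle R G).
Implicit Types (g h k x : G) (F D E : {fset G}) (a b c d f u v w ab bc : sections B).
Implicit Types (K L M e : R).
Local Notation incl := (fibre_incl B).

(** Multiplying by the single value b(h) turns the square sum p of the translated column of [a] into
    b(h)* p b(h). *)
Lemma l2norm_column a b h F :
  l2norm (gsource h) F (sapp a [fset h]%fset b) <=
  cnorm (b h) * l2norm (grange h) (rtransl (ginv h) F) a.
Proof.
rewrite -(@ler_pXn2r _ 2%N) ?nnegrE ?mulr_ge0 ?l2norm_ge0 ?cnorm_ge0//.
rewrite exprMn !sqr_l2norm; set p := sform (grange h) _ a a.
have hh := gprod_invl h; have rh := gprod_range_l h.
have -> : sform (gsource h) F (sapp a [fset h]%fset b) (sapp a [fset h]%fset b) =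
    fdot (gsource h) (b h) (fmul h p (b h)).
  rewrite fmul_suml// fdot_sumr//.
  have := sfsum_rtransl (ginv h) (fun k => fdot (gsource h) (b h)
    (fmul h (fdot (grange h) (a k) (a k)) (b h))) F.
  rewrite gsource_inv grange_inv /sfsum => ->; apply: eq_bigr => g /eqP gh.
  have hg := esym gh; rewrite sapp1// /smul_term -/(gdiv g h).
  have ghg := gprod_div gh.
  have gg : gprod (ginv g) g (gsource h) by rewrite -gh; exact: gprod_invl.
  have dd : gprod (ginv (gdiv g h)) (gdiv g h) (grange h).
    by rewrite -(gsource_div gh); exact: gprod_invl.
  have dh : gprod (ginv (gdiv g h)) g h by rewrite ginv_div//; exact: gprod_div.
  by rewrite (fdot_mull _ _ _ ghg gg dh) (fdot_mulr _ _ _ ghg dh dd).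
rewrite (le_trans (cnorm_fdot _ _ hh))// expr2 -mulrA ler_wpM2l ?cnorm_ge0//.
by rewrite mulrC; exact: cnorm_fmul.
Qed.

Lemma sapp_column0 a b h g : gsource h != gsource g -> sapp a [fset h]%fset b g = 0.
Proof. by move=> hg; rewrite /sapp /sfsum big_mkcond big_seq_fset1 (negbTE hg). Qed.

Lemma column_summable0 : column_summable (0 : sections B).
Proof. by move=> x e xu e0; exists fset0 => D _; rewrite l2norm0. Qed.

Lemma column_summableD a b : column_summable a -> column_summable b ->
  column_summable (a + b).
Proof.
move=> ac bc x e xu e0; have e2 : 0 < e / 2 by rewrite divr_gt0.
have [D1 H1] := ac x _ xu e2; have [D2 H2] := bc x _ xu e2.
exists (D1 `|` D2)%fset => D /fdisjointP HD.
rewrite (le_lt_trans (l2normD _ _ _ xu))// [ltRHS]splitr ltrD//.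
  apply: H1; apply/fdisjointP => h /HD; rewrite inE negb_or => /andP[]//.
by apply: H2; apply/fdisjointP => h /HD; rewrite inE negb_or => /andP[].
Qed.

Lemma column_summableZ (t : R[i]) a : column_summable a -> column_summable (t *: a).
Proof.
move=> ac x e xu e0; have t1 : 0 < cmod t + 1 by rewrite ltr_wpDl ?cmod_ge0.
have [D0 H0] := ac x _ xu (divr_gt0 e0 t1); exists D0 => D /H0.
rewrite l2normZ ltr_pdivlMr// => /(le_lt_trans _); apply.
by rewrite mulrC ler_wpM2l ?l2norm_ge0// lerDl ler01.
Qed.

Lemma column_summable_column a b h : column_summable a ->
  column_summable (sapp a [fset h]%fset b).
Proof.
move=> ac x e xu e0; have [hx|hx] := eqVneq (gsource h) x; last first.
  exists fset0 => D _; rewrite (@eq_l2norm _ _ _ _ _ _ 0) ?l2norm0//.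
  by move=> g _ gx; rewrite sapp_column0// gx.
have b1 : 0 < cnorm (b h) + 1 by rewrite ltr_wpDl ?cnorm_ge0.
have [D0 H0] := ac _ _ (gsource_range h) (divr_gt0 e0 b1).
exists (rtransl h D0) => D /rtransl_disjoint/H0; rewrite ltr_pdivlMr// => aD.
rewrite -hx (le_lt_trans (l2norm_column a b h D))//.
by rewrite (le_lt_trans _ aD)// mulrC ler_wpM2l ?l2norm_ge0// lerDl ler01.
Qed.

Lemma column_summable_sapp a b D : column_summable a -> column_summable (sapp a D b).
Proof.
move=> ac.
have -> : sapp a D b = \sum_(h <- D) sapp a [fset h]%fset b.
  apply: functional_extensionality_dep => g.
  have -> : (\sum_(h <- D) sapp a [fset h]%fset b) g =
      \sum_(h <- D) sapp a [fset h]%fset b g.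
    by elim/big_rec2 : _ => // h p q _ <-.
  rewrite {1}/sapp /sfsum big_mkcond/=; apply: eq_bigr => h _.
  case: eqP => hg; first by rewrite sapp1.
  by rewrite sapp_column0//; exact/eqP.
apply: big_ind => [|b1 b2|h _]; first exact: column_summable0.
- exact: column_summableD.
- exact: column_summable_column.
Qed.

(** Up to e / 2, [b] may be replaced by its restriction to a finite set, after which the product is
    a finite sum of translated columns of [a]. The denominator K + 1 allows for K = 0. *)
Lemma column_summable_has_conv a b ab K : bounded_by a K -> column_summable a ->
  column_summable b -> (forall k, has_conv a b (ab k)) -> column_summable ab.
Proof.
move=> aK ac bc abE x e xu e0; have [K0 _] := aK.
have K1 : 0 < K + 1 by rewrite ltr_wpDl.
have e2 : 0 < e / 2 by rewrite divr_gt0.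
have [D0 H0] := bc x _ xu (divr_gt0 e2 K1).
have [D1 H1] := column_summable_sapp b D0 ac xu e2.
exists D1 => D DD1; have -> : ab = (ab - sapp a D0 b) + sapp a D0 b by zmod.
rewrite (le_lt_trans (l2normD _ _ _ xu))// [ltRHS]splitr ler_ltD ?H1//.
rewrite (le_trans (@l2norm_tail _ _ _ a b ab D0 x K (e / 2 / (K + 1)) D xu aK _ _))//.
  by move=> E /H0/ltW.
rewrite mulrCA; apply: ler_piMr; first exact: ltW.
by rewrite ler_pdivrMr// mul1r lerDl ler01.
Qed.

(** Both products are compared at [g] with (ab) applied to [c] cut down to [D0], which by
    [has_conv_sapp] is also [a] applied to [b] of that truncation. Each differs from it by at most K
    L e'. *)
Lemma has_conv_assoc a b c ab bc u v K L :
  bounded_by a K -> bounded_by b L -> column_summable c ->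
  (forall k, has_conv a b (ab k)) -> (forall k, has_conv b c (bc k)) ->
  (forall k, has_conv ab c (u k)) -> (forall k, has_conv a bc (v k)) -> u = v.
Proof.
move=> aK bL cc abE bcE uE vE; apply: functional_extensionality_dep => g.
have abKL := bounded_by_conv aK bL abE; have [K0 _] := aK; have [L0 _] := bL.
set x := gsource g; have xu : gsource x = x by exact: gsource_source.
apply/eqP; rewrite -subr_eq0; apply/eqP/cnorm_le0.
apply/ler_addgt0Pr => e e0; rewrite add0r.
have M1 : 0 < 2 * (K * L) + 1 by rewrite ltr_wpDl// !mulr_ge0.
have [D0 H0] := cc x _ xu (divr_gt0 e0 M1).
set e' := e / _ in H0; have H0' D : [disjoint D & D0]%fset -> l2norm x D c <= e'.
  by move=> /H0/ltW.
have t1 : cnorm (u g - sapp ab D0 c g) <= K * L * e'.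
  have := l2norm_tail [fset g]%fset xu abKL (fun k _ => uE k) H0'.
  by rewrite l2norm1.
have t2 : cnorm (v g - sapp ab D0 c g) <= K * (L * e').
  have := @l2norm_conv _ _ _ a (bc - sapp b D0 c) (v - sapp ab D0 c) x K (L * e')
    [fset g]%fset xu aK.
  rewrite l2norm1; apply => [k _|E].
    have := has_convDr (vE k) (has_convZr (-1) (has_conv_sapp D0 c k abE)).
    by rewrite !scaleN1r.
  by apply: (l2norm_tail E xu bL _ H0').
rewrite -(subrKA (sapp ab D0 c g)) (le_trans (cnormD _ _))//.
apply: (@le_trans _ _ (K * L * e' + K * (L * e'))).
  by rewrite lerD// cnormBC.
rewrite (_ : _ + _ = (2 * (K * L)) * e'); last by ring.
rewrite /e' mulrCA; apply: ler_piMr; first exact: ltW.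
by rewrite ler_pdivrMr// mul1r lerDl ler01.
Qed.

(** The involution takes the factorization (g h^-1, h) of g to (h^-1, h g^-1) of g^-1, so the
    summation index changes from h to h g^-1. *)
Lemma has_conv_star a b g (l : fibre B g) : has_conv a b l ->
  has_conv (sstar b) (sstar a) (fstar (ginv g) l).
Proof.
move=> /hassum_rtransl; rewrite -gsource_inv.
move=> /(hassum_map (T := fun p : fibre B g => fstar (ginv g) p) (K := 1)).
move=> /(_ (fun p q => fstarD p q erefl)).
have TK (p : fibre B g) : cnorm (fstar (ginv g) p) <= 1 * cnorm p.
  by rewrite mul1r cnorm_fstar.
move=> /(_ TK); apply: eq_hassum => k; rewrite gsource_inv => kg.
have gk : gprod k g (gmul k g) by [].
have e1 : gdiv g (gmul k g) = ginv k.
  rewrite /gdiv ginv_mul// -gmulA ?grange_inv ?gsource_inv//.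
  by rewrite -/(grange g) -kg -grange_inv gmul_range.
have e2 : gdiv (ginv g) k = ginv (gmul k g) by rewrite ginv_mul.
rewrite /smul_term fstarM; last first.
  by apply: gprod_div; rewrite gsource_mul.
apply: fmul_congr; rewrite incl_sstar incl_fstar//; congr bstar; apply: incl_section.
  by rewrite e2 ginvK.
by rewrite e1.
Qed.

End ConvolutionAlgebra.

(** * Convolution and the norms *)

Section Convolution.
Variables (R : realType) (G : etaleGroupoid) (B : fellBundle R G).
Implicit Types (g h k x : G) (F D E : {fset G}) (a b c d f u v w : sections B).
Implicit Types (K L M e : R).
Local Notation incl := (fibre_incl B).

(** The factorizations of [g] with second factor in [D]; [insub] drops the elements of [D] whose
    source is not that of [g]. These sets are cofinal, which links the two nets of partial sums. *)
Definition fact_fset g D : {fset factorizations g} :=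
  [fset p in (pmap insub [seq (gdiv g h, h) | h <- D] : seq (factorizations g))]%fset.

Lemma factorizationsP g (p : factorizations g) :
  gsource (val p).2 = gsource g /\ (val p).1 = gdiv g (val p).2.
Proof.
have := valP p; rewrite inE; case: (val p) => p1 p2 [/= s1 s2].
by rewrite -s2 gsource_mul// gmulK.
Qed.

Lemma factorizations_div g h : gsource h = gsource g ->
  (gdiv g h, h) \in factorizations g.
Proof.
move=> hg; rewrite inE; split => /=; first by rewrite composableE gsource_div.
by rewrite gdivK.
Qed.

Lemma mem_fact_fset g D (p : factorizations g) :
  (p \in fact_fset g D) = ((val p).2 \in D).
Proof.
rewrite inE/= mem_pmap_sub; apply/mapP/idP => [[h hD -> //]|pD].
exists (val p).2 => //; have [_] := factorizationsP p.
by case: (val p) => /= p1 p2 ->.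
Qed.

Lemma partial_sum_fact_fset a b g D :
  summability.partial_sum (@convolution_term R G B a b g) (fact_fset g D) =
  sapp a D b g.
Proof.
rewrite /summability.partial_sum -(big_seq_fsetE _ _ xpredT)/=.
have -> : \sum_(p <- fact_fset g D) @convolution_term R G B a b g p =
    \sum_(p <- (pmap insub [seq (gdiv g h, h) | h <- D] : seq (factorizations g)))
      @convolution_term R G B a b g p.
  apply: perm_big; apply: uniq_perm; first exact: fset_uniq.
    by rewrite pmap_sub_uniq// map_inj_uniq ?fset_uniq// => h k [].
  by move=> p; rewrite inE.
rewrite big_pmap big_map /sapp /sfsum [RHS]big_mkcond; apply: eq_bigr => h _.
case: insubP => [p _ pE|]; last first.
  by case: eqP => // hg; rewrite factorizations_div.
have [hg _] := factorizationsP p; rewrite pE/= in hg.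
by rewrite hg eqxx/= /convolution_term pE.
Qed.

Lemma convolution_cvgP a b g (l : fibre B g) :
  summability.partial_sum (@convolution_term R G B a b g) @ summability.totally --> l
  <-> has_conv a b l.
Proof.
split=> [/cvgrPdist_lt H|/hassumP H].
  apply/hassumP => e e0; have e0' : 0 < e%:C by rewrite ltcR.
  have [A _ HA] := H _ e0'; exists [fset (val p).2 | p in A]%fset => D AD.
  rewrite -[sfsum _ _ D]/(sapp a D b g) -partial_sum_fact_fset.
  rewrite cnormBC -ltcR cnormE; apply: HA; apply/fsubsetP => p pA.
  rewrite mem_fact_fset; move/fsubsetP : AD; apply.
  by apply/imfsetP; exists p.
apply/cvgrPdist_lt => e e0.
have eE : e = (complex.Re e)%:C by rewrite RRe_real// gtr0_real.
have /H[D0 HD] : 0 < complex.Re e by rewrite -ltcR -eE.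
exists (fact_fset g D0) => // A D0A.
have -> : A = fact_fset g ([fset (val p).2 | p in A] `|` D0)%fset.
  apply/fsetP => p; rewrite mem_fact_fset inE; apply/idP/orP => [pA|[]].
  - by left; apply/imfsetP; exists p.
  - move=> /imfsetP[q qA pq]; suff -> : p = q by [].
    apply: val_inj; have [_] := factorizationsP p; have [_] := factorizationsP q.
    by move: pq; case: (val p) => p1 p2; case: (val q) => q1 q2 /= -> -> ->.
  - by rewrite -mem_fact_fset => pD; move/fsubsetP : D0A; apply.
rewrite partial_sum_fact_fset eE -cnormE ltcR cnormBC; apply: HD.
exact: fsubsetUr.
Qed.

Lemma convolution_definedP a b : convolution_defined a b <->
  forall g, exists l : fibre B g, has_conv a b l.
Proof.
split=> H g.
  by have /cvg_ex[l /convolution_cvgP ?] := H g; exists l.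
by apply/cvg_ex; have [l /convolution_cvgP ?] := H g; exists l.
Qed.

Lemma convolutionE a b g (l : fibre B g) : has_conv a b l ->
  convolution a b g = l.
Proof. by move=> /convolution_cvgP H; exact: cvg_lim H. Qed.

Lemma fin_supported_fset f : fin_supported f -> exists D,
  forall g, f g != 0 -> g \in D.
Proof.
move=> /finite_fsetP[D DE]; exists D => g gf.
by have : ssupp f g by []; rewrite DE.
Qed.

Lemma has_conv_fin_supported a f D g : (forall h, f h != 0 -> h \in D) ->
  has_conv a f (sapp a D f g).
Proof.
move=> fD; apply/hassumP => e e0; exists D => E DE.
suff -> : sfsum (gsource g) (smul_term a f g) E = sapp a D f g.
  by rewrite subrr cnorm0.
have ED : (E `&` D)%fset = D by exact/fsetIidPr.
rewrite -[in LHS](fsetID D E) ED /sapp sfsum_disjU; last first.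
  by apply/fdisjointP => z zD; rewrite inE zD.
rewrite [X in _ + X]big_seq_cond [X in _ + X]big1 ?addr0// => h /andP[].
rewrite inE => /andP[hD _] /eqP hg.
have /eqP f0 : f h == 0 by apply: contraNT hD; exact: fD.
by rewrite /smul_term f0 fmul0r//; exact: gprod_div.
Qed.

Lemma norm2_ge a x F : gsource x = x -> ((l2norm x F a)%:E <= norm2 a)%E.
Proof.
move=> xu; rewrite /norm2 le_max; apply/orP; right.
apply: le_trans (ereal_sup_ubound _); last by exists x.
apply: ereal_sup_ubound; exists [fset g in F | gsource g == x]%fset.
  by move=> g; rewrite !inE => /andP[_ /eqP].
congr (Num.sqrt (cnorm _))%:E; rewrite /sform -[RHS]big_filter.
have -> : \sum_(g <- [fset g in F | gsource g == x]%fset)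
    at_fibre x (bmul (bstar (incl (a g))) (incl (a g))) =
    \sum_(g <- [seq g <- F | gsource g == x])
    at_fibre x (bmul (bstar (incl (a g))) (incl (a g))).
  apply: perm_big; apply: uniq_perm; rewrite ?filter_uniq ?fset_uniq// => g.
  by rewrite mem_filter !inE andbC.
by apply: eq_bigr => g _; rewrite /fdot /fmul incl_fstar.
Qed.

Lemma norm2_le a M : 0 <= M ->
  (forall x F, gsource x = x -> l2norm x F a <= M) -> (norm2 a <= M%:E)%E.
Proof.
move=> M0 aM; rewrite /norm2 ge_max lee_fin M0/=.
apply: ge_ereal_sup => _ [x xu <-]; apply: ge_ereal_sup => _ [F Fx <-].
rewrite lee_fin; apply: le_trans (aM x F xu); rewrite le_eqVlt; apply/orP; left.
apply/eqP; congr (Num.sqrt (cnorm _)); rewrite /sform.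
rewrite big_seq_cond [RHS]big_seq_cond.
apply: eq_big => [g|g /andP[gF _]].
  by case: (boolP (g \in F)) => //= /Fx ->; rewrite eqxx.
by rewrite /fdot /fmul incl_fstar.
Qed.

Lemma norm2_fin_supported f : fin_supported f ->
  exists2 M, 0 <= M & norm2 f = M%:E.
Proof.
move=> /fin_supported_fset[D fD]; pose C := \sum_(g <- D) cnorm (f g).
have C0 : 0 <= C by apply: sumr_ge0 => g _; exact: cnorm_ge0.
have M0 : 0 <= (size D)%:R * C by rewrite mulr_ge0.
have le : (norm2 f <= ((size D)%:R * C)%:E)%E.
  apply: norm2_le => // x F xu.
  apply: (le_trans (l2norm_mono f xu (fsubsetUl F D))).
  rewrite (@eq_l2norm _ _ _ _ _ _ (srestr D f)); last first.
    move=> g _ _; rewrite /srestr; case: ifPn => // gD.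
    by apply/eqP; apply: contraNT gD; exact: fD.
  rewrite l2norm_restr ?fsubsetUr//; apply: l2norm_small => // g gD _.
  by rewrite /C (big_fsetD1 g)//= lerDl; apply: sumr_ge0 => h _; exact: cnorm_ge0.
have ge : (0 <= norm2 f)%E by rewrite /norm2 le_max lexx.
exists (fine (norm2 f)); first exact: fine_ge0.
rewrite fineK// ge0_fin_numE//; apply: le_lt_trans le _; exact: ltry.
Qed.

Lemma normb_ge0 a : (0 <= normb a)%E.
Proof.
apply: le_trans (ereal_sup_ubound _); last first.
  exists 0 => //; rewrite /fin_supported/= (_ : ssupp _ = set0); first exact: finite_set0.
  by apply/seteqP; split => // g /=; rewrite /ssupp/= sections0 eqxx.
rewrite mule_ge0// ?inve_ge0; rewrite /norm2 le_max lexx//.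
Qed.

Lemma normb_le a K : bounded_by a K -> (normb a <= K%:E)%E.
Proof.
move=> [K0 aK]; apply: ge_ereal_sup => _ [f ff <-].
have [M M0 fM] := norm2_fin_supported ff.
have [D fD] := fin_supported_fset ff.
have afE : convolution a f = sapp a D f.
  apply: functional_extensionality_dep => g; apply: convolutionE.
  exact: has_conv_fin_supported.
have le : (norm2 (convolution a f) <= (K * M)%:E)%E.
  apply: norm2_le => [|x F xu]; first exact: mulr_ge0.
  rewrite afE (le_trans (aK _ _ _ _ xu))// ler_wpM2l//.
  by rewrite -lee_fin -fM norm2_ge.
(* The case 0 / 0: the numerator vanishes together with the denominator. *)
rewrite fM; have [M00|Mn0] := eqVneq M 0.
  rewrite M00 mulr0 in le.
  have -> : norm2 (convolution a f) = 0%E.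
    by apply/le_anti; rewrite le/= /norm2 le_max lexx.
  by rewrite mul0e lee_fin.
have Mp : 0 < M by rewrite lt_neqAle eq_sym Mn0.
rewrite inver (negbTE Mn0) lee_pdivrMr//.
Qed.

(** The supremum [normb], when finite, is itself an admissible constant; with [normb_le] this makes
    it the least one. *)
Lemma normb_bounded_by a : (normb a < +oo)%E -> bounded_by a (fine (normb a)).
Proof.
move=> afin; have anum : normb a \is a fin_num by rewrite ge0_fin_numE ?normb_ge0.
(* The section is cut down to source x as well as to [D], because [norm2] is a supremum over all
   units whereas the bound concerns x alone. *)
split; first exact/fine_ge0/normb_ge0.
move=> x F D f xu; set D' := [fset h in D | gsource h == x]%fset.
have D'P h : (h \in D') = (h \in D) && (gsource h == x) by rewrite !inE.
pose f' := srestr D' f.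
have f'D h : f' h != 0 -> h \in D' by rewrite /f' /srestr; case: ifP => //; rewrite eqxx.
have ff : fin_supported f'.
  apply: (@sub_finite_set _ _ [set` D']); last exact: finite_fset.
  by move=> h /f'D.
have afE : convolution a f' = sapp a D' f'.
  apply: functional_extensionality_dep => g; apply: convolutionE.
  exact: has_conv_fin_supported.
have appE : l2norm x F (sapp a D f) = l2norm x F (convolution a f').
  apply: eq_l2norm => g gF gx; rewrite afE /sapp /sfsum gx -[RHS]big_filter.
  rewrite [RHS](perm_big [seq h <- D | gsource h == x]); last first.
    apply: uniq_perm; rewrite ?filter_uniq ?fset_uniq// => h.
    by rewrite !mem_filter D'P; case: (gsource h == x); rewrite ?andbT ?andbF.
  rewrite -[LHS]big_filter [LHS]big_seq [RHS]big_seq; apply: eq_bigr => h.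
  rewrite mem_filter => /andP[hx hD].
  by rewrite /smul_term /f' /srestr D'P hD hx.
have f'le : (norm2 f' <= (l2norm x D f)%:E)%E.
  apply: norm2_le => [|y E yu]; first exact: l2norm_ge0.
  have [->|yx] := eqVneq y x.
    apply: (le_trans (l2norm_mono f' xu (fsubsetUl E D'))).
    rewrite l2norm_restr ?fsubsetUr// l2norm_mono//.
    by apply/fsubsetP => h; rewrite D'P => /andP[].
  rewrite (@eq_l2norm _ _ _ _ _ _ 0) ?l2norm0 ?l2norm_ge0// => g _ gy.
  by rewrite /f' /srestr D'P gy (negbTE yx) andbF.
have [M M0 fM] := norm2_fin_supported ff.
rewrite appE; have [M00|Mn0] := eqVneq M 0.
  suff -> : convolution a f' = 0.
    by rewrite l2norm0 mulr_ge0 ?l2norm_ge0// fine_ge0// normb_ge0.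
  apply: functional_extensionality_dep => g; rewrite afE /sapp /sfsum big1// => h /eqP hg.
  have f'0 : f' h = 0.
    apply: cnorm_le0; rewrite -l2norm1 -M00 -lee_fin -fM norm2_ge//.
    exact: gsource_source.
  by rewrite /smul_term f'0 fmul0r//; exact: gprod_div.
have Mp : 0 < M by rewrite lt_neqAle eq_sym Mn0.
have : (norm2 (convolution a f') / norm2 f' <= normb a)%E.
  by apply: ereal_sup_ubound; exists f'.
rewrite -(fineK anum) fM inver (negbTE Mn0) lee_pdivrMr// -EFinM => le.
have := le_trans (norm2_ge (convolution a f') F xu) le.
rewrite lee_fin => /le_trans; apply.
apply: ler_wpM2l; first exact/fine_ge0/normb_ge0.
by rewrite -lee_fin -fM.
Qed.

Lemma bounded_sectionsP a : bounded_sections a <-> exists K, bounded_by a K.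
Proof.
split=> [/normb_bounded_by|[K aK]]; first by exists (fine (normb a)).
exact: le_lt_trans (normb_le aK) (ltry _).
Qed.

Lemma normbE a : bounded_sections a -> normb a = (fine (normb a))%:E.
Proof. by move=> afin; rewrite fineK// ge0_fin_numE// normb_ge0. Qed.

Lemma convolution_col a b g : bounded_sections a -> column_summable b ->
  has_conv a b (convolution a b g).
Proof.
move=> /normb_bounded_by aK bc; have [l lE] := column_summable_conv g aK bc.
by rewrite (convolutionE lE).
Qed.

Lemma convolution_row a b g : column_summable (sstar a) -> bounded_sections b ->
  has_conv a b (convolution a b g).
Proof.
move=> ac /normb_bounded_by bL; have [l lE] := row_summable_conv g ac bL.
by rewrite (convolutionE lE).
Qed.

(** At a unit x the partial sums of a*a are the square sums of the column of [a] at x. The square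
    sum over a set disjoint from D0 is a difference of two partial sums, each within e^2 / 2 of the
    limit. *)
Lemma column_summable_of_defined a : convolution_defined (sstar a) a ->
  column_summable a.
Proof.
move=> /convolution_definedP H x e xu e0.
have [l] := H x; rewrite /has_conv xu => lE.
have e20 : 0 < e ^+ 2 / 2 by rewrite divr_gt0// exprn_gt0.
have /hassumP/(_ _ e20)[D0 HD] := lE; exists D0 => D DD0.
have sE E : sfsum x (smul_term (sstar a) a x) E = sform x E a a.
  apply: eq_bigr => h /eqP hx; rewrite smul_termE ?xu// sstarK.
  apply: fmul_congr => //; rewrite !incl_fstar//; congr bstar.
  by apply: incl_section; rewrite /gdiv gunit_inv// -hx gmul_source.
rewrite -(@ltr_pXn2r _ 2%N) ?nnegrE ?l2norm_ge0 ?(ltW e0)// sqr_l2norm -!sE.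
have -> : sfsum x (smul_term (sstar a) a x) D =
    sfsum x (smul_term (sstar a) a x) (D `|` D0)%fset -
    sfsum x (smul_term (sstar a) a x) D0 by rewrite sfsum_disjU// addrK.
rewrite -(subrKA l) (le_lt_trans (cnormD _ _))// [ltRHS]splitr ltrD//.
  by apply: HD; exact: fsubsetUr.
by rewrite cnormBC; exact: HD.
Qed.

Lemma big_algebraP a : big_algebra a <->
  [/\ bounded_sections a, column_summable a & column_summable (sstar a)].
Proof.
split=> [[ab a1 a2]|[ab a1 a2]]; split => //.
- exact: column_summable_of_defined.
- by apply: column_summable_of_defined; rewrite sstarK.
- apply/convolution_definedP => g.
  apply: (@column_summable_conv _ _ _ _ _ (fine (normb a))) => //.
  exact/bounded_by_star/normb_bounded_by.
- apply/convolution_definedP => g.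
  apply: (@column_summable_conv _ _ _ _ _ (fine (normb a))) => //.
  exact/normb_bounded_by.
Qed.

End Convolution.

(** * Completeness *)

Section BanachSubspace.
Variables (R : realType) (V : lmodType R[i]) (S : set V) (n : V -> R).
Hypothesis S_sub : is_subspace S.
Hypothesis n_add : forall u v, S u -> S v -> n (u + v) <= n u + n v.
Hypothesis n_scale : forall l u, S u -> n (l *: u) = cmod l * n u.
Hypothesis n_eq0 : forall u, S u -> n u = 0 -> u = 0.
(** Completeness is phrased with filters on the ambient space that contain [S], so that it can be
    checked without mentioning the subtype. *)
Hypothesis n_complete : forall X : set_system V, ProperFilter X -> X S ->
  (forall e : R, 0 < e -> exists2 v, S v & \forall u \near X, n (u - v) < e) ->
  exists2 l, S l & forall e : R, 0 < e -> \forall u \near X, n (u - l) < e.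

Record subspace_type := SubspaceType { ssval :> V ; ssvalP : S ssval }.

Let ssval_inj : injective ssval.
Proof.
move=> [u uS] [v vS] /= uv; subst v; congr SubspaceType; exact: Prop_irrelevance.
Qed.

HB.instance Definition _ := gen_eqMixin subspace_type.
HB.instance Definition _ := gen_choiceMixin subspace_type.

Let S0 : S 0. Proof. by case: S_sub. Qed.
Let SZ l u : S u -> S (l *: u).
Proof. by case: S_sub => _ H uS; rewrite -[_ *: _]addr0; exact: H. Qed.
Let SD u v : S u -> S v -> S (u + v).
Proof. by case: S_sub => _ H uS vS; rewrite -[u]scale1r; exact: H. Qed.

Let w0 := SubspaceType S0.
Let wadd (u v : subspace_type) := SubspaceType (SD (ssvalP u) (ssvalP v)).
Let wscale (l : R[i]) (u : subspace_type) := SubspaceType (SZ l (ssvalP u)).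

Let waddA : associative wadd.
Proof. by move=> u v w; apply: ssval_inj; rewrite /= addrA. Qed.
Let waddC : commutative wadd.
Proof. by move=> u v; apply: ssval_inj; rewrite /= addrC. Qed.
Let wadd0 : left_id w0 wadd.
Proof. by move=> u; apply: ssval_inj; rewrite /= add0r. Qed.
Let waddN : left_inverse w0 (wscale (-1)) wadd.
Proof. by move=> u; apply: ssval_inj; rewrite /= scaleN1r addNr. Qed.

HB.instance Definition _ :=
  GRing.isZmodule.Build subspace_type waddA waddC wadd0 waddN.

Let wscaleA l m u : wscale l (wscale m u) = wscale (l * m) u.
Proof. by apply: ssval_inj; rewrite /= scalerA. Qed.
Let wscale1 : left_id 1 wscale.
Proof. by move=> u; apply: ssval_inj; rewrite /= scale1r. Qed.
Let wscaleDr : right_distributive wscale +%R.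
Proof. by move=> l u v; apply: ssval_inj; rewrite /= scalerDr. Qed.
Let wscaleDl u : {morph wscale^~ u : l m / l + m}.
Proof. by move=> l m; apply: ssval_inj; rewrite /= scalerDl. Qed.

HB.instance Definition _ := GRing.Zmodule_isLmodule.Build R[i] subspace_type
  wscaleA wscale1 wscaleDr wscaleDl.

Let wnorm (u : subspace_type) : R[i] := (n u)%:C.

Let wnormD u v : wnorm (u + v) <= wnorm u + wnorm v.
Proof. by rewrite -rmorphD lecR n_add//; exact: ssvalP. Qed.
Let wnormZ l u : wnorm (l *: u) = `|l| * wnorm u.
Proof. by rewrite -cmodE -rmorphM -n_scale//; exact: ssvalP. Qed.
Let wnorm0 u : wnorm u = 0 -> u = 0.
Proof.
by move=> /complexI u0; apply: ssval_inj; apply: n_eq0 => //; exact: ssvalP.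
Qed.

HB.instance Definition _ := Lmodule_isNormed.Build R[i] subspace_type
  wnormD wnormZ wnorm0.

Let ssvalB (u v : subspace_type) : ssval (u - v) = ssval u - ssval v.
Proof. by rewrite -[in RHS]scaleN1r. Qed.

Let cnorm_ssval (u : subspace_type) : cnorm u = n u. Proof. by []. Qed.

Let wcomplete (F : set_system subspace_type) : ProperFilter F -> cauchy F -> cvg F.
Proof.
move=> FF /cauchyP Fc.
have [||l lS Fl] := n_complete (fmap_proper_filter ssval FF).
- by apply: nearW => u; exact: ssvalP.
- move=> e e0; have e0' : 0 < e%:C by rewrite ltcR.
  have [u Fu] := Fc _ e0'; exists u; first exact: ssvalP.
  suff : \forall w \near F, n (ssval w - ssval u) < e by [].
  apply: filterS Fu => w; rewrite -ball_normE /= -cnormE ltcR cnormBC cnorm_ssval.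
  by rewrite ssvalB.
apply/cvg_ex; exists (SubspaceType lS); apply/cvgrPdist_lt => e e0.
have eE : e = (complex.Re e)%:C by rewrite RRe_real// gtr0_real.
have {}Fl : \forall w \near F, n (ssval w - l) < complex.Re e.
  by apply: Fl; rewrite -ltcR -eE.
apply: filterS Fl => u; rewrite eE -cnormE ltcR cnormBC cnorm_ssval.
by rewrite ssvalB.
Qed.

HB.instance Definition _ := Uniform_isComplete.Build subspace_type wcomplete.

Let ssval_linear : linear ssval. Proof. by []. Qed.

HB.instance Definition _ :=
  GRing.isLinear.Build R[i] subspace_type V *:%R ssval ssval_linear.

Lemma banach_subspace (N : V -> \bar R) : (forall v, S v -> N v = (n v)%:E) ->
  is_banach_space N S.
Proof.
move=> NE; exists subspace_type, ssval; split => //.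
  apply/seteqP; split => [_ [w _ <-]|v vS]; first exact: ssvalP.
  by exists (SubspaceType vS).
by move=> w; rewrite NE//; exact: ssvalP.
Qed.

End BanachSubspace.

(** * The norm on bounded sections and its completeness *)

Section BoundedNorm.
Variables (R : realType) (G : etaleGroupoid) (B : fellBundle R G).
Implicit Types (g h k x : G) (F D E : {fset G}) (a b c d f u v w : sections B).
Implicit Types (K L M e : R).

Definition bnd a : R := fine (normb a).

Lemma bnd_bounded_by a : bounded_sections a -> bounded_by a (bnd a).
Proof. exact: normb_bounded_by. Qed.

Lemma bounded_by_bounded a K : bounded_by a K -> bounded_sections a.
Proof. by move=> aK; apply/bounded_sectionsP; exists K. Qed.

Lemma bnd_le a K : bounded_by a K -> bnd a <= K.
Proof.
move=> aK; have abd := bounded_by_bounded aK.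
by rewrite -lee_fin -normbE// normb_le.
Qed.

Lemma bnd_ge0 a : 0 <= bnd a.
Proof. exact/fine_ge0/normb_ge0. Qed.

Lemma bounded_by0 : bounded_by (0 : sections B) 0.
Proof.
split=> // x F D f xu; rewrite mul0r -(scale0r (0 : sections B)) sappZl.
by rewrite scale0r l2norm0.
Qed.

Lemma bounded_sections_subspace : is_subspace (@bounded_sections R G B).
Proof.
split; first exact: bounded_by_bounded bounded_by0.
move=> l a b /bnd_bounded_by aK /bnd_bounded_by bL.
exact: bounded_by_bounded (bounded_byD (bounded_byZ l aK) bL).
Qed.

Lemma bounded_sectionsB a b : bounded_sections a -> bounded_sections b ->
  bounded_sections (a - b).
Proof.
move=> /bnd_bounded_by aK /bnd_bounded_by bL.
exact: bounded_by_bounded (bounded_byB aK bL).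
Qed.

Lemma bnd_add a b : bounded_sections a -> bounded_sections b ->
  bnd (a + b) <= bnd a + bnd b.
Proof.
by move=> /bnd_bounded_by aK /bnd_bounded_by bL; exact: bnd_le (bounded_byD aK bL).
Qed.

(** [bounded_byZ] gives one inequality; the other is the same one for the inverse scalar. *)
Lemma bnd_scale (l : R[i]) a : bounded_sections a -> bnd (l *: a) = cmod l * bnd a.
Proof.
move=> /bnd_bounded_by aK; have laK := bounded_byZ l aK.
apply/le_anti; rewrite (bnd_le laK)/=.
have [->|l0] := eqVneq l 0; first by rewrite (cmodr 0) normr0 mul0r bnd_ge0.
have := bnd_le (bounded_byZ l^-1 (bnd_bounded_by (bounded_by_bounded laK))).
rewrite scalerA mulVf// scale1r => le.
have lp : 0 < cmod l.
  by rewrite lt_neqAle cmod_ge0 andbT eq_sym -(inj_eq (@complexI R)) cmodE normr_eq0.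
have lV : cmod l^-1 = (cmod l)^-1.
  by apply: complexI; rewrite cmodE fmorphV/= cmodE normfV.
by move: le; rewrite lV mulrC ler_pdivlMr// mulrC.
Qed.

Lemma bnd_eq0 a : bounded_sections a -> bnd a = 0 -> a = 0.
Proof.
move=> /bnd_bounded_by aK a0; apply: functional_extensionality_dep => g.
by apply: cnorm_le0; rewrite -a0; exact: bounded_by_pointwise.
Qed.

Lemma bounded_sections_star a : bounded_sections a -> bounded_sections (sstar a).
Proof. by move=> /bnd_bounded_by/bounded_by_star/bounded_by_bounded. Qed.

Lemma bnd_star a : bounded_sections a -> bnd (sstar a) = bnd a.
Proof.
move=> ab; have ab' := bounded_sections_star ab.
have := bnd_le (bounded_by_star (bnd_bounded_by ab')); rewrite sstarK => le1.
have le2 := bnd_le (bounded_by_star (bnd_bounded_by ab)).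
exact: (le_anti (introT andP (conj le2 le1))).
Qed.

Lemma sapp_small a D f g e : (forall h, h \in D -> cnorm (a (gdiv g h)) <= e) ->
  0 <= e -> cnorm (sapp a D f g) <= e * \sum_(h <- D) cnorm (f h).
Proof.
move=> ae e0; rewrite mulr_sumr (le_trans (cnorm_sum _ _ _))//.
rewrite [leRHS](bigID (fun h => gsource h == gsource g))/= -[leLHS]addr0 lerD//.
  rewrite big_seq_cond [leRHS]big_seq_cond; apply: ler_sum => h /andP[hD /eqP hg].
  rewrite (le_trans (cnorm_fmul _ _ _))//; first exact: gprod_div.
  by rewrite ler_wpM2r ?cnorm_ge0// ae.
by apply: sumr_ge0 => h _; rewrite mulr_ge0 ?cnorm_ge0.
Qed.

(** For finite [F] and [D] only the values at the finitely many arrows [gdiv g h] matter. Some [v]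
    near the limit satisfies the bound and is close to [l] at all of them. *)
Lemma bounded_by_near (X : set_system (sections B)) u (l : sections B) e : ProperFilter X ->
  0 <= e -> (\forall v \near X, bounded_by (u - v) e) ->
  (forall g e', 0 < e' -> \forall v \near X, cnorm (v g - l g) < e') ->
  bounded_by (u - l) e.
Proof.
move=> FX e0 ue lP; split=> // x F D f xu; apply/ler_addgt0Pr => e1 e10.
set C := \sum_(h <- D) cnorm (f h).
have C0 : 0 <= C by apply: sumr_ge0 => h _; exact: cnorm_ge0.
pose M := (size F)%:R * C + 1.
have M0 : 0 < M by rewrite ltr_wpDl// mulr_ge0.
pose t := e1 / M; have t0 : 0 < t by rewrite divr_gt0.
pose Q g h (v : sections B) : Prop := cnorm (v (gdiv g h) - l (gdiv g h)) < t.
have near1 : \forall v \near X, forall g, g \in enum_fset F ->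
    forall h, h \in enum_fset D -> Q g h v.
  apply: near_all_seq => g _; apply: (near_all_seq (Q := Q g)) => h _.
  exact: lP.
have [v [vF [_ uv]]] := filter_ex (filterI near1 ue).
have -> : u - l = (u - v) + (v - l) by rewrite addrA subrK.
rewrite sappDl (le_trans (l2normD _ _ _ xu))//; apply: lerD; first exact: uv.
have tC : 0 <= t * C by rewrite mulr_ge0// ltW.
rewrite (le_trans (l2norm_small tC _))//.
  move=> g gF _; apply: sapp_small; last exact: ltW.
  by move=> h hD; rewrite sectionsD sectionsN ltW// vF.
rewrite mulrCA /t mulrAC ler_pdivrMr// ler_wpM2l ?(ltW e10)//.
by rewrite lerDl ler01.
Qed.

(** Fibrewise norms are dominated by [bnd], so the limit exists in every fibre; [bounded_by_near]
    then upgrades pointwise to norm convergence. *)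
Lemma bounded_sections_complete (X : set_system (sections B)) :
  ProperFilter X -> X (@bounded_sections R G B) ->
  (forall e, 0 < e -> exists2 v, bounded_sections v &
     \forall u \near X, bnd (u - v) < e) ->
  exists2 l, bounded_sections l &
    forall e, 0 < e -> \forall u \near X, bnd (u - l) < e.
Proof.
move=> FX Xb Xc.
have pw g : exists p : fibre B g, forall e, 0 < e ->
    \forall u \near X, cnorm (u g - p) < e.
  have [|p pX] := @cnorm_cauchy_cvg _ (fibre B g) ((fun u => u g) @ X) _.
    move=> e e0; have [v vb vX] := Xc e e0; exists (v g).
    suff : \forall u \near X, cnorm (u g - v g) < e by [].
    apply: filterS2 Xb vX => u ub; apply: le_lt_trans.
    have := bounded_by_pointwise g (bnd_bounded_by (bounded_sectionsB ub vb)).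
    by rewrite sectionsD sectionsN.
  by exists p.
pose l : sections B := fun g => sval (cid (pw g)).
have lP g e' : 0 < e' -> \forall v \near X, cnorm (v g - l g) < e'.
  by move=> e0; rewrite /l; case: cid => p /= pX; exact: pX.
have vl v e : bounded_sections v -> 0 < e -> (\forall u \near X, bnd (u - v) < e) ->
    bounded_by (v - l) e.
  move=> vb e0 vX; apply: (bounded_by_near (X := X)) => //; first exact: ltW.
  apply: filterS2 Xb vX => u ub uv.
  apply: bounded_byW (ltW uv) _; rewrite -opprB; apply: bounded_byN.
  exact/bnd_bounded_by/bounded_sectionsB.
exists l.
  have [v vb /(vl v 1 vb ltr01) vl1] := Xc 1 ltr01.
  have -> : l = v - (v - l) by zmod.
  exact/bounded_sectionsB/(bounded_by_bounded vl1).
move=> e e0; have e2 : 0 < e / 2 by rewrite divr_gt0.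
have [v vb vX] := Xc _ e2; have vl1 := vl v _ vb e2 vX.
apply: filterS2 Xb vX => u ub uv.
have -> : u - l = (u - v) + (v - l) by rewrite addrA subrK.
apply: (le_lt_trans (bnd_add (bounded_sectionsB ub vb) (bounded_by_bounded vl1))).
by rewrite [ltRHS]splitr; apply: ltr_leD; [exact: uv|exact: bnd_le].
Qed.

(** [bounded_by_l2norm] makes the approximation uniform over all finite sets, so tails of [a]
    inherit smallness from tails of [b]. *)
Lemma column_summable_lim a : (forall e, 0 < e ->
    exists2 b, column_summable b & bounded_by (b - a) e) -> column_summable a.
Proof.
move=> H x e xu e0; have e2 : 0 < e / 2 by rewrite divr_gt0.
have [b bc ba] := H _ e2; have [D0 HD] := bc x _ xu e2; exists D0 => D /HD bD.
have -> : a = b - (b - a) by zmod.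
rewrite (le_lt_trans (l2normB _ _ _ xu))// [ltRHS]splitr.
by apply: ltr_leD; [exact: bD|exact: bounded_by_l2norm].
Qed.

Lemma big_algebra_bounded a : big_algebra a -> bounded_sections a.
Proof. by case. Qed.

Lemma big_algebra_star a : big_algebra a -> big_algebra (sstar a).
Proof.
move=> /big_algebraP[ab a1 a2]; apply/big_algebraP; split; first exact: bounded_sections_star.
  exact: a2.
by rewrite sstarK; exact: a1.
Qed.

Lemma big_algebra_subspace : is_subspace (@big_algebra R G B).
Proof.
have [b0 bD] := bounded_sections_subspace.
split.
  apply/big_algebraP; split; [exact: b0|exact: column_summable0|].
  by rewrite -(scale0r (0 : sections B)) sstarZ rmorph0 scale0r; exact: column_summable0.
move=> l a b /big_algebraP[ab a1 a2] /big_algebraP[bb b1 b2].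
apply/big_algebraP; split; first exact: bD.
  by apply: column_summableD b1; exact: column_summableZ.
by rewrite sstarD sstarZ; apply: column_summableD b2; exact: column_summableZ.
Qed.

Lemma big_algebra_complete (X : set_system (sections B)) :
  ProperFilter X -> X (@big_algebra R G B) ->
  (forall e, 0 < e -> exists2 v, big_algebra v & \forall u \near X, bnd (u - v) < e) ->
  exists2 l, big_algebra l & forall e, 0 < e -> \forall u \near X, bnd (u - l) < e.
Proof.
move=> FX XA Xc; have [||l lb lX] := bounded_sections_complete FX.
- by apply: filterS XA => u; exact: big_algebra_bounded.
- by move=> e /Xc[v /big_algebra_bounded vb vX]; exists v.
exists l => //.
have approx e : 0 < e -> exists2 u, big_algebra u & bounded_by (u - l) e.
  move=> /lX /(filterI XA)/filter_ex[u [uA ul]]; exists u => //.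
  apply: bounded_byW (ltW ul) _; apply: bnd_bounded_by.
  exact: bounded_sectionsB (big_algebra_bounded uA) lb.
apply/big_algebraP; split; first exact: lb.
  apply: column_summable_lim => e /approx[u /big_algebraP[_ u1 _] ul].
  by exists u; [exact: u1|exact: ul].
apply: column_summable_lim => e /approx[u /big_algebraP[_ _ u2] ul].
exists (sstar u); first exact: u2.
by rewrite -sstarN -sstarD; exact: bounded_by_star.
Qed.

Lemma bounded_sections_banach : is_banach_space (@normb R G B) (@bounded_sections R G B).
Proof.
apply: (banach_subspace bounded_sections_subspace bnd_add bnd_scale bnd_eq0
  bounded_sections_complete) => v.
exact: normbE.
Qed.

Lemma big_algebra_banach : is_banach_space (@normb R G B) (@big_algebra R G B).
Proof.
have sub := big_algebra_bounded.
apply: (banach_subspace big_algebra_subspace _ _ _ big_algebra_complete).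
- by move=> a b /sub ab /sub bb; exact: bnd_add.
- by move=> l a /sub; exact: bnd_scale.
- by move=> a /sub; exact: bnd_eq0.
- by move=> a /sub; exact: normbE.
Qed.

(** * Products of bounded sections with elements of the big algebra *)

Lemma conv_mull a m g : big_algebra a -> bounded_sections m ->
  has_conv a m (convolution a m g).
Proof. by move=> /big_algebraP[_ _ ac] mb; exact: convolution_row. Qed.

Lemma conv_mulr a m g : big_algebra a -> bounded_sections m ->
  has_conv m a (convolution m a g).
Proof. by move=> /big_algebraP[_ ac _] mb; exact: convolution_col. Qed.

Lemma bounded_by_convolution a b : bounded_sections a -> bounded_sections b ->
  (forall g, has_conv a b (convolution a b g)) ->
  bounded_by (convolution a b) (bnd a * bnd b).
Proof.
by move=> /bnd_bounded_by aK /bnd_bounded_by bL; exact: bounded_by_conv.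
Qed.

Lemma normb_convolution a b : bounded_sections a -> bounded_sections b ->
  (forall g, has_conv a b (convolution a b g)) ->
  (normb (convolution a b) <= normb a * normb b)%E.
Proof.
move=> ab bb abE; rewrite (normbE ab) (normbE bb) -EFinM.
exact/normb_le/bounded_by_convolution.
Qed.

Lemma sstar_convolution a b : (forall g, has_conv a b (convolution a b g)) ->
  sstar (convolution a b) = convolution (sstar b) (sstar a).
Proof.
move=> abE; apply: functional_extensionality_dep => g; apply/esym/convolutionE.
have := has_conv_star (abE (ginv g)).
by rewrite /sstar ginvK.
Qed.

Lemma convolution_linearl (l : R[i]) a b c :
  (forall g, has_conv a c (convolution a c g)) ->
  (forall g, has_conv b c (convolution b c g)) ->
  convolution (l *: a + b) c = l *: convolution a c + convolution b c.
Proof.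
move=> acE bcE; apply: functional_extensionality_dep => g; apply: convolutionE.
exact: (has_convDl (has_convZl l (acE g)) (bcE g)).
Qed.

Lemma convolution_linearr (l : R[i]) a b c :
  (forall g, has_conv c a (convolution c a g)) ->
  (forall g, has_conv c b (convolution c b g)) ->
  convolution c (l *: a + b) = l *: convolution c a + convolution c b.
Proof.
move=> acE bcE; apply: functional_extensionality_dep => g; apply: convolutionE.
exact: (has_convDr (has_convZr l (acE g)) (bcE g)).
Qed.

Lemma bounded_mull a m : big_algebra a -> bounded_sections m ->
  bounded_sections (convolution a m).
Proof.
move=> aA mb; apply: (bounded_by_bounded (bounded_by_convolution _ mb _)).
  exact: big_algebra_bounded.
by move=> g; exact: conv_mull.
Qed.

Lemma bounded_mulr a m : big_algebra a -> bounded_sections m ->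
  bounded_sections (convolution m a).
Proof.
move=> aA mb; apply: (bounded_by_bounded (bounded_by_convolution mb _ _)).
  exact: big_algebra_bounded.
by move=> g; exact: conv_mulr.
Qed.

Lemma column_summable_mul a b : big_algebra a -> big_algebra b ->
  column_summable (convolution a b).
Proof.
move=> aA bA; have [ab a1 _] := (big_algebraP a).1 aA.
have [bb b1 _] := (big_algebraP b).1 bA.
apply: (column_summable_has_conv (bnd_bounded_by ab) a1 b1) => g.
exact: conv_mull.
Qed.

Lemma big_algebra_mul a b : big_algebra a -> big_algebra b ->
  big_algebra (convolution a b).
Proof.
move=> aA bA; have bb := big_algebra_bounded bA.
apply/big_algebraP; split; first exact: bounded_mull.
  exact: column_summable_mul.
rewrite sstar_convolution; last by move=> g; exact: conv_mull.
by apply: column_summable_mul; exact: big_algebra_star.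
Qed.

(** The summable factor [c] stands on the right, and the other two are merely bounded with
    convergent products; this serves both for (m a) b and for (a m) b. *)
Lemma convolutionA_right a b c : bounded_sections a -> bounded_sections b ->
  big_algebra c ->
  (forall g, has_conv a b (convolution a b g)) ->
  (forall g, has_conv a (convolution b c) (convolution a (convolution b c) g)) ->
  convolution (convolution a b) c = convolution a (convolution b c).
Proof.
move=> ab bb cA abE abcE; have [_ cc _] := (big_algebraP c).1 cA.
apply: (has_conv_assoc (bnd_bounded_by ab) (bnd_bounded_by bb) cc abE _ _ abcE).
  by move=> g; exact: conv_mulr.
move=> g; apply: (conv_mulr g cA).
exact: bounded_by_bounded (bounded_by_convolution ab bb abE).
Qed.

(** With the bounded factor on the right, summability is available for rows only; the involution
    reverses the order and reduces to [convolutionA_right]. *)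
Lemma convolutionA_left a b m : big_algebra a -> big_algebra b ->
  bounded_sections m ->
  convolution (convolution a b) m = convolution a (convolution b m).
Proof.
move=> aA bA mb; rewrite -[LHS]sstarK -[RHS]sstarK; congr sstar.
have ab := big_algebra_bounded aA; have bb := big_algebra_bounded bA.
have abA := big_algebra_mul aA bA; have bmb := bounded_mull bA mb.
have sA := big_algebra_star aA; have sB := big_algebra_star bA.
have sm := bounded_sections_star mb; have sbb := bounded_sections_star bb.
rewrite [LHS]sstar_convolution; last by move=> g; exact: (conv_mull g abA mb).
rewrite (@sstar_convolution a b); last by move=> g; exact: (conv_mull g aA bb).
rewrite [RHS]sstar_convolution; last by move=> g; exact: (conv_mull g aA bmb).
rewrite (@sstar_convolution b m); last by move=> g; exact: (conv_mull g bA mb).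
apply/esym; apply: (convolutionA_right sm sbb sA) => g.
  exact: (conv_mulr g sB sm).
exact: (conv_mulr g (big_algebra_mul sB sA) sm).
Qed.

End BoundedNorm.

(** [convolution] is a total function whose values carry meaning only where the sums converge; the
    separate first conjunct ensures that the module actions are genuine convolutions. *)
Theorem corollary3p6 (R : realType) (G : etaleGroupoid) (B : fellBundle R G) :
  (forall a m : sections B, big_algebra a -> bounded_sections m ->
     convolution_defined a m /\ convolution_defined m a) /\
  is_banach_star_bimodule (@normb R G B) (@sstar R G B) (@convolution R G B)
    (@big_algebra R G B) (@bounded_sections R G B).
Proof.
have sub := @big_algebra_bounded R G B.
have mulA_r (m a b : sections B) : bounded_sections m -> big_algebra a -> big_algebra b ->
    convolution (convolution m a) b = convolution m (convolution a b).
  move=> mb aA bA; apply: (convolutionA_right mb (sub _ aA) bA) => g.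
    exact: (conv_mulr g aA mb).
  exact: (conv_mulr g (big_algebra_mul aA bA) mb).
have mulA_m (a m b : sections B) : big_algebra a -> bounded_sections m -> big_algebra b ->
    convolution (convolution a m) b = convolution a (convolution m b).
  move=> aA mb bA; apply: (convolutionA_right (sub _ aA) mb bA) => g.
    exact: (conv_mull g aA mb).
  exact: (conv_mull g aA (bounded_mulr bA mb)).
have sZ (S : set (sections B)) : (forall u, S u -> S (sstar u)) ->
    is_involution (@sstar R G B) S.
  move=> SS; split=> [//|u _|l u v _ _]; first exact: sstarK.
  by rewrite sstarD sstarZ.
split.
  move=> a m aA mb; split; apply/convolution_definedP => g.
    by exists (convolution a m g); exact: conv_mull.
  by exists (convolution m a g); exact: conv_mulr.
split.
- split.
  + exact: sub.
  + split.
    * exact: big_algebra_subspace.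
    * exact: big_algebra_mul.
    * move=> l a b c aA bA /sub cb.
      by apply: convolution_linearl => g; exact: conv_mull.
    * move=> l a b c aA bA /sub cb.
      by apply: convolution_linearr => g; exact: conv_mulr.
    * by move=> a b c /sub ab bA cA; exact: mulA_r.
  + split.
    * exact: bounded_sections_subspace.
    * exact: bounded_mull.
    * by move=> m a mb aA; exact: bounded_mulr.
    * move=> l a b m aA bA mb.
      by apply: convolution_linearl => g; exact: conv_mull.
    * move=> l a m n aA mb nb.
      by apply: convolution_linearr => g; exact: conv_mull.
    * move=> l m n a mb nb aA.
      by apply: convolution_linearl => g; exact: conv_mulr.
    * move=> l m a b mb aA bA.
      by apply: convolution_linearr => g; exact: conv_mulr.
    * exact: convolutionA_left.
    * exact: mulA_r.
    * exact: mulA_m.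
  + exact: big_algebra_banach.
  + exact: bounded_sections_banach.
  + move=> a m aA mb; apply: (normb_convolution (sub _ aA) mb) => g.
    exact: (conv_mull g aA mb).
  + move=> m a mb aA; apply: (normb_convolution mb (sub _ aA)) => g.
    exact: (conv_mulr g aA mb).
- by apply: sZ; exact: big_algebra_star.
- by apply: sZ; exact: bounded_sections_star.
- move=> m mb; rewrite (normbE mb) (normbE (bounded_sections_star mb)).
  exact: (congr1 EFin (bnd_star mb)).
- by move=> a m aA mb; apply: sstar_convolution => g; exact: conv_mull.
- by move=> m a mb aA; apply: sstar_convolution => g; exact: conv_mulr.
Qed.
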